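(* Let $r$ be a nonconstant symmetric rational function, let $Q\in\mathcal N_0^0(r)$, $Q\neq0$, and denote the zeros and poles of $r$ in $\mathbb R\cup\{\infty\}$ by $a_i$ and $b_i$, $1\le i\le n$, where $a_n=\infty$ or $b_n=\infty$ if $\infty$ is a zero or a pole of $r$. (In the sums and characteristic functions below the indices run over the distinct finite zeros, respectively the distinct finite poles, each counted once.) Let $Q$ be realized by the boundary triplet $\{\mathbb C,\Gamma_0^{\omega,\eta_{b_1}},\Gamma_1^{\omega,\eta_{b_1}}\}$ associated with $S_\omega^*$ in the Hilbert space $\mathfrak H_{\sigma,\beta}$, where $\omega\times1=\frac1{t-b_1}\times1\in\mathfrak H_{-1}(A_{\sigma,\beta},b_1)$ if $b_1\in\mathbb R$, and $\omega\times1=1\times1\in\mathfrak H_{-1}(A_{\sigma,\beta},\infty)$ if $b_1=\infty$. With $\zeta_{b_i}=\lim_{\lambda\widehat\to b_i}(b_i-\lambda)r(\lambda)Q(\lambda)$ for $b_i\in\mathbb R$, $\zeta_\infty=\lim_{\lambda\widehat\to\infty}r(\lambda)Q(\lambda)/\lambda$ and $\gamma=\lim_{\lambda\to\infty}r(\lambda)$ (when $a_n,b_n\in\mathbb R$), define $$\begin{cases}d\sigma_e=\mathbf 1^c_{\{a_1,\dots,a_n\}}d\sigma+\sum_{i=1}^n\delta_{b_i},\quad \beta_e=\gamma\beta, & b_n,a_n\in\mathbb R;\\ d\sigma_e=\mathbf 1^c_{\{a_1,\dots,a_n\}}d\sigma+\sum_{i=1}^{n-1}\delta_{b_i},\quad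 \beta_e=\zeta_{b_n}, & b_n=\infty,\ a_n\in\mathbb R;\\ d\sigma_e=\mathbf 1^c_{\{a_1,\dots,a_{n-1}\}}d\sigma+\sum_{i=1}^n\delta_{b_i},\quad \beta_e=0, & b_n\in\mathbb R,\ a_n=\infty,\end{cases}$$ and $$\omega_e(t)=\begin{cases}\dfrac{\mathbf 1^c_{\{b_1,\dots,b_n\}}}{t-a_n}\sqrt{|r(t)|}+\displaystyle\sum_{i=1}^n\frac{\mathbf 1_{\{b_i\}}\sqrt{\zeta_{b_i}}}{b_i-a_n}, & b_n,a_n\in\mathbb R;\\ \dfrac{\mathbf 1^c_{\{b_1,\dots,b_{n-1}\}}}{t-a_n}\sqrt{|r(t)|}+\displaystyle\sum_{i=1}^{n-1}\frac{\mathbf 1_{\{b_i\}}\sqrt{\zeta_{b_i}}}{b_i-a_n}, & b_n=\infty,\ a_n\in\mathbb R;\\ \mathbf 1^c_{\{b_1,\dots,b_n\}}\sqrt{|r(t)|}+\displaystyle\sum_{i=1}^n\sqrt{\mathbf 1_{\{b_i\}}\zeta_{b_i}}, & b_n\in\mathbb R,\ a_n=\infty.\end{cases}$$ Then $\omega_e\times1\in\mathfrak H_{-1}(A_{\sigma_e,\beta_e},a_n)$ and, with $\eta_{a_n}=\lim_{\lambda\widehat\to a_n}r(\lambda)Q(\lambda)$, the Nevanlinna function $rQ$ is realized by the boundary triplet $\{\mathbb C,\Gamma_0^{\omega_e,\eta_{a_n}},\Gamma_1^{\omega_e,\eta_{a_n}}\}$ associated with $S_{\omega_e}^*$ in the Hilbert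 space $\mathfrak H_{\sigma_e,\beta_e}$.
   Context: $\mathcal N$: functions $Q$ holomorphic on $\mathbb C\setminus\mathbb R$ with $Q(\bar z)=\overline{Q(z)}$ and $\operatorname{Im}Q(z)/\operatorname{Im}z\ge0$. $\mathcal N_0^0(r)=\{Q\in\mathcal N:rQ\in\mathcal N\}$; for $0\ne Q\in\mathcal N_0^0(r)$ all finite zeros and poles of $r$ are real and of order at most two. $\lambda\widehat\to\xi$ denotes nontangential (sectorial for $\xi=\infty$) limits. For $E\subset\mathbb R\cup\{\infty\}$, $\mathbf 1_E$ and $\mathbf 1_E^c$ are the characteristic functions of $E\cap\mathbb R$ and $\mathbb R\setminus E$; $\delta_b$ is the unit point mass at $b$. For $\beta\ge0$ and a nonnegative measure $\sigma$ on $\mathbb R$ with $\int d\sigma(t)/(1+t^2)<\infty$, $\mathfrak H_{\sigma,\beta}$ is the Hilbert space $L^2(d\sigma)\times\mathbb C$ with $(f\times f_\infty,g\times g_\infty)=\bar g_\infty\beta f_\infty+\int\bar g f\,d\sigma$, modulo elements of norm zero (so it is $L^2(d\sigma)$ if $\beta=0$). $A_{\sigma,\beta}=\{\{f(t)\times0,\ tf(t)\times f_\infty\}\in\mathfrak H_{\sigma,\beta}^2\}$ is a selfadjoint relation in it. Rigged spaces for a selfadjoint relation $A=A_o\oplus(\{0\}\times\operatorname{mul}A)$ in $\mathfrak H$ ($A_o$ the selfadjoint operator part in $\mathfrak H\ominus\operatorname{mul}A$, $P_\infty$ the orthogonal projection onto $\mathfrak H\ominus\operatorname{mul}A$): $\mathfrak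 H_{+1}(A,\infty)=\operatorname{dom}|A_o|^{1/2}\oplus\operatorname{mul}A$ with inner product $(f,g)+(|A_o|^{1/2}P_\infty f,|A_o|^{1/2}P_\infty g)$; $\mathfrak H_{-1}(A,\infty)$ is the completion of $\mathfrak H$ with respect to $((I-P_\infty)f,g)+((I+|A_o|)^{-1}P_\infty f,P_\infty g)$; $\mathfrak H_{\pm1}(A,\xi)=\mathfrak H_{\pm1}((A-\xi)^{-1},\infty)$ for $\xi\in\mathbb R$; $(\cdot,\cdot)_\xi$ is the continuous extension of $(\cdot,\cdot)$ to $\mathfrak H_{+1}(A,\xi)\times\mathfrak H_{-1}(A,\xi)$. For $A=A_{\sigma,\beta}$ these are weighted $L^2(d\sigma)$-type spaces and $(f\times f_\infty,g\times g_\infty)_\xi=\bar g_\infty\beta f_\infty+\int\bar gf\,d\sigma$. $A_\infty$ is the closure of $A$ as a relation from $\mathfrak H_{+1}(A,\infty)$ to $\mathfrak H_{-1}(A,\infty)$; for $\xi\in\mathbb R$, $(A-\xi)_\xi^{-1}$ is the closure of $(A-\xi)^{-1}$ as a relation from $\mathfrak H_{+1}(A,\xi)$ to $\mathfrak H_{-1}(A,\xi)$, and $(A-\xi)_\xi=((A-\xi)^{-1}_\xi)^{-1}$. Boundary triplets. For $w\in\mathfrak H_{-1}(A,\xi)$, $\eta\in\mathbb R$: if $\xi=\infty$, $S_w=\{\{f,f'\}\in A:(f,w)_\infty=0\}$, $S_w^*=\{\{f,f'-cw\}\in\mathfrak H^2:\{f,f'\}\in A_\infty,c\in\mathbb C\}$,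 $\Gamma_0^{w,\eta}=c$, $\Gamma_1^{w,\eta}=\eta c+(f,w)_\infty$, with Weyl function $M(\lambda)=\eta+((A_\infty-\lambda)^{-1}w,w)_\infty$; if $\xi\in\mathbb R$, $S_w=\{\{f,f'\}\in A:(f'-\xi f,w)_\xi=0\}$, $S_w^*=\{\{f+cw,f'+\xi f+\xi cw\}\in\mathfrak H^2:\{f,f'\}\in(A-\xi)_\xi,c\in\mathbb C\}$, $\Gamma_0^{w,\eta}=c$, $\Gamma_1^{w,\eta}=\eta c+(f',w)_\xi$, with Weyl function $M(\lambda)=\eta+(\lambda-\xi)((I+(\xi-\lambda)(A-\xi)_\xi^{-1})^{-1}w,w)_\xi$. A function is realized by this boundary triplet if it equals $M$ on $\rho(A)$. In the degenerate case $w\in\ker(A-\xi)$ ($\xi\in\mathbb R$) or $w\in\operatorname{mul}A$ ($\xi=\infty$), $S_w=A$ and $M\equiv\eta$ (constant functions may occur; the triplet is then a so-called boundary relation). In the theorem, $w=\omega\times1$, $A=A_{\sigma,\beta}$, $\xi=b_1$, $\eta_{b_1}=\lim_{\lambda\widehat\to b_1}Q(\lambda)$, and $w=\omega_e\times1$, $A=A_{\sigma_e,\beta_e}$, $\xi=a_n$; the subscripts/superscripts $\omega$, $\omega_e$ refer to these elements. *)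

(* Defs.v *)
From HB Require Import structures.
From mathcomp Require Import all_boot all_order all_algebra.
From mathcomp Require Import complex.
From mathcomp Require Import all_classical all_reals all_analysis.
Import Order.TTheory GRing.Theory Num.Theory.
Import numFieldNormedType.Exports.
Set Implicit Arguments.
Unset Strict Implicit.
Unset Printing Implicit Defensive.
Local Open Scope classical_set_scope.
Local Open Scope ring_scope.
Local Open Scope complex_scope.

(* Conventions.
   - The complex plane is R[i]^o: the regular-algebra alias carries the topology
     and the notion [derivable] (here: complex differentiability).
   - A point of the extended real line is an [option R]; None is infinity. *)

Section Limits.
Context {R : realType}.
Local Notation C := (R[i]^o).

Definition nonreal : set C := [set z | complex.Im z != 0].

Definition cinfty : set_system C :=
  [set U | exists M : R, forall z : C, M%:C < `|z| -> U z].

Definition nbhs_ext (xi : option R) : set_system C :=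
  if xi is Some x then nbhs (x%:C : C) else cinfty.

Definition stolz (x K : R) : set C :=
  [set z | nonreal z /\ `|complex.Re z - x| <= K * `|complex.Im z|].

(* The filter of nontangential approach to xi, from both half-planes: the limit
   along it exists iff the limits along all Stolz angles exist and agree. *)
Definition nontangential (xi : option R) : set_system C :=
  [set U | forall K : R, within (stolz (odflt 0 xi) K) (nbhs_ext xi) U].

(* All limits below are limits of functions f with f(z^* ) = f(z)^* along filters
   invariant under conjugation, hence they are real. *)
Definition rlim (F : set_system C) (f : C -> C) : R :=
  complex.Re (lim (f z @[z --> F])).

End Limits.

Section Nevanlinna.
Context {R : realType}.
Local Notation C := (R[i]^o).

Record nevanlinna (Q : C -> C) : Prop := Nevanlinna {
  nevanlinna_holomorphic : forall z, nonreal z -> derivable Q z 1 ;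
  nevanlinna_symmetric : forall z, nonreal z -> Q (conjc z) = conjc (Q z) ;
  nevanlinna_Im_ge0 :
    forall z, nonreal z -> 0 <= complex.Im (Q z) / complex.Im z }.

Record ratfun := RatFun {
  rnum : {poly R[i]} ;
  rden : {poly R[i]} ;
  _ : rden != 0 ;
  _ : coprimep rnum rden }.

Definition reval (r : ratfun) (z : C) : C := (rnum r).[z] / (rden r).[z].

Definition rsymmetric (r : ratfun) : Prop :=
  forall z : R[i], (rden r).[z] != 0 -> (rden r).[conjc z] != 0 ->
  reval r (conjc z) = conjc (reval r z).

Definition rnonconstant (r : ratfun) : Prop :=
  forall c : R[i], rnum r != c *: rden r.

Definition zero_order (r : ratfun) (xi : option R) : nat :=
  if xi is Some x then mup x%:C (rnum r)
  else (size (rden r) - size (rnum r))%N.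

Definition pole_order (r : ratfun) (xi : option R) : nat :=
  if xi is Some x then mup x%:C (rden r)
  else (size (rnum r) - size (rden r))%N.

Definition N00 (r : ratfun) (Q : C -> C) : Prop :=
  nevanlinna Q /\ nevanlinna (fun z => reval r z * Q z).

End Nevanlinna.

Section LinearRelations.
Context {R : realType} {V : lmodType R[i]}.
Implicit Types T : set (V * V).

(* A space of representatives: elements x, y with [ip (x - y) (x - y) = 0] stand
   for the same vector. The relations below are closed under this equivalence. *)
Record ipspace := IPSpace {
  icar :> V -> Prop ;
  ip : V -> V -> R[i]^o }.

Definition nrm2 (K : ipspace) (x : V) : R := complex.Re (ip K x x).

Definition rinv T : set (V * V) := [set p | T (p.2, p.1)].

(* T - l *)
Definition rsub T (l : R[i]) : set (V * V) :=
  [set p | T (p.1, p.2 + l *: p.1)].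

(* I + c T *)
Definition rIadd (c : R[i]) T : set (V * V) :=
  [set p | exists2 y, T (p.1, y) & p.2 = p.1 + c *: y].

Definition rclosure (K L : ipspace) T : set (V * V) :=
  [set p | [/\ K p.1, L p.2 & forall e : R, 0 < e ->
     exists q, [/\ T q, K q.1, L q.2,
       nrm2 K (p.1 - q.1) < e & nrm2 L (p.2 - q.2) < e]]].

Definition resolvent_set (K : ipspace) T : set R[i]^o :=
  [set l | (forall y, K y -> exists x, rinv (rsub T l) (y, x)) /\
     exists M : R, forall x y, rinv (rsub T l) (y, x) -> nrm2 K x <= M * nrm2 K y].

Record boundary_triplet := BoundaryTriplet {
  bt_resolvent : set R[i]^o ;
  bt_sym : set (V * V) ;
  bt_adj : set (V * V) ;
  (* the graph of (Gamma_0, Gamma_1) on bt_adj *)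
  bt_Gamma : set ((V * V) * (R[i] * R[i])) ;
  bt_weyl : R[i]^o -> set R[i]^o }.

(* Q is only given off the real line; at real points of the resolvent set the
   equality is understood for its continuous (= holomorphic) extension. *)
Definition realized (Q : R[i]^o -> R[i]^o) (B : boundary_triplet) : Prop :=
  forall l, bt_resolvent B l -> exists2 m, bt_weyl B l m &
    (nonreal l -> Q l = m) /\ Q z @[z --> within nonreal (nbhs l)] --> m.

End LinearRelations.

Section Model.
Context {R : realType}.
Local Notation C := (R[i]^o).
Local Notation V := ((R -> C) * C)%type.
Variables (sigma : {measure set R -> \bar R}) (beta : R).
Implicit Types (x y w : V) (xi : option R).

Definition admissible : Prop :=
  0 <= beta /\ (\int[sigma]_t ((1 + t ^+ 2)^-1)%:E < +oo)%E.

Definition cmeasurable (f : R -> C) : Prop :=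
  measurable_fun setT (fun t => complex.Re (f t)) /\
  measurable_fun setT (fun t => complex.Im (f t)).

Definition cintegral (f : R -> C) : C :=
  (\int[sigma]_t complex.Re (f t)) +i* (\int[sigma]_t complex.Im (f t)).

Definition sqintegrable (k : R -> R) (f : R -> C) : Prop :=
  cmeasurable f /\
  (\int[sigma]_t (k t * (complex.Re (f t) ^+ 2 + complex.Im (f t) ^+ 2))%:E
     < +oo)%E.

Definition pairing x y : C :=
  conjc y.2 * beta%:C * x.2 + cintegral (fun t => conjc (y.1 t) * x.1 t).

Definition Hspace : ipspace :=
  IPSpace [set x : V | sqintegrable (fun=> 1) x.1] pairing.

Definition Arel : set (V * V) :=
  [set p | [/\ Hspace p.1, Hspace p.2 & exists (f : R -> C) (finf : C),
     let u : V := (f, 0) in let v : V := (fun t => t%:C * f t, finf) in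
     [/\ Hspace u, Hspace v, nrm2 Hspace (p.1 - u) = 0
       & nrm2 Hspace (p.2 - v) = 0]]].

(* Let B = A if xi = None and B = (A - x)^-1 if xi = Some x. The modulus |B_o| of
   the operator part of B, precomposed with the projection onto the complement
   of mul B, is multiplication by [absval xi] on L^2(sigma) and 0 on the component
   at infinity. Indeed
   - for B = A, mul A is the component at infinity;
   - for B = (A - x)^-1, the component at infinity is in ker B, and mul B = ker (A - x)
     consists of the functions supported in {x}, where 0^-1 = 0 gives the value 0. *)
Definition absval xi (t : R) : R :=
  if xi is Some x then `|t - x|^-1 else `|t|.

Definition sqrtabs xi x : V :=
  (fun t => (Num.sqrt (absval xi t))%:C * x.1 t, 0).

Definition Hplus xi : ipspace :=
  IPSpace [set x | Hspace x /\ Hspace (sqrtabs xi x)]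
    (fun x y => pairing x y + pairing (sqrtabs xi x) (sqrtabs xi y)).

(* The completion of Hspace with respect to
   (x, y) |-> ((I - P) x, y) + ((I + |B_o|)^-1 P x, P y),
   realized as a space of functions, i.e. as a weighted L^2-space. *)
Definition Hminus xi : ipspace :=
  IPSpace [set x : V | sqintegrable (fun t => (1 + absval xi t)^-1) x.1]
    (fun x y => pairing (fun t => ((1 + absval xi t)^-1)%:C * x.1 t, x.2) y).

Definition Ainf : set (V * V) := rclosure (Hplus None) (Hminus None) Arel.

(* the closure of (A - x)^-1 *)
Definition Rclos (x : R) : set (V * V) :=
  rclosure (Hplus (Some x)) (Hminus (Some x)) (rinv (rsub Arel x%:C)).

(* (A - x)_x *)
Definition Ashift (x : R) : set (V * V) := rinv (Rclos x).

Definition Ssym xi w : set (V * V) :=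
  [set p | Arel p /\
    if xi is Some x then pairing (p.2 - x%:C *: p.1) w = 0
    else pairing p.1 w = 0].

Definition Gamma xi w (eta : R) : set ((V * V) * (C * C)) :=
  [set g | Hspace g.1.1 /\ Hspace g.1.2 /\ exists (f f' : V) (c : C),
    if xi is Some x then
      [/\ Ashift x (f, f'),
          g.1 = (f + c *: w, f' + x%:C *: f + (x%:C * c) *: w)
        & g.2 = (c, eta%:C * c + pairing f' w)]
    else
      [/\ Ainf (f, f'), g.1 = (f, f' - c *: w)
        & g.2 = (c, eta%:C * c + pairing f w)]].

Definition weyl xi w (eta : R) (l : C) : set C :=
  [set m | if xi is Some x then
      exists2 f, rinv (rIadd (x%:C - l) (Rclos x)) (w, f) &
        m = eta%:C + (l - x%:C) * pairing f w
    else
      exists2 f, rinv (rsub Ainf l) (w, f) & m = eta%:C + pairing f w].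

Definition triplet xi w (eta : R) : boundary_triplet :=
  BoundaryTriplet (resolvent_set Hspace Arel) (Ssym xi w)
    [set p | exists c, Gamma xi w eta (p, c)] (Gamma xi w eta) (weyl xi w eta).

End Model.

Section ProductData.
Context {R : realType}.
Local Notation C := (R[i]^o).
Variables (r : @ratfun R) (Q : C -> C) (n : nat) (a b : n.+1.-tuple (option R)).
Variables (sigma : {measure set R -> \bar R}) (beta : R).

Definition finpts (s : seq (option R)) : seq R := undup (pmap id s).

Lemma measurable_finpts (s : seq (option R)) : measurable [set` finpts s].
Proof.
apply: countable_measurable => [x|]; first exact: measurable_set1.
exact/finite_set_countable/finite_seq.
Qed.

Definition omega (t : R) : C :=
  if tnth b ord0 is Some b1 then ((t - b1)^-1)%:C else 1.

Definition zeta (x : R) : R :=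
  rlim (nontangential (Some x)) (fun l => (x%:C - l) * reval r l * Q l).

Definition zeta_inf : R :=
  rlim (nontangential None) (fun l => reval r l * Q l / l).

Definition gamma_inf : R := rlim cinfty (reval r).

Definition sigma_e : {measure set R -> \bar R} :=
  measure_add (mrestr sigma (measurableC (measurable_finpts a)))
    (msum (fun k => \d_((finpts b)`_k)) (size (finpts b))).

Lemma sigma_eE (X : set R) :
  (sigma_e X = sigma (X `&` ~` [set` finpts a]) +
     \sum_(x <- finpts b) \d_x X)%E.
Proof.
apply: (eq_trans (measure_addE _ _ _)); congr (_ + _)%E.
by rewrite /msum (big_nth 0) big_mkord.
Qed.

Definition beta_e : R :=
  match tnth a ord_max, tnth b ord_max with
  | Some _, Some _ => gamma_inf * beta
  | Some _, None => zeta_inf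
  | None, _ => 0
  end.

Definition sqrtr (t : R) : R := Num.sqrt (complex.Re `|reval r (t%:C : C)|).

Definition omega_e (t : R) : C :=
  (match tnth a ord_max with
   | Some an =>
       \1_(~` [set` finpts b]) t / (t - an) * sqrtr t +
       \sum_(x <- finpts b) \1_[set x] t * Num.sqrt (zeta x) / (x - an)
   | None =>
       \1_(~` [set` finpts b]) t * sqrtr t +
       \sum_(x <- finpts b) Num.sqrt (\1_[set x] t * zeta x)
   end)%:C.

End ProductData.

(* Main.v *)
(** The Weyl function of the triplet of the element omega x 1 in the space of (sigma, beta) is a
    Cauchy transform Q z = al + be z + \int (1 / (t - z) - t / (1 + t^2)) dsigma, and conversely
    every function of this form with the density kap^2 |omega|^2 is such a Weyl function, because
    multiplication by (t - z)^-1 gives the resolvent and truncated elements approximate its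
    extension to the rigged spaces. So it suffices to represent r Q with the density r dsigma.
    Nonnegativity of Im (r Q) in the upper half-plane forces r >= 0 sigma-almost everywhere
    (where r < 0, Im Q (x + i y) is O(y), so sigma vanishes there) and
    sigma {b} = 0 at the poles. Cutting the density off away from the poles and from infinity,
    the minimum principle for harmonic functions shows that r Q minus the truncated integral
    still has nonnegative imaginary part; by monotone convergence r is integrable against
    dsigma / (1 + t^2). What remains of r Q is a rational function, by interpolation in z, and
    its poles are simple because Im (r Q) >= 0 along rays: it is A + B z + sum c_x / (x - z)
    with residues c_x = zeta_x >= 0 and B equal to beta_e. *)

Require Import Defs.
From HB Require Import structures.
From mathcomp Require Import all_boot all_order all_algebra.
From mathcomp Require Import complex ring lra.
From mathcomp Require Import all_classical all_reals all_analysis measurable_realfun.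
Import Order.TTheory GRing.Theory Num.Theory.
Import numFieldNormedType.Exports.
Set Implicit Arguments.
Unset Strict Implicit.
Unset Printing Implicit Defensive.
Local Open Scope classical_set_scope.
Local Open Scope ring_scope.
Local Open Scope complex_scope.

(** The obstacle is that [rQ] comes without an integral representation. Its measure is not recovered
    from boundary values: it is guessed as r dsigma plus point masses at the poles, and the
    difference is shown to be harmless. A direct comparison fails, since r is not known to be
    integrable against dsigma / (1 + t^2) near a pole or at infinity before the positivity of [rQ]
    is used; hence the truncations, and a minimum principle that asks only for lower bounds near the
    boundary. Interpolation applies because for fixed t the quotient (N(z) D(t) - N(t) D(z)) / (z -
    t) is a polynomial in z of bounded degree. Zeros and poles enter [sigma_e] asymmetrically: at a
    finite zero the new density vanishes, so deleting the atom leaves the transform unchanged, while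
    each finite pole gets unit mass and [omega_e] carries the root of the residue. Weyl values form
    a set, since the closures are relations up to null vectors, so uniqueness and existence of the
    value are separate steps. The convention 1 / 0 = 0 is used throughout: r t = 0 at a pole, and
    [omega] vanishes at a finite b_1. *)

Local Notation cn := ComplexField.Normc.normc.
Local Notation Re := complex.Re.
Local Notation Im := complex.Im.

(** * Complex integration and nontangential limits *)

Section Complex.
Context {R : realType}.
Implicit Types (z w : R[i]) (x y : R).

(** The norm of [R[i]] is itself complex valued; estimates go through the real-valued [cn], so that
    [lra] and the order lemmas of [R] apply. *)
Lemma normc_cn z : `|z| = (cn z)%:C.
Proof. by rewrite normc_def; case: z. Qed.

Lemma cnE z : cn z = Num.sqrt (Re z ^+ 2 + Im z ^+ 2).
Proof. by case: z. Qed.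

Lemma sqr_cn z : cn z ^+ 2 = Re z ^+ 2 + Im z ^+ 2.
Proof. by rewrite cnE sqr_sqrtr// addr_ge0// sqr_ge0. Qed.

Lemma cn_ge0 z : 0 <= cn z.
Proof. by rewrite cnE sqrtr_ge0. Qed.

Lemma cnM z w : cn (z * w) = cn z * cn w.
Proof. exact: ComplexField.Normc.normcM. Qed.

Lemma cnV z : cn z^-1 = (cn z)^-1.
Proof. exact: ComplexField.Normc.normcV. Qed.

Lemma cnX z n : cn (z ^+ n) = cn z ^+ n.
Proof.
by elim: n => [|n IH]; rewrite ?expr0 ?ComplexField.Normc.normc1// !exprS cnM IH.
Qed.

Lemma cnN z : cn (- z) = cn z.
Proof. by case: z => a b /=; rewrite !sqrrN. Qed.

Lemma cnB z w : cn (z - w) = cn (w - z).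
Proof. by rewrite -opprB cnN. Qed.

Lemma cnJ z : cn (conjc z) = cn z.
Proof. by case: z => a b /=; rewrite sqrrN. Qed.

Lemma cnD z w : cn (z + w) <= cn z + cn w.
Proof. by rewrite -lecR rmorphD/= -!normc_cn ler_normD. Qed.

Lemma cn_le_sub z w : cn z - cn w <= cn (z - w).
Proof. by rewrite lerBlDr -{1}(subrK w z) cnD. Qed.

Lemma cn0 : cn (0 : R[i]) = 0. Proof. exact: ComplexField.Normc.normc0. Qed.

Lemma cn1 : cn (1 : R[i]) = 1. Proof. exact: ComplexField.Normc.normc1. Qed.

Lemma cn_eq0 z : (cn z == 0) = (z == 0).
Proof.
apply/eqP/eqP => [/ComplexField.Normc.eq0_normc//|->]; exact: cn0.
Qed.

Lemma cn_gt0 z : (0 < cn z) = (z != 0).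
Proof. by rewrite lt_def cn_ge0 andbT cn_eq0. Qed.

Lemma cn_real x : cn x%:C = `|x|.
Proof. by rewrite cnE/= expr0n addr0 sqrtr_sqr. Qed.

Lemma Re_le_cn z : `|Re z| <= cn z.
Proof. by rewrite cnE -sqrtr_sqr ler_wsqrtr// lerDl sqr_ge0. Qed.

Lemma Im_le_cn z : `|Im z| <= cn z.
Proof. by rewrite cnE -sqrtr_sqr ler_wsqrtr// lerDr sqr_ge0. Qed.

Lemma cn_le_ReIm z : cn z <= `|Re z| + `|Im z|.
Proof.
rewrite -(@ler_pXn2r _ 2)// ?nnegrE ?cn_ge0 ?addr_ge0//.
by rewrite sqr_cn sqrrD !real_normK ?num_real// lerD2r lerDl mulrn_wge0 ?mulr_ge0.
Qed.

Lemma cReM z w : Re (z * w) = Re z * Re w - Im z * Im w.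
Proof. by case: z w => [? ?] [? ?]. Qed.

Lemma cImM z w : Im (z * w) = Re z * Im w + Im z * Re w.
Proof. by case: z w => [? ?] [? ?]. Qed.

Lemma cReD z w : Re (z + w) = Re z + Re w.
Proof. by case: z w => [? ?] [? ?]. Qed.

Lemma cImD z w : Im (z + w) = Im z + Im w.
Proof. by case: z w => [? ?] [? ?]. Qed.

Lemma cReN z : Re (- z) = - Re z. Proof. by case: z. Qed.

Lemma cImN z : Im (- z) = - Im z. Proof. by case: z. Qed.

Lemma cReV z : Re z^-1 = Re z / cn z ^+ 2.
Proof. by rewrite sqr_cn; case: z. Qed.

Lemma cImV z : Im z^-1 = - Im z / cn z ^+ 2.
Proof. by rewrite sqr_cn mulNr; case: z. Qed.

Lemma cReJ z : Re (conjc z) = Re z. Proof. by case: z. Qed.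

Lemma cImJ z : Im (conjc z) = - Im z. Proof. by case: z. Qed.

Lemma conjcD z w : conjc (z + w) = conjc z + conjc w.
Proof. by case: z w => [? ?] [? ?] /=; rewrite opprD. Qed.

Lemma conjcB z w : conjc (z - w) = conjc z - conjc w.
Proof. by case: z w => [? ?] [? ?] /=; rewrite opprD. Qed.

Lemma conjcM z w : conjc (z * w) = conjc z * conjc w.
Proof. exact: rmorphM. Qed.

Lemma conjcV z : conjc z^-1 = (conjc z)^-1.
Proof. exact: conjc_inv. Qed.

Lemma complex_ext z w : Re z = Re w -> Im z = Im w -> z = w.
Proof. by case: z w => [? ?] [? ?] /= -> ->. Qed.

Lemma mulJc z : conjc z * z = (cn z ^+ 2)%:C.
Proof.
by rewrite sqr_cn; apply: complex_ext; case: z => a b /=; ring.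
Qed.

Lemma nonreal_neq0 z : Im z != 0 -> z != 0.
Proof. by apply: contraNneq => ->. Qed.

Lemma nonreal_sub z x : Im z != 0 -> x%:C - z != 0.
Proof.
by move=> z0; apply: nonreal_neq0; rewrite cImD cImN /= add0r oppr_eq0.
Qed.

Lemma Im_le_cn_sub z x : `|Im z| <= cn (x%:C - z).
Proof.
by apply: le_trans (Im_le_cn _); rewrite cImD cImN/= add0r normrN.
Qed.

Lemma conjc_eval (p : {poly R}) z :
  (map_poly (real_complex R) p).[conjc z] = conjc (map_poly (real_complex R) p).[z].
Proof.
elim/poly_ind: p => [|p c IH]; first by rewrite rmorph0 !horner0 conjc0.
rewrite rmorphD rmorphM/= map_polyX map_polyC/= !hornerE IH.
by rewrite conjcD conjcM conjc_real.
Qed.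

End Complex.

(** The inverse equals f (f^2)^-1, where the real power is measurable; at a zero of [f] both sides
    vanish because 0^-1 = 0. *)
Lemma measurable_inv {R : realType} (f : R -> R) :
  measurable_fun setT f -> measurable_fun setT (fun t => (f t)^-1).
Proof.
move=> mf.
suff -> : (fun t => (f t)^-1) = (fun t => f t * powR (f t ^+ 2) (-1)).
  apply: measurable_funM => //.
  apply: (measurableT_comp (measurable_powR (-1))).
  exact: measurable_funX.
apply/funext => t; have [->|ft] := eqVneq (f t) 0; first by rewrite invr0 mul0r.
by rewrite powR_inv1 ?sqr_ge0 // ; field.
Qed.

Section ComplexIntegral.
Context {R : realType} (mu : {measure set R -> \bar R}).
Implicit Types (f g : R -> R[i]^o) (h : R -> R).

Definition rintegrable h := mu.-integrable setT (EFin \o h).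

Definition cintegrable f := cmeasurable f /\ rintegrable (fun t => cn (f t)).

Lemma cmeasurable_cst (c : R[i]) : cmeasurable (fun=> c : R[i]^o).
Proof. by split; exact: measurable_cst. Qed.

Lemma cmeasurable_real h : measurable_fun setT h ->
  cmeasurable (fun t => (h t)%:C : R[i]^o).
Proof. by move=> mh; split => //=; exact: measurable_cst. Qed.

Lemma cmeasurableD f g : cmeasurable f -> cmeasurable g ->
  cmeasurable (fun t => f t + g t : R[i]^o).
Proof.
move=> [f1 f2] [g1 g2]; split.
  by under eq_fun do rewrite cReD; exact: measurable_funD.
by under eq_fun do rewrite cImD; exact: measurable_funD.
Qed.

Lemma cmeasurableN f : cmeasurable f -> cmeasurable (fun t => - f t : R[i]^o).
Proof.
move=> [f1 f2]; split.
  by under eq_fun do rewrite cReN; exact: measurable_funN.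
by under eq_fun do rewrite cImN; exact: measurable_funN.
Qed.

Lemma cmeasurableM f g : cmeasurable f -> cmeasurable g ->
  cmeasurable (fun t => f t * g t : R[i]^o).
Proof.
move=> [f1 f2] [g1 g2]; split.
  under eq_fun do rewrite cReM.
  by apply: measurable_funB; exact: measurable_funM.
under eq_fun do rewrite cImM.
by apply: measurable_funD; exact: measurable_funM.
Qed.

Lemma measurable_cn f : cmeasurable f -> measurable_fun setT (fun t => cn (f t)).
Proof.
move=> [f1 f2]; under eq_fun do rewrite cnE.
apply: (measurableT_comp (continuous_measurable_fun (@sqrt_continuous R))
  (measurable_funD (measurable_funX _ f1) (measurable_funX _ f2))).
Qed.

Lemma cmeasurableV f : cmeasurable f -> cmeasurable (fun t => (f t)^-1 : R[i]^o).
Proof.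
move=> mf; have m2 : measurable_fun setT (fun t => (cn (f t) ^+ 2)^-1).
  by apply: measurable_inv; apply: measurable_funX; exact: measurable_cn.
case: mf => f1 f2; split.
  by under eq_fun do rewrite cReV; exact: measurable_funM.
under eq_fun do rewrite cImV.
by apply: measurable_funM => //; exact: measurable_funN.
Qed.

Lemma cmeasurableJ f : cmeasurable f -> cmeasurable (fun t => conjc (f t) : R[i]^o).
Proof.
move=> [f1 f2]; split; first by under eq_fun do rewrite cReJ.
by under eq_fun do rewrite cImJ; exact: measurable_funN.
Qed.

Lemma rintegrable_le h h' : measurable_fun setT h -> rintegrable h' ->
  (forall t, `|h t| <= h' t) -> rintegrable h.
Proof.
move=> mh ih hh'; apply: (le_integrable _ _ _ ih) => //.
  exact/measurable_EFinP.
by move=> t _ /=; rewrite lee_fin (le_trans (hh' t))// ler_norm.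
Qed.

Lemma cintegrable_le f h : cmeasurable f -> rintegrable h ->
  (forall t, cn (f t) <= h t) -> cintegrable f.
Proof.
move=> mf ih fh; split => //; apply: rintegrable_le ih _.
  exact: measurable_cn.
by move=> t; rewrite ger0_norm// cn_ge0.
Qed.

Lemma rintegrable_measurable h : rintegrable h -> measurable_fun setT h.
Proof. by move=> /measurable_int/measurable_EFinP. Qed.

Lemma rintegrableD h h' : rintegrable h -> rintegrable h' ->
  rintegrable (fun t => h t + h' t).
Proof. by move=> i1 i2; apply: eq_integrable (integrableD _ i1 i2). Qed.

Lemma rintegrableZ (c : R) h : rintegrable h -> rintegrable (fun t => c * h t).
Proof. by move=> i1; apply: eq_integrable (integrableZl _ c i1). Qed.

Lemma rintegrable_norm h : rintegrable h -> rintegrable (fun t => `|h t|).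
Proof. by move=> i1; apply: eq_integrable (integrable_abse i1). Qed.

Lemma cintegrable_Re f : cintegrable f -> rintegrable (fun t => Re (f t)).
Proof.
move=> [[f1 f2] i]; apply: rintegrable_le i _ => // t; exact: Re_le_cn.
Qed.

Lemma cintegrable_Im f : cintegrable f -> rintegrable (fun t => Im (f t)).
Proof.
move=> [[f1 f2] i]; apply: rintegrable_le i _ => // t; exact: Im_le_cn.
Qed.

Lemma cintegrableD f g : cintegrable f -> cintegrable g ->
  cintegrable (fun t => f t + g t : R[i]^o).
Proof.
move=> [mf jf] [mg jg]; apply: cintegrable_le (rintegrableD jf jg) _.
  exact: cmeasurableD.
by move=> t; exact: cnD.
Qed.

Lemma cintegrableZ (c : R[i]) f : cintegrable f ->
  cintegrable (fun t => c * f t : R[i]^o).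
Proof.
move=> [mf jf]; apply: cintegrable_le (rintegrableZ (cn c) jf) _.
  by apply: cmeasurableM => //; exact: cmeasurable_cst.
by move=> t; rewrite cnM.
Qed.

Lemma cintegralD f g : cintegrable f -> cintegrable g ->
  cintegral mu (fun t => f t + g t : R[i]^o) = cintegral mu f + cintegral mu g.
Proof.
move=> jf jg; apply: complex_ext; rewrite ?cReD ?cImD/=.
  under eq_Rintegral do rewrite cReD.
  by rewrite RintegralD//; exact: cintegrable_Re.
under eq_Rintegral do rewrite cImD.
by rewrite RintegralD//; exact: cintegrable_Im.
Qed.

Lemma cintegralZ (c : R[i]) f : cintegrable f ->
  cintegral mu (fun t => c * f t : R[i]^o) = c * cintegral mu f.
Proof.
move=> jf; have [j1 j2] := (cintegrable_Re jf, cintegrable_Im jf).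
have jj (d : R) h : rintegrable h -> mu.-integrable setT (EFin \o (fun t => d * h t)).
  exact: rintegrableZ.
apply: complex_ext; rewrite ?cReM ?cImM/=.
  under eq_Rintegral do rewrite cReM.
  by rewrite RintegralB//; [rewrite !RintegralZl|exact: jj|exact: jj].
under eq_Rintegral do rewrite cImM.
by rewrite RintegralD//; [rewrite !RintegralZl|exact: jj|exact: jj].
Qed.

Lemma cintegral0 : cintegral mu (fun=> 0 : R[i]^o) = 0.
Proof. by apply: complex_ext; rewrite /= Rintegral_cst// mul0r. Qed.

Lemma cintegral_sum (I : Type) (r : seq I) (F : I -> R -> R[i]^o) :
  (forall i, cintegrable (F i)) ->
  cintegrable (fun t => \sum_(i <- r) F i t : R[i]^o) /\
  cintegral mu (fun t => \sum_(i <- r) F i t : R[i]^o) = \sum_(i <- r) cintegral mu (F i).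
Proof.
move=> jF; elim: r => [|i r [IH1 IH2]].
  under eq_fun do rewrite big_nil; rewrite big_nil cintegral0; split => //.
  split; first exact: cmeasurable_cst.
  by under eq_fun do rewrite ComplexField.Normc.normc0; exact: integrable0.
under eq_fun do rewrite big_cons; rewrite big_cons.
by split; [exact: cintegrableD|rewrite cintegralD// IH2].
Qed.

Lemma cintegralB f g : cintegrable f -> cintegrable g ->
  cintegral mu (fun t => f t - g t : R[i]^o) = cintegral mu f - cintegral mu g.
Proof.
move=> jf jg.
rewrite -[X in _ = _ + X]mulN1r -cintegralZ// -cintegralD//.
  by congr cintegral; apply/funext => t; rewrite mulN1r.
exact: cintegrableZ.
Qed.

Lemma cintegralJ f : cintegrable f ->
  cintegral mu (fun t => conjc (f t) : R[i]^o) = conjc (cintegral mu f).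
Proof.
move=> jf; apply: complex_ext; rewrite ?cReJ ?cImJ/=.
  by apply: eq_Rintegral => t _; rewrite cReJ.
under eq_Rintegral do rewrite cImJ -mulN1r.
by rewrite RintegralZl ?mulN1r//; exact: cintegrable_Im.
Qed.

Lemma le_rintegral h h' : rintegrable h -> rintegrable h' ->
  (forall t, h t <= h' t) -> \int[mu]_t h t <= \int[mu]_t h' t.
Proof. by move=> i1 i2 hh; apply: le_Rintegral. Qed.

(** The factor 2 is the price of bounding the real and imaginary parts separately; later uses ask
    only for some constant. *)
Lemma cn_cintegral_le f h : cmeasurable f -> rintegrable h ->
  (forall t, cn (f t) <= h t) -> cn (cintegral mu f) <= 2 * \int[mu]_t h t.
Proof.
move=> mf ih fh; have jf := cintegrable_le mf ih fh.
apply: le_trans (cn_le_ReIm _) _; rewrite mulr_natl mulr2n /=.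
have [j1 j2] := (cintegrable_Re jf, cintegrable_Im jf).
apply: lerD.
- apply: le_trans (le_normr_Rintegral measurableT j1) _.
  apply: le_rintegral => //; first exact: rintegrable_norm.
  by move=> t; apply: le_trans (fh t); exact: Re_le_cn.
- apply: le_trans (le_normr_Rintegral measurableT j2) _.
  apply: le_rintegral => //; first exact: rintegrable_norm.
  by move=> t; apply: le_trans (fh t); exact: Im_le_cn.
Qed.

Lemma ae_cintegral f g : cmeasurable f -> cmeasurable g ->
  {ae mu, forall t, f t = g t} -> cintegral mu f = cintegral mu g.
Proof.
move=> [f1 f2] [g1 g2] fg; apply: complex_ext => /=; rewrite /Rintegral;
  congr fine; apply: ae_eq_integral => //; try exact/measurable_EFinP.
  by apply: filterS fg => t + _ => ->.
by apply: filterS fg => t + _ => ->.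
Qed.

Lemma ae_rintegrable h h' : measurable_fun setT h' ->
  {ae mu, forall t, h t = h' t} -> rintegrable h -> rintegrable h'.
Proof.
move=> mh hh jh.
have mh0 := rintegrable_measurable jh.
apply/integrableP; split; first exact/measurable_EFinP.
move/integrableP: jh => [_]; congr (_ < _)%E; apply: ae_eq_integral => //.
- by apply/measurable_EFinP; exact: measurableT_comp.
- by apply/measurable_EFinP; exact: measurableT_comp.
- by apply: filterS hh => t + _ /= => ->.
Qed.

End ComplexIntegral.

(** * Nontangential filters and dominated convergence along them *)

Section Nontangential.
Context {R : realType}.
Local Notation C := (R[i]^o).
Implicit Types (xi : option R) (f : C -> C) (l : C).

(** A countable decreasing base of the approach regions inside one Stolz angle; countability is what
    makes dominated convergence for sequences applicable. *)
Definition sector xi (K : R) (n : nat) : set C :=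
  [set z | stolz (odflt 0 xi) K z /\
     if xi is Some x then cn (z - x%:C) < n.+1%:R^-1 else n%:R < cn z].

Lemma ltc_norm (z : C) (e : R) : (`|z| < e%:C) = (cn z < e).
Proof. by rewrite normc_cn ltcR. Qed.

Lemma posC_real (e : C) : 0 < e -> exists2 d : R, 0 < d & e = d%:C.
Proof.
by rewrite ltcE => /andP[/eqP/= e0 e1]; exists (Re e) => //; apply: complex_ext.
Qed.

Lemma nbhsC_P (x : C) (U : set C) :
  nbhs x U <-> exists2 d : R, 0 < d & forall z, cn (z - x) < d -> U z.
Proof.
split.
  move=> /(@nbhs_normP _ C x U)[e /posC_real[d d0 ->] xU]; exists d => // z zx.
  by apply: xU; rewrite /ball_/= ltc_norm cnB.
move=> [d d0 xU]; apply/(@nbhs_normP _ C x U); exists d%:C; first by rewrite /= ltcR.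
by move=> z; rewrite /ball_/= ltc_norm cnB => /xU.
Qed.

Section Limits.
Context (F : set_system C) {FF : Filter F}.
Implicit Types (g : C -> C) (m : C).

Lemma cvgC_cst l : (fun=> l) @ F --> l.
Proof. exact: cvg_cst. Qed.

Lemma cvgCD f g l m : f @ F --> l -> g @ F --> m ->
  (f z + g z : C) @[z --> F] --> (l + m : C).
Proof. exact: cvgD. Qed.

Lemma cvgCB f g l m : f @ F --> l -> g @ F --> m ->
  (f z - g z : C) @[z --> F] --> (l - m : C).
Proof. exact: cvgB. Qed.

Lemma cvgCM f g l m : f @ F --> l -> g @ F --> m ->
  (f z * g z : C) @[z --> F] --> (l * m : C).
Proof. exact: cvgM. Qed.

Lemma cvgCV f l : l != 0 -> f @ F --> l -> ((f z)^-1 : C) @[z --> F] --> (l^-1 : C).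
Proof. exact: cvgV. Qed.

Lemma cvgCX f l n : f @ F --> l -> (f z ^+ n : C) @[z --> F] --> (l ^+ n : C).
Proof.
move=> fl; elim: n => [|n IH]; first by rewrite expr0; exact: cvg_cst.
by rewrite exprS; under eq_fun do rewrite exprS; exact: cvgCM.
Qed.

Lemma cvgC_near_eq f g l : F [set z | f z = g z] -> f @ F --> l -> g @ F --> l.
Proof. by move=> fg; apply: cvg_trans; apply: near_eq_cvg; exact: fg. Qed.

End Limits.

Lemma nontangentialP xi (U : set C) :
  nontangential xi U <-> forall K, exists n, sector xi K n `<=` U.
Proof.
split => [h K|h K].
  have := h K; case: xi h => [x|] _ /=.
    move=> /nbhsC_P[d d0 dU]; have [n _ nd] := near_infty_natSinv_lt (PosNum d0).
    by exists n => z [sz zx]; apply: dU => //; apply: lt_trans zx _; exact: (nd n (leqnn n)).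
  move=> [M MU]; exists (Num.truncn M).+1 => z [sz zM]; apply: MU => //.
  by rewrite normc_cn ltcR (le_lt_trans _ zM)// ltW// truncnS_gt.
have [n nU] := h K; case: xi h nU => [x|] _ nU /=.
  by apply/nbhsC_P; exists n.+1%:R^-1 => // z zx sz; exact: nU.
exists n%:R => z + sz; rewrite normc_cn ltcR => zn; exact: nU.
Qed.

Lemma sector_le xi K n m : (n <= m)%N -> sector xi K m `<=` sector xi K n.
Proof.
move=> nm z [sz h]; split => //; case: xi sz h => [x|] sz h.
  by apply: lt_le_trans h _; rewrite lef_pV2 ?posrE// ler_nat.
by apply: le_lt_trans h; rewrite ler_nat.
Qed.

Global Instance nontangential_filter xi : ProperFilter (nontangential xi).
Proof.
split.
  move=> /nontangentialP/(_ 0)[n nU].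
  case: xi nU => [x|] nU.
    pose y : R := n.+2%:R^-1.
    have y0 : 0 < y by rewrite invr_gt0 ltr0n.
    apply: (nU (x +i* y)); split => /=.
      by split; rewrite /nonreal/= ?gt_eqF// subrr normr0 mul0r.
    by rewrite subrr subr0 expr0n/= add0r sqrtr_sqr gtr0_norm// ltf_pV2 ?posrE// ltr_nat.
  apply: (nU (0 +i* n.+1%:R)); split => /=.
    split; first by rewrite /nonreal/= pnatr_eq0.
    by rewrite /= subrr normr0 mul0r.
  by rewrite expr0n/= add0r sqrtr_sqr gtr0_norm// ltr_nat.
split.
- by move=> K; case: xi => [x|] /=; [exact: filterT|exists 0].
- move=> U V /nontangentialP hU /nontangentialP hV; apply/nontangentialP => K.
  have [[n nU] [m mV]] := (hU K, hV K); exists (maxn n m) => z sz; split.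
    by apply: nU; apply: sector_le sz; exact: leq_maxl.
  by apply: mV; apply: sector_le sz; exact: leq_maxr.
- move=> U V UV /nontangentialP hU; apply/nontangentialP => K.
  by have [n nU] := hU K; exists n => z /nU/UV.
Qed.

Lemma cvgC_P (F : set_system C) f l : Filter F ->
  (f z @[z --> F] --> l <-> forall e : R, 0 < e -> F [set z | cn (f z - l) < e]).
Proof.
move=> FF; split.
  move=> /cvgrPdist_lt h e e0; have e0' : (0 : C) < e%:C by rewrite ltcR.
  by apply: filterS (h _ e0') => z; rewrite /= ltc_norm cnB.
move=> h; apply/cvgrPdist_lt => _ /posC_real[e e0 ->].
by apply: filterS (h _ e0) => z; rewrite /= ltc_norm cnB.
Qed.

Lemma nontangential_cvgP xi f l :
  f z @[z --> nontangential xi] --> l <->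
  forall K e : R, 0 < e -> exists n, forall z, sector xi K n z -> cn (f z - l) < e.
Proof.
rewrite cvgC_P; split => [h K e e0|h e e0].
  by have /nontangentialP/(_ K)[n nU] := h e e0; exists n => z /nU.
by apply/nontangentialP => K; have [n nU] := h K e e0; exists n => z /nU.
Qed.

Lemma nontangential_nonreal xi : nontangential xi nonreal.
Proof. by apply/nontangentialP => K; exists 0%N => z [[]]. Qed.

Lemma cvgC_nonreal_eq xi f g l : (forall z, Im z != 0 -> f z = g z) ->
  f @ nontangential xi --> l -> g @ nontangential xi --> l.
Proof.
move=> fg; apply: cvgC_near_eq; apply: filterS (nontangential_nonreal xi) => z.
exact: fg.
Qed.

Lemma nontangential_id (x : R) : z @[z --> nontangential (Some x)] --> (x%:C : C).
Proof.
apply/nontangential_cvgP => K e e0.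
have [n _ nd] := near_infty_natSinv_lt (PosNum e0).
by exists n => z [_]; move/lt_trans; apply; exact: (nd n (leqnn n)).
Qed.

Lemma nontangential_inv : z^-1 @[z --> nontangential None] --> (0 : C).
Proof.
apply/nontangential_cvgP => K e e0; exists (Num.truncn e^-1).+1 => z [_ zn].
have e1 : e^-1 < cn z by apply: lt_trans zn; exact: truncnS_gt.
rewrite subr0 cnV invf_plt ?posrE//.
by apply: lt_trans e1; rewrite invr_gt0.
Qed.

(** In a Stolz angle the distance to the vertex is comparable to Im z, hence at most a multiple of
    |t - z| for every real t. This is the source of all majorants for nontangential limits. *)
Lemma stolz_cn_le (x K : R) (z : C) : stolz x K z ->
  cn (z - x%:C) <= (`|K| + 1) * `|Im z|.
Proof.
move=> [_ zK]; apply: le_trans (cn_le_ReIm _) _.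
rewrite cReD cImD cReN cImN/= subr0 mulrDl mul1r lerD2r.
by apply: le_trans zK _; rewrite ler_wpM2r// ler_norm.
Qed.

Variable mu : {measure set R -> \bar R}.

(** If it failed, each [U n] would contain a point [u n] whose integral has modulus at least [e];
    sequential dominated convergence along [u] contradicts this. *)
Lemma dominated_small (U : nat -> set C) (f : C -> R -> C) (g : R -> R) :
  (forall n m, (n <= m)%N -> U m `<=` U n) ->
  (forall z, U 0%N z -> cmeasurable (f z)) ->
  rintegrable mu g ->
  (forall z t, U 0%N z -> cn (f z t) <= g t) ->
  (forall t e, 0 < e -> exists n, forall z, U n z -> cn (f z t) < e) ->
  forall e, 0 < e -> exists n, forall z, U n z -> cn (cintegral mu (f z)) < e.
Proof.
move=> Ule mf ig fg f0 e e0; apply: contrapT => /forallNP h.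
have {h} h n : exists z, U n z /\ e <= cn (cintegral mu (f z)).
  have /existsNP[z /not_implyP[Uz /negP]] := h n.
  by rewrite -leNgt => ez; exists z.
have [u uP] := choice h.
have Uu n : U 0%N (u n) by have [+ _] := uP n; exact: Ule.
have mh n : measurable_fun setT (fun t => cn (f (u n) t)).
  by apply: measurable_cn; apply: mf; exact: Uu.
have [||||| _ _] := @dominated_convergence _ _ _ mu setT measurableT
  (fun n t => (cn (f (u n) t))%:E) (fun=> 0%E) (EFin \o g).
- by move=> n; exact/measurable_EFinP.
- exact: measurable_cst.
- apply: aeW => t _; apply/fine_cvgP; split; first exact: nearW.
  apply/cvgrPdist_lt => d d0; have [n nd] := f0 t d d0.
  exists n => // m /= nm; rewrite sub0r normrN ger0_norm ?cn_ge0//.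
  by apply: nd; apply: Ule nm _ _; have [] := uP m.
- exact: ig.
- by apply: aeW => t n _ /=; rewrite ger0_norm ?cn_ge0// lee_fin; exact: fg.
rewrite integral0 => /fine_cvgP[_ /cvgrPdist_lt].
have e20 : 0 < e / 2 by lra.
move=> /(_ _ e20)[n _ /(_ n (leqnn n))] /=.
rewrite sub0r normrN -/(Rintegral mu setT (fun t => cn (f (u n) t))) => h2.
have [_ en] := uP n.
have := @cn_cintegral_le _ mu (f (u n)) _ (mf _ (Uu n)) _ (fun t => lexx _).
have : rintegrable mu (fun t => cn (f (u n) t)).
  by apply: rintegrable_le ig _ => // t; rewrite ger0_norm ?cn_ge0//; exact: fg.
move=> i /(_ i) h3; have := le_trans en h3; move: h2.
by move=> /(le_lt_trans (ler_norm _)); lra.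
Qed.

(** The majorant may depend on the Stolz angle, because the limit is tested one angle at a time. *)
Lemma nontangential_dct xi (f : C -> R -> C) :
  (forall z, nonreal z -> cmeasurable (f z)) ->
  (forall K, exists n g, rintegrable mu g /\
     forall z t, sector xi K n z -> cn (f z t) <= g t) ->
  (forall t, f z t @[z --> nontangential xi] --> (0 : C)) ->
  cintegral mu (f z) @[z --> nontangential xi] --> (0 : C).
Proof.
move=> mf dom f0; apply/nontangential_cvgP => K e e0.
have [n [g [ig fg]]] := dom K.
have [||||m mP] := @dominated_small (fun m => sector xi K (n + m)) f g _ _ ig _ _ e e0.
- by move=> p q pq; apply: sector_le; rewrite leq_add2l.
- by move=> z [[nz _] _]; exact: mf.
- by move=> z t; rewrite addn0; exact: fg.
- move=> t d d0; have /nontangential_cvgP/(_ K d d0)[m mP] := f0 t.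
  exists m => z sz; have := mP z; rewrite subr0; apply.
  by apply: sector_le sz; exact: leq_addl.
by exists (n + m)%N => z sz; rewrite subr0; exact: mP.
Qed.

End Nontangential.

(** * Cauchy transforms *)

Section Kernel.
Context {R : realType}.
Local Notation C := (R[i]^o).
Implicit Types (t b : R) (z : C) (g h : R -> R).

Definition rho t : R := (1 + t ^+ 2)^-1.

Definition kernel t z : C := (t%:C - z)^-1 - (t * rho t)%:C.

Lemma rho_gt0 t : 0 < rho t.
Proof. by rewrite invr_gt0 ltr_wpDr// sqr_ge0. Qed.

Lemma rho_le1 t : rho t <= 1.
Proof. by rewrite invf_le1 ?lerDl ?sqr_ge0// ltr_wpDr// sqr_ge0. Qed.

(** With [rho] pulled out, the remaining factor is (1 + t z) / (t - z), bounded in t for nonreal z;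
    so integrability against [rho] suffices for convergence. *)
Lemma kernelE t z : Im z != 0 ->
  kernel t z = (rho t)%:C * (z + (1 + z ^+ 2) / (t%:C - z)).
Proof.
move=> z0; have tz := nonreal_sub t z0.
have : ((1 + t ^+ 2)%:C : R[i]) != 0 by rewrite fmorph_eq0 gt_eqF// ltr_wpDr// sqr_ge0.
rewrite rmorphD rmorph1 rmorphXn/= => t2.
rewrite /kernel /rho fmorphV/= rmorphM fmorphV/= rmorphD rmorphXn rmorph1.
by field; rewrite t2 tz.
Qed.

Lemma cn_kernel_le t z : Im z != 0 ->
  cn (kernel t z) <= rho t * (cn z + cn (1 + z ^+ 2) / cn (t%:C - z)).
Proof.
move=> z0; rewrite kernelE// cnM cn_real gtr0_norm ?rho_gt0//.
rewrite ler_pM2l ?rho_gt0//; apply: le_trans (cnD _ _) _.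
by rewrite cnM cnV.
Qed.

Lemma cn_kernel_le_Im t z : Im z != 0 ->
  cn (kernel t z) <= (cn z + cn (1 + z ^+ 2) / `|Im z|) * rho t.
Proof.
move=> z0; apply: le_trans (cn_kernel_le t z0) _.
rewrite mulrC ler_pM2r ?rho_gt0// lerD2l ler_wpM2l ?cn_ge0//.
by rewrite lef_pV2 ?posrE ?cn_gt0 ?nonreal_sub ?normr_gt0// Im_le_cn_sub.
Qed.

Lemma Im_kernel t z : Im (kernel t z) = Im z / cn (t%:C - z) ^+ 2.
Proof. by rewrite cImD cImV !cImD !cImN/= oppr0 addr0 add0r opprK. Qed.

Lemma kernel_conj t z : kernel t (conjc z) = conjc (kernel t z).
Proof.
by rewrite /kernel conjcB conjcV conjcB !conjc_real.
Qed.

Lemma measurable_rho : measurable_fun setT rho.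
Proof.
apply: measurable_inv; apply: measurable_funD; first exact: measurable_cst.
exact: measurable_funX.
Qed.

Lemma cmeasurable_resolvent z : cmeasurable (fun t => (t%:C - z)^-1 : C).
Proof.
apply: cmeasurableV; apply: cmeasurableD; first exact: cmeasurable_real.
exact: cmeasurable_cst.
Qed.

Lemma cmeasurable_kernel z : cmeasurable (kernel^~ z).
Proof.
apply: cmeasurableD; first exact: cmeasurable_resolvent.
apply: cmeasurableN; apply: cmeasurable_real.
by apply: measurable_funM => //; exact: measurable_rho.
Qed.

Lemma nontangential_resolvent xi t : xi != Some t ->
  (t%:C - z)^-1 @[z --> nontangential xi] -->
  ((if xi is Some b then (t%:C - b%:C)^-1 else 0) : C).
Proof.
case: xi => [b|] /eqP bt.
  apply: cvgCV; last by apply: cvgCB; [exact: cvgC_cst|exact: nontangential_id].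
  by rewrite -rmorphB fmorph_eq0 subr_eq0; apply: contra_notN bt => /eqP ->.
have h : z^-1 * (t%:C * z^-1 - 1)^-1 @[z --> nontangential None] -->
    (0 * (t%:C * 0 - 1)^-1 : C).
  apply: cvgCM; first exact: nontangential_inv.
  apply: cvgCV; first by rewrite mulr0 sub0r oppr_eq0 oner_eq0.
  apply: cvgCB; last exact: cvgC_cst.
  by apply: cvgCM; [exact: cvgC_cst|exact: nontangential_inv].
rewrite mul0r in h; apply: cvg_trans h; apply: near_eq_cvg; near=> z.
have z0 : Im z != 0 by near: z; exact: nontangential_nonreal.
have tz := nonreal_sub t z0; have zn0 := nonreal_neq0 z0.
by field; rewrite zn0 tz.
Unshelve. all: by end_near. Qed.

Section Integral.
Variable mu : {measure set R -> \bar R}.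

Definition kint g z : C := cintegral mu (fun t => (g t)%:C * kernel t z).

Definition kdensity g := measurable_fun setT g /\ rintegrable mu (fun t => `|g t| * rho t).

Lemma kdensity_le g h : measurable_fun setT h -> kdensity g ->
  (forall t, `|h t| <= `|g t|) -> kdensity h.
Proof.
move=> mh [mg ig] hg; split => //; apply: rintegrable_le ig _.
  by apply: measurable_funM; [exact: measurableT_comp|exact: measurable_rho].
move=> t; rewrite normrM normr_id (gtr0_norm (rho_gt0 _)).
by rewrite ler_wpM2r// ltW// rho_gt0.
Qed.

Lemma cmeasurable_kint g z : measurable_fun setT g ->
  cmeasurable (fun t => (g t)%:C * kernel t z : C).
Proof.
by move=> mg; apply: cmeasurableM; [exact: cmeasurable_real|exact: cmeasurable_kernel].
Qed.

Lemma cintegrable_kint g z : Im z != 0 -> kdensity g ->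
  cintegrable mu (fun t => (g t)%:C * kernel t z : C).
Proof.
move=> z0 [mg ig].
apply: cintegrable_le (rintegrableZ (cn z + cn (1 + z ^+ 2) / `|Im z|) ig) _.
  exact: cmeasurable_kint.
move=> t; rewrite cnM cn_real mulrCA ler_wpM2l//; exact: cn_kernel_le_Im.
Qed.

Lemma kint_conj g z : Im z != 0 -> kdensity g -> kint g (conjc z) = conjc (kint g z).
Proof.
move=> z0 kg; rewrite -cintegralJ; last exact: cintegrable_kint.
by congr cintegral; apply/funext => t; rewrite conjcM conjc_real kernel_conj.
Qed.

Lemma kintB g h z : Im z != 0 -> kdensity g -> kdensity h ->
  kint (fun t => g t - h t) z = kint g z - kint h z.
Proof.
move=> z0 kg kh; rewrite -cintegralB; [|exact: cintegrable_kint..].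
by congr cintegral; apply/funext => t; rewrite rmorphB mulrBl.
Qed.

Lemma Im_kint g z : Im z != 0 -> kdensity g ->
  Im (kint g z) = \int[mu]_t (g t * (Im z / cn (t%:C - z) ^+ 2)).
Proof.
move=> z0 kg; apply: eq_Rintegral => t _.
by rewrite cImM /= mul0r addr0 Im_kernel.
Qed.

Lemma Im_kint_integrable g z : Im z != 0 -> kdensity g ->
  rintegrable mu (fun t => g t * (Im z / cn (t%:C - z) ^+ 2)).
Proof.
move=> z0 kg; have := cintegrable_Im (cintegrable_kint z0 kg).
by under eq_fun do rewrite cImM /= mul0r addr0 Im_kernel.
Qed.

(** The condition g b = 0 removes a possible atom at b. Off b the integrand tends to 0, and the
    bound on |z - b| / |t - z| in a Stolz angle gives the majorant. *)
Lemma kint_ray b g : kdensity g -> g b = 0 ->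
  (z - b%:C) * kint g z @[z --> nontangential (Some b)] --> (0 : C).
Proof.
move=> [mg ig] gb0.
have h : cintegral mu (fun t => (z - b%:C) * ((g t)%:C * kernel t z) : C)
    @[z --> nontangential (Some b)] --> (0 : C).
  apply: nontangential_dct.
  - move=> z _; apply: cmeasurableM; first exact: cmeasurable_cst.
    exact: cmeasurable_kint.
  (* On the sector of index 0 one has |z - b| < 1, hence |z| <= M. *)
  - move=> K; pose M := 1 + `|b|.
    exists 0%N, (fun t => (M + (1 + M ^+ 2) * (`|K| + 1)) * (`|g t| * rho t)).
    split; first exact: rintegrableZ.
    move=> z t [sz zb]; have [/= z0 _] := sz; have z0' : Im z != 0 := z0.
    have zM : cn z <= M.
      rewrite -lerBlDr -(cn_real b); apply: le_trans (cn_le_sub _ _) _.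
      by apply: ltW; rewrite invr1 in zb.
    have zM2 : cn (1 + z ^+ 2) <= 1 + M ^+ 2.
      apply: le_trans (cnD _ _) _; rewrite cn1 cnX lerD2l ler_pXn2r// nnegrE ?cn_ge0//.
      by rewrite addr_ge0.
    have zb1 : cn (z - b%:C) <= 1 by apply: ltW; rewrite invr1 in zb.
    have zt : cn (z - b%:C) / cn (t%:C - z) <= `|K| + 1.
      rewrite ler_pdivrMr ?cn_gt0 ?nonreal_sub//.
      apply: le_trans (stolz_cn_le sz) _; rewrite ler_wpM2l ?addr_ge0//.
      exact: Im_le_cn_sub.
    rewrite !cnM cn_real; apply: le_trans (_ : cn (z - b%:C) *
      (`|g t| * (rho t * (cn z + cn (1 + z ^+ 2) / cn (t%:C - z)))) <= _).
      by rewrite ler_wpM2l ?cn_ge0// ler_wpM2l//; exact: cn_kernel_le.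
    rewrite [leLHS](_ : _ = (`|g t| * rho t) * (cn (z - b%:C) * cn z +
       cn (1 + z ^+ 2) * (cn (z - b%:C) / cn (t%:C - z)))); last by ring.
    rewrite mulrC; apply: ler_wpM2r; first by rewrite mulr_ge0// ltW// rho_gt0.
    apply: lerD.
      by rewrite -[leRHS]mul1r ler_pM ?cn_ge0.
    by rewrite ler_pM ?cn_ge0// divr_ge0 ?cn_ge0.
  - move=> t; have [->|tb] := eqVneq t b.
      have -> : (fun z : C => (z - b%:C) * ((g b)%:C * kernel b z)) = fun=> 0.
        by apply/funext => z; rewrite gb0 mul0r mulr0.
      exact: cvgC_cst.
    rewrite -[X in _ --> X](mul0r ((g t)%:C * ((t%:C - b%:C)^-1 - (t * rho t)%:C) : C)).
    apply: cvgM.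
      rewrite -(subrr (b%:C : C)); apply: cvgCB; last exact: cvgC_cst.
      exact: nontangential_id.
    apply: cvgCM; first exact: cvgC_cst.
    apply: cvgCB; last exact: cvgC_cst.
    apply: (@nontangential_resolvent (Some b)).
    by apply: contra_neqN tb => /eqP[].
apply: cvg_trans h; apply: near_eq_cvg; near=> z.
rewrite cintegralZ//; apply: cintegrable_kint => //.
by near: z; exact: nontangential_nonreal.
Unshelve. all: by end_near. Qed.

Lemma kint_infty g : kdensity g ->
  z^-1 * kint g z @[z --> nontangential None] --> (0 : C).
Proof.
move=> [mg ig].
have h : cintegral mu (fun t => z^-1 * ((g t)%:C * kernel t z) : C)
    @[z --> nontangential None] --> (0 : C).
  apply: nontangential_dct.
  - move=> z _; apply: cmeasurableM; first exact: cmeasurable_cst.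
    exact: cmeasurable_kint.
  - move=> K.
    (* Index 1 means |z| > 1, which gives |1 + z^2| <= 2 |z|^2. *)
    exists 1%N, (fun t => (1 + 2 * (`|K| + 1)) * (`|g t| * rho t)).
    split; first exact: rintegrableZ.
    move=> z t [sz zn]; have [/= z0 _] := sz; have z0' : Im z != 0 := z0.
    have zg0 : 0 < cn z by rewrite cn_gt0 nonreal_neq0.
    have zM2 : cn (1 + z ^+ 2) <= 2 * cn z ^+ 2.
      apply: le_trans (cnD _ _) _; rewrite cn1 cnX mulr_natl mulr2n lerD2r.
      by rewrite expr_ge1// ltW.
    have zt : cn z / cn (t%:C - z) <= `|K| + 1.
      rewrite ler_pdivrMr ?cn_gt0 ?nonreal_sub//.
      rewrite -[X in cn X <= _]subr0 -[X in cn (z - X) <= _]/((0 : R)%:C).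
      apply: le_trans (stolz_cn_le sz) _; rewrite ler_wpM2l ?addr_ge0//.
      exact: Im_le_cn_sub.
    rewrite !cnM cn_real cnV; apply: le_trans (_ : (cn z)^-1 *
      (`|g t| * (rho t * (cn z + 2 * cn z ^+ 2 / cn (t%:C - z)))) <= _).
      rewrite ler_wpM2l ?invr_ge0 ?cn_ge0// ler_wpM2l//.
      apply: le_trans (cn_kernel_le _ _) _ => //.
      apply: ler_wpM2l; first by rewrite ltW// rho_gt0.
      by rewrite lerD2l ler_wpM2r// invr_ge0 cn_ge0.
    rewrite [leLHS](_ : _ = (`|g t| * rho t) * (1 +
       2 * (cn z / cn (t%:C - z)))); last first.
      have tz : cn (t%:C - z) != 0 by rewrite cn_eq0 nonreal_sub.
      by field; rewrite tz gt_eqF.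
    rewrite mulrC; apply: ler_wpM2r; first by rewrite mulr_ge0// ltW// rho_gt0.
    by rewrite lerD2l ler_pM2l.
  - move=> t; rewrite -[X in _ --> X](mul0r ((g t)%:C * (0 - (t * rho t)%:C) : C)).
    apply: cvgCM; first exact: nontangential_inv.
    apply: cvgCM; first exact: cvgC_cst.
    apply: cvgCB; last exact: cvgC_cst.
    exact: (@nontangential_resolvent None).
apply: cvg_trans h; apply: near_eq_cvg; near=> z.
rewrite cintegralZ//; apply: cintegrable_kint => //.
by near: z; exact: nontangential_nonreal.
Unshelve. all: by end_near. Qed.

End Integral.
End Kernel.

(** * Real polynomials at complex points *)

Section RealPolynomials.
Context {R : realType}.
Local Notation C := (R[i]^o).
Implicit Types (p q : {poly R}) (z w : R[i]) (x : R).

Definition peval p z : R[i] := (map_poly (real_complex R) p).[z].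

Lemma pevalC x z : peval x%:P z = x%:C.
Proof. by rewrite /peval map_polyC hornerC. Qed.

Lemma pevalXsubC x z : peval ('X - x%:P) z = z - x%:C.
Proof. by rewrite /peval rmorphB/= map_polyX map_polyC/= !hornerE. Qed.

Lemma pevalM p q z : peval (p * q) z = peval p z * peval q z.
Proof. by rewrite /peval rmorphM hornerM. Qed.

Lemma pevalD p q z : peval (p + q) z = peval p z + peval q z.
Proof. by rewrite /peval rmorphD hornerD. Qed.

Lemma pevalZ x p z : peval (x *: p) z = x%:C * peval p z.
Proof. by rewrite -mul_polyC pevalM pevalC. Qed.

Lemma pevalX z : peval 'X z = z.
Proof. by rewrite /peval map_polyX hornerX. Qed.

Lemma peval1 z : peval 1 z = 1.
Proof. by rewrite /peval rmorph1 hornerC. Qed.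

Lemma pevalB p q z : peval (p - q) z = peval p z - peval q z.
Proof. by rewrite /peval rmorphB hornerD hornerN. Qed.

Lemma peval_real p x : peval p x%:C = (p.[x])%:C.
Proof. exact: horner_map. Qed.

Lemma peval_conj p z : peval p (conjc z) = conjc (peval p z).
Proof. exact: conjc_eval. Qed.

Lemma peval_lipschitz p (B : R) : exists2 L : R, 0 < L &
  forall z w, cn z <= B -> cn w <= B ->
    cn (peval p z) <= L /\ cn (peval p z - peval p w) <= L * cn (z - w).
Proof.
elim/poly_ind: p => [|p c [L L0 IH]].
  exists 1 => // z w _ _; rewrite /peval rmorph0 !horner0 subrr cn0.
  by rewrite mul1r cn_ge0 ler01.
exists (L * (`|B| + 1) + `|c| + 1).
  by rewrite ltr_wpDl// addr_ge0// mulr_ge0// ?addr_ge0// ltW.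
move=> z w zB wB; have [Lz Lzw] := IH z w zB wB; have [Lw _] := IH w z wB zB.
have Bz := le_trans zB (ler_norm B).
have pX v : peval (p * 'X + c%:P) v = peval p v * v + c%:C.
  by rewrite pevalD pevalM pevalC /peval map_polyX hornerX.
rewrite !pX; split.
  apply: le_trans (cnD _ _) _; rewrite cnM cn_real.
  have : cn (peval p z) * cn z <= L * (`|B| + 1).
    by rewrite ler_pM ?cn_ge0// (le_trans Bz)// lerDl.
  by move=> h; rewrite -addrA lerD// lerDl.
have -> : peval p z * z + c%:C - (peval p w * w + c%:C) =
  (peval p z - peval p w) * z + peval p w * (z - w) by ring.
apply: le_trans (cnD _ _) _; rewrite !cnM.
have h1 : cn (peval p z - peval p w) * cn z <= (L * cn (z - w)) * `|B|.
  by rewrite ler_pM ?cn_ge0.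
have h2 : cn (peval p w) * cn (z - w) <= L * cn (z - w).
  by rewrite ler_wpM2r ?cn_ge0.
apply: le_trans (lerD h1 h2) _.
rewrite [leLHS](_ : _ = L * (`|B| + 1) * cn (z - w)); last by ring.
by rewrite ler_wpM2r ?cn_ge0// -addrA lerDl addr_ge0.
Qed.

(** For real coefficients p(z) - conj(p(z)) = p(z) - p(conj z), so the Lipschitz bound between z and
    conj z makes Im p(z) of order Im z. *)
Lemma peval_Im p (B : R) : exists2 L : R, 0 < L & forall z, cn z <= B ->
  cn (peval p z) <= L /\ `|Im (peval p z)| <= L * `|Im z|.
Proof.
have [L L0 Lp] := peval_lipschitz p B; exists L => // z zB.
have [h1 h2] := Lp z (conjc z) zB (etrans (congr1 (<=%R^~ B) (cnJ z)) zB).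
split => //; move: h2; rewrite peval_conj.
have hJ (v : R[i]) : cn (v - conjc v) = 2 * `|Im v|.
  case: v => a b /=; rewrite subrr expr0n/= add0r opprK sqrtr_sqr (_ : b + b = 2 * b); last by ring.
  by rewrite normrM ger0_norm.
by rewrite !hJ mulrCA ler_pM2l.
Qed.

Lemma peval_prod_neq0 (s : seq R) z :
  (forall x, x \in s -> z != x%:C) -> peval (\prod_(x <- s) ('X - x%:P)) z != 0.
Proof.
elim: s => [|y s IH] zs.
  by rewrite big_nil -[1]/(1%:P) pevalC oner_neq0.
rewrite big_cons pevalM pevalXsubC mulf_neq0 ?subr_eq0 ?zs ?mem_head//.
by apply: IH => x xs; apply: zs; rewrite inE xs orbT.
Qed.

Lemma peval_prod_nonreal (s : seq R) z : Im z != 0 ->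
  peval (\prod_(x <- s) ('X - x%:P)) z != 0.
Proof.
by move=> z0; apply: peval_prod_neq0 => x _; apply: contraNneq z0 => ->.
Qed.

Lemma measurable_horner p : measurable_fun setT (horner p).
Proof. by apply: continuous_measurable_fun => x; exact: continuous_horner. Qed.

Lemma cvgC_peval p (F : set_system C) (FF : Filter F) (f : C -> C) (l : C) :
  f @ F --> l -> (peval p (f z) : C) @[z --> F] --> (peval p l : C).
Proof.
move=> fl; elim/poly_ind: p => [|p c IH].
  have -> : (fun z => peval 0 (f z) : C) = fun=> peval 0 l.
    by apply/funext => z; rewrite /peval rmorph0 !horner0.
  exact: cvgC_cst.
have pX v : peval (p * 'X + c%:P) v = peval p v * v + c%:C.
  by rewrite pevalD pevalM pevalC /peval map_polyX hornerX.
rewrite pX; under eq_fun do rewrite pX.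
by apply: cvgCD; [exact: cvgCM|exact: cvgC_cst].
Qed.

End RealPolynomials.

(** * Criteria for null sets on the line *)

Section NullSets.
Context {R : realType} (mu : {measure set R -> \bar R}).
Implicit Types (c h M : R).

(** Cutting the interval into n + 1 half-open pieces of half-width d / (n + 1) bounds its measure by
    (n + 1) M (d / (n + 1))^2, which tends to 0. *)
Lemma quadratic_interval_null (c d M : R) : 0 < d -> 0 <= M ->
  (forall x h, c <= x <= c + 2 * d -> 0 < h <= d ->
     (mu `[(x - h)%R, (x + h)%R[%classic <= (M * h ^+ 2)%:E)%E) ->
  mu `[c, (c + 2 * d)%R[%classic = 0%E.
Proof.
move=> d0 M0 hM.
have step n m h : (m <= n.+1)%N -> h = d / n.+1%:R ->
    (mu `[c, (c + 2 * h * m%:R)%R[%classic <= (M * h ^+ 2 * m%:R)%:E)%E.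
  move=> mn hE; have h0 : 0 < h by rewrite hE divr_gt0.
  elim: m mn => [|m IH] mn.
    by rewrite !mulr0 addr0 set_itv_ge ?measure0// bnd_simp ltxx.
  have -> : `[c, (c + 2 * h * m.+1%:R)%R[%classic =
      `[c, (c + 2 * h * m%:R)%R[ `|` `[(c + 2 * h * m%:R)%R, (c + 2 * h * m.+1%:R)%R[.
    apply/seteqP; split => x /=; rewrite !in_itv/=.
      move=> /andP[cx xm]; have [xl|xl] := ltP x (c + 2 * h * m%:R).
        by left; rewrite cx.
      by right; rewrite xm andbT.
    have hm : 0 <= 2 * h * m%:R by rewrite !mulr_ge0// ltW.
    have hm1 : 2 * h * m%:R <= 2 * h * m.+1%:R.
      have h2 : 0 <= 2 * h by lra.
      by rewrite ler_wpM2l// ler_nat.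
    by move=> [] /andP[h1 h2]; apply/andP; split; lra.
  apply: le_trans (measureU2 _ _ _) _ => //.
  rewrite (_ : M * h ^+ 2 * m.+1%:R = M * h ^+ 2 * m%:R + M * h ^+ 2); last first.
    by rewrite -[m.+1%:R]natr1; ring.
  rewrite EFinD; apply: leeD; first exact: IH (ltnW mn).
  have := hM (c + 2 * h * m%:R + h) h; rewrite addrK.
  rewrite (_ : c + 2 * h * m%:R + h + h = c + 2 * h * m.+1%:R); last first.
    by rewrite -[m.+1%:R]natr1; ring.
  apply.
    have hm : 0 <= 2 * h * m%:R by rewrite !mulr_ge0// ltW.
    have mn' : m%:R + 1 <= n.+1%:R :> R by rewrite natr1 ler_nat.
    have hn : h * n.+1%:R = d by rewrite hE divfK// pnatr_eq0.
    have : h * (m%:R + 1) <= d by rewrite -hn ler_wpM2l// ltW.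
    by move: hm; lra.
  by rewrite h0 /= hE ler_pdivrMr// ler_pMr// ler1n.
apply/eqP; rewrite eq_le measure_ge0 andbT.
apply/lee_addgt0Pr => e e0; rewrite add0e.
pose n := Num.truncn (M * d ^+ 2 / e).
have := step n n.+1 _ (leqnn _) erefl.
rewrite (_ : 2 * _ * _ = 2 * d); last by field; rewrite addrC natr1 pnatr_eq0.
move/le_trans; apply; rewrite lee_fin expr_div_n.
rewrite [leLHS](_ : _ = M * d ^+ 2 / n.+1%:R); last first.
  by field; rewrite addrC natr1 pnatr_eq0.
by rewrite ler_pdivrMr// -ler_pdivrMl// mulrC ltW// truncnS_gt.
Qed.

(** A Lindelof argument: every point of [U] lies in a null interval with rational endpoints, and
    there are countably many of these. *)
Lemma open_null (U : set R) :
  (forall x, U x -> exists2 d : R, 0 < d & mu `[(x - d)%R, (x + d)%R[%classic = 0%E) ->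
  mu.-negligible U.
Proof.
move=> Unull.
(* Enumerates pairs of rationals; codes of no pair and intervals of nonzero measure contribute the
   empty set. *)
pose F n := if (unpickle n : option (rat * rat)) is Some (p, q) then
  let I := `[ratr p : R, ratr q : R[%classic in
  if `[< mu I = 0%E >] then I else set0 else set0.
have FN n : mu.-negligible (F n).
  rewrite /F; case: (unpickle n) => [[p q]|]; last exact: negligible_set0.
  case: ifPn => [/asboolP I0|_]; last exact: negligible_set0.
  by apply/negligibleP.
apply: negligibleS (negligible_bigcup FN) => x /Unull[d d0 xd].
have [p /andP[p1 p2]] : exists p : rat, x - d < ratr p < x.
  have := @rat_in_itvoo _ (x - d) x; rewrite ltrBlDr ltrDl => /(_ d0)[p].
  by rewrite in_itv/=; exists p.
have [q /andP[q1 q2]] : exists q : rat, x < ratr q < x + d.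
  have := @rat_in_itvoo _ x (x + d); rewrite ltrDl => /(_ d0)[q].
  by rewrite in_itv/=; exists q.
have [m mE] : exists m, unpickle m = Some (p, q).
  by eexists; exact: pickleK.
exists m => //; rewrite /F mE.
case: asboolP => [_|[]]; first by rewrite /= in_itv/= ltW.
apply: subset_measure0 xd => // y /=; rewrite !in_itv/= => /andP[y1 y2].
by apply/andP; split; lra.
Qed.

End NullSets.

(** * Growth of the Cauchy transform near the real line *)

Section CauchyTransform.
Context {R : realType} (mu : {measure set R -> \bar R}) (al be : R).
Hypothesis irho : rintegrable mu rho.
Local Notation C := (R[i]^o).
Implicit Types (t : R) (z : C).

Definition cauchyQ z : C := al%:C + be%:C * z + kint mu (fun=> 1) z.

Lemma kdensity1 : kdensity mu (fun=> 1).
Proof.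
split; first exact: measurable_cst.
by under eq_fun do rewrite normr1 mul1r.
Qed.

Lemma measurable_inv_cn z : measurable_fun setT (fun t => (cn (t%:C - z) ^+ 2)^-1).
Proof.
apply: measurable_inv; apply: measurable_funX; apply: measurable_cn.
by apply: cmeasurableD; [exact: cmeasurable_real|exact: cmeasurable_cst].
Qed.

Lemma integrable_inv_cn z : Im z != 0 ->
  rintegrable mu (fun t => (cn (t%:C - z) ^+ 2)^-1).
Proof.
move=> z0; have := rintegrableZ (Im z)^-1 (Im_kint_integrable z0 kdensity1).
by under eq_fun do rewrite mul1r mulrA mulVf// mul1r.
Qed.

Lemma Im_cauchyQ z : Im z != 0 ->
  Im (cauchyQ z) = (be + \int[mu]_t (cn (t%:C - z) ^+ 2)^-1) * Im z.
Proof.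
move=> z0; rewrite /cauchyQ 2!cImD Im_kint//; last exact: kdensity1.
rewrite cImM /=; under eq_Rintegral do rewrite mul1r.
rewrite RintegralZl//; last exact: integrable_inv_cn.
by rewrite mul0r add0r addr0; ring.
Qed.

(** From (e / c - 1)^2 >= 0 one gets 1 / c <= 1 / (2 e) + (e / 2) / c^2. Only the last term can blow
    up near the real line; its integral is Im Q / Im z up to [be], and it carries the small factor
    [e]. *)
Lemma cn_kernel_split t z e : 0 < e -> Im z != 0 ->
  cn (kernel t z) <= (cn z + cn (1 + z ^+ 2) / (2 * e)) * rho t +
     cn (1 + z ^+ 2) * e / 2 * (cn (t%:C - z) ^+ 2)^-1.
Proof.
move=> e0 z0; apply: le_trans (cn_kernel_le t z0) _.
set B := cn (1 + _); set c := cn (_ - _).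
have c0 : 0 < c by rewrite cn_gt0 nonreal_sub.
have B0 : 0 <= B by exact: cn_ge0.
have r0 := rho_gt0 t; have r1 := rho_le1 t.
have h : c^-1 <= (2 * e)^-1 + e / 2 * (c ^+ 2)^-1.
  rewrite -subr_ge0 [leRHS](_ : _ = (2 * e)^-1 * (e / c - 1) ^+ 2); last first.
    by field; rewrite !gt_eqF.
  by rewrite mulr_ge0 ?sqr_ge0// invr_ge0 mulr_ge0// ltW.
have h2 : rho t * c^-1 <= rho t * (2 * e)^-1 + e / 2 * (c ^+ 2)^-1.
  apply: le_trans (_ : rho t * ((2 * e)^-1 + e / 2 * (c ^+ 2)^-1) <= _).
    by rewrite ler_pM2l.
  rewrite mulrDr lerD2l ler_piMl// mulr_ge0 ?invr_ge0 ?sqr_ge0//.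
  by rewrite divr_ge0// ltW.
rewrite mulrDr mulrCA mulrDl.
rewrite [leRHS](_ : _ = rho t * cn z + B * (rho t * (2 * e)^-1 + e / 2 * (c ^+ 2)^-1)).
  by rewrite lerD2l ler_wpM2l.
by field; rewrite !gt_eqF.
Qed.

Lemma cn_cauchyQ_le z e : 0 < e -> Im z != 0 ->
  cn (cauchyQ z) <= `|al| + `|be| * cn z +
    2 * ((cn z + cn (1 + z ^+ 2) / (2 * e)) * (\int[mu]_t rho t) +
     cn (1 + z ^+ 2) * e / 2 * (\int[mu]_t (cn (t%:C - z) ^+ 2)^-1)).
Proof.
move=> e0 z0; apply: le_trans (cnD _ _) _; apply: lerD.
  by apply: le_trans (cnD _ _) _; rewrite cnM !cn_real.
have i1 := rintegrableZ (cn z + cn (1 + z ^+ 2) / (2 * e)) irho.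
have i2 := rintegrableZ (cn (1 + z ^+ 2) * e / 2) (integrable_inv_cn z0).
rewrite -!RintegralZl//; last exact: integrable_inv_cn.
rewrite -RintegralD//.
apply: cn_cintegral_le; last first.
- by move=> t; rewrite cnM cn_real normr1 mul1r; exact: cn_kernel_split.
- exact: rintegrableD.
- by apply: cmeasurable_kint; exact: measurable_cst.
Qed.

Lemma inv_cn_integral_ge0 z : 0 <= \int[mu]_t (cn (t%:C - z) ^+ 2)^-1.
Proof. by apply: Rintegral_ge0 => t _; rewrite invr_ge0 sqr_ge0. Qed.

(** A Chebyshev bound: on the interval |t - x - i h|^2 <= 2 h^2. *)
Lemma measure_le_inv_cn x h : 0 < h ->
  (mu `[(x - h)%R, (x + h)%R[%classic <=
   (2 * h ^+ 2 * \int[mu]_t (cn (t%:C - (x +i* h)) ^+ 2)^-1)%:E)%E.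
Proof.
move=> h0; have z0 : Im (x +i* h) != 0 by rewrite /= gt_eqF.
have i1 := rintegrableZ (2 * h ^+ 2) (integrable_inv_cn z0).
have i2 := integrable_inv_cn z0.
rewrite -RintegralZl//.
rewrite /Rintegral fineK; last exact: (integrable_fin_num _ i1).
rewrite -[X in mu X]setIT -integral_indic//.
apply: ge0_le_integral => //.
- exact/measurable_EFinP/measurable_indic.
- exact: measurable_int i1.
move=> t _; rewrite lee_fin indicE.
have [tI|_] := boolP (t \in _); last first.
  by rewrite mulr_ge0// ?invr_ge0 ?sqr_ge0// mulr_ge0// sqr_ge0.
have c0 : 0 < cn (t%:C - (x +i* h)) ^+ 2 by rewrite exprn_gt0// cn_gt0 nonreal_sub.
rewrite ler_pdivlMr// mul1r sqr_cn/= sub0r sqrrN.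
move: tI; rewrite inE/= in_itv/= => /andP[xt tx].
have : (t - x) ^+ 2 <= h ^+ 2.
  rewrite -[leLHS]real_normK ?num_real// ler_pXn2r ?nnegrE ?normr_ge0 ?(ltW h0)//.
  by rewrite ler_norml; apply/andP; split; lra.
by lra.
Qed.

End CauchyTransform.

(** * Sign and integrability of the transformed density *)

Section SignOfDensity.
Context {R : realType} (mu : {measure set R -> \bar R}) (al be : R).
Hypotheses (irho : rintegrable mu rho) (be0 : 0 <= be).
Variables N D : {poly R}.
Local Notation Q := (cauchyQ mu al be).
Hypothesis NDQ : forall z, 0 < Im z ->
  0 <= Im (peval N z * conjc (peval D z) * Q z).

(* Where N D < 0 the product N conj(D) is real up to O(y), which bounds Im Q by
   O(y) |Q|, and |Q| is controlled by an arbitrarily small multiple of Im Q / y. *)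
Lemma inv_cn_integral_bounded x0 : N.[x0] * D.[x0] < 0 ->
  exists2 d, 0 < d & exists2 M, 0 <= M & forall x y, `|x - x0| <= d -> 0 < y <= d ->
    \int[mu]_t (cn (t%:C - (x +i* y)) ^+ 2)^-1 <= M.
Proof.
(* All points z below satisfy |z - x0| <= 2 d <= 1, so [A] bounds |z| and [B] bounds |1 + z^2|. *)
move=> ND0; pose A := `|x0| + 2; pose B := 1 + A ^+ 2.
have A0 : 0 < A by rewrite ltr_wpDl.
have B0 : 0 < B by rewrite ltr_wpDr// sqr_ge0.
have [L1 L10 hN1] := peval_lipschitz N A; have [L2 L20 hD1] := peval_lipschitz D A.
have [L3 L30 hN2] := peval_Im N A; have [L4 L40 hD2] := peval_Im D A.
pose L := L1 + L2 + L3 + L4; have L0 : 0 < L by rewrite !addr_gt0.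
pose c := - (N.[x0] * D.[x0]); have c0 : 0 < c by rewrite oppr_gt0.
(* Chosen so that 2 L^2 B e = c / 4: the term in [I] on the right is then absorbed by c / 2 I on the
   left. *)
pose e := c / (8 * L ^+ 2 * B).
have e0 : 0 < e by rewrite divr_gt0// !mulr_gt0// exprn_gt0.
(* Gives 4 L^2 d <= c / 2, so Re u stays below - c / 2 on the whole neighbourhood. *)
pose d := Num.min (1 / 2) (c / (8 * L ^+ 2)).
have d0 : 0 < d by rewrite lt_min divr_gt0//= divr_gt0// mulr_gt0// exprn_gt0.
have [A0' B0' L0' e0' c0'] : [/\ 0 <= A, 0 <= B, 0 <= L, 0 <= e & 0 <= c].
  by split; exact: ltW.
have Irho0 : 0 <= \int[mu]_t rho t by apply: Rintegral_ge0 => t _; exact/ltW/rho_gt0.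
pose K := `|al| + `|be| * A + 2 * ((A + B / (2 * e)) * \int[mu]_t rho t).
have K0 : 0 <= K.
  rewrite addr_ge0//; first by rewrite addr_ge0// mulr_ge0.
  by rewrite mulr_ge0// mulr_ge0// addr_ge0// divr_ge0// mulr_ge0.
exists d => //; exists (8 * L ^+ 2 * K / c).
  by rewrite divr_ge0// mulr_ge0// mulr_ge0// sqr_ge0.
move=> x y xd /andP[y0 yd]; set z := x +i* y.
have z0 : Im z != 0 by rewrite /= gt_eqF.
have dh : d <= 1 / 2 by rewrite /d ge_min lexx.
have dc : d <= c / (8 * L ^+ 2) by rewrite /d ge_min lexx orbT.
have zx : cn (z - x0%:C) <= 2 * d.
  apply: le_trans (cn_le_ReIm _) _; rewrite cReD cImD cReN cImN/= subr0.
  by rewrite (gtr0_norm y0); lra.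
have x0A : cn (x0%:C : R[i]) <= A by rewrite cn_real lerDl.
have zA : cn z <= A.
  have := cn_le_sub z x0%:C; rewrite cn_real /A; lra.
have [[Nz Nzx] [Dz Dzx]] := (hN1 z x0%:C zA x0A, hD1 z x0%:C zA x0A).
have [[Nx _] [Nz2 NzI]] := (hN1 x0%:C z x0A zA, hN2 z zA).
have [Dz2 DzI] := hD2 z zA.
have [L1L L2L] : L1 <= L /\ L2 <= L by split; rewrite /L; lra.
have [L3L L4L] : L3 <= L /\ L4 <= L by split; rewrite /L; lra.
set u := peval N z * conjc (peval D z).
have uRe : Re u <= - (c / 2).
  have h : cn (u - (N.[x0] * D.[x0])%:C) <= c / 2.
    have -> : u - (N.[x0] * D.[x0])%:C =
        (peval N z - peval N x0%:C) * conjc (peval D z) +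
        peval N x0%:C * conjc (peval D z - peval D x0%:C).
      rewrite /u conjcB !peval_real conjc_real rmorphM/=; ring.
    apply: le_trans (cnD _ _) _; rewrite !cnM !cnJ.
    apply: le_trans (_ : (L * (2 * d)) * L + L * (L * (2 * d)) <= _).
      apply: lerD; apply: ler_pM; rewrite ?cn_ge0//.
      - by apply: le_trans Nzx _; apply: ler_pM => //; rewrite ?cn_ge0 ?ltW.
      - by apply: le_trans Dz _.
      - by apply: le_trans Nx _.
      - by apply: le_trans Dzx _; apply: ler_pM => //; rewrite ?cn_ge0 ?ltW.
    rewrite [leLHS](_ : _ = 4 * L ^+ 2 * d); last by ring.
    apply: le_trans (_ : 4 * L ^+ 2 * (c / (8 * L ^+ 2)) <= _).
      by rewrite ler_pM2l// mulr_gt0// exprn_gt0.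
    by rewrite le_eqVlt; apply/orP; left; apply/eqP; field; rewrite gt_eqF.
  have := le_trans (le_trans (ler_norm _) (Re_le_cn _)) h.
  by rewrite cReD cReN /= /c; lra.
have uIm : `|Im u| <= 2 * L ^+ 2 * y.
  rewrite /u cImM cReJ cImJ; apply: le_trans (ler_normD _ _) _.
  rewrite !normrM normrN (gtr0_norm (y0 : 0 < Im z)) in NzI DzI *.
  apply: le_trans (_ : L * (L * y) + (L * y) * L <= _); last first.
    by rewrite le_eqVlt; apply/orP; left; apply/eqP; ring.
  apply: lerD; apply: ler_pM; rewrite ?normr_ge0//.
  - by apply: le_trans (Re_le_cn _) _; exact: le_trans Nz _.
  - by apply: le_trans DzI _; rewrite ler_pM2r.
  - by apply: le_trans NzI _; rewrite ler_pM2r.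
  - by apply: le_trans (Re_le_cn _) _; exact: le_trans Dz _.
have := NDQ (y0 : 0 < Im z); rewrite -/u cImM Im_cauchyQ//.
set I := \int[mu]_t _ => uQ.
have I0 : 0 <= I by exact: inv_cn_integral_ge0.
have QK : cn (Q z) <= K + B * e * I.
  apply: le_trans (cn_cauchyQ_le al be irho e0 z0) _; rewrite -/I.
  have zB : cn (1 + z ^+ 2) <= B.
    apply: le_trans (cnD _ _) _; rewrite cn1 cnX lerD2l.
    by rewrite ler_pXn2r ?nnegrE ?cn_ge0// ltW.
  rewrite /K [leRHS](_ : _ = `|al| + `|be| * A +
    2 * ((A + B / (2 * e)) * \int[mu]_t rho t + B * e / 2 * I)); last first.
    by field; rewrite gt_eqF.
  apply: lerD; first by rewrite lerD2l ler_wpM2l.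
  rewrite ler_pM2l//; apply: lerD.
    by rewrite ler_wpM2r// lerD// ler_pM2r// invr_gt0 mulr_gt0.
  by rewrite ler_wpM2r// ler_pM2r// ler_pM2r.
(* In Im (u Q) = Re u Im Q + Im u Re Q >= 0 the first term is at most - c / 2 I y and must be
   compensated by the second, which is O(y) |Q|. *)
have ImQ : c / 2 * I * y <= 2 * L ^+ 2 * y * (K + B * e * I).
  have h1 : Im u * Re (Q z) <= 2 * L ^+ 2 * y * (K + B * e * I).
    apply: le_trans (ler_norm _) _; rewrite normrM; apply: ler_pM => //.
    by apply: le_trans (Re_le_cn _) QK.
  have h2 : c / 2 * I * y <= - Re u * ((be + I) * y).
    rewrite -mulrA; apply: ler_pM => //.
    - by rewrite divr_ge0// ltW.
    - by rewrite mulr_ge0// ltW.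
    - by rewrite lerNr.
    - by rewrite ler_pM2r// lerDr.
  apply: le_trans h2 _; apply: le_trans h1; rewrite mulNr; move: uQ => /=; lra.
rewrite ler_pdivlMr// mulrC.
have eB : 2 * L ^+ 2 * (B * e) = c / 4.
  by rewrite /e; field; rewrite !gt_eqF.
have {}ImQ : c / 2 * I <= 2 * L ^+ 2 * K + c / 4 * I.
  rewrite -(ler_pM2r y0); apply: le_trans ImQ _; rewrite -eB.
  by rewrite le_eqVlt; apply/orP; left; apply/eqP; ring.
by move: ImQ; lra.
Qed.

(** Where the integral of |t - z|^-2 stays bounded by M, an interval of half-width h has measure at
    most 2 M h^2, too little to carry any mass. *)
Lemma density_sign_null : mu.-negligible [set t | N.[t] * D.[t] < 0].
Proof.
apply: open_null => x0 /= /inv_cn_integral_bounded[d d0 [M M0 h]].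
exists (d / 2); first by rewrite divr_gt0.
have -> : x0 + d / 2 = x0 - d / 2 + 2 * (d / 2) by field.
apply: (@quadratic_interval_null _ mu _ _ (2 * M)).
- by rewrite divr_gt0.
- by rewrite mulr_ge0.
move=> x h' /andP[x1 x2] /andP[h0 hd].
apply: le_trans (measure_le_inv_cn irho x h0) _; rewrite lee_fin.
rewrite [leRHS](_ : _ = 2 * h' ^+ 2 * M); last by ring.
rewrite ler_pM2l; last by rewrite mulr_gt0// exprn_gt0.
apply: h; first by rewrite ler_norml; apply/andP; split; lra.
by rewrite h0; lra.
Qed.

End SignOfDensity.

(** * Positivity of Im excludes leading terms of order two or more *)

Section LeadingTerm.
Context {R : realType}.
Local Notation C := (R[i]^o).
Implicit Types (w z k : C) (F : C -> C).

Lemma cos_sin_exp (x : R) n :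
  (cos x +i* sin x) ^+ n = cos (n%:R * x) +i* sin (n%:R * x).
Proof.
elim: n => [|n IH]; first by rewrite mul0r cos0 sin0.
rewrite exprS IH -natr1 mulrDl mul1r cosD sinD.
by apply: complex_ext; rewrite ?cReM ?cImM/=; ring.
Qed.

(** The arguments pi / (2 j) and 3 pi / (2 j) of the two roots both lie in (0, pi) because j >= 2;
    for j = 1 the second would not. *)
Lemma upper_root_i j : (2 <= j)%N ->
  (exists2 w : R[i], 0 < Im w & w ^+ j = 0 +i* 1) /\
  (exists2 w : R[i], 0 < Im w & w ^+ j = 0 +i* -1).
Proof.
move=> j2; have j0 : (0 : R) < j%:R by rewrite ltr0n (ltn_trans _ j2).
have j2' : (2 : R) <= j%:R by rewrite ler_nat.
have p0 := pi_gt0 R.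
have dir (x : R) : 0 < x -> x < j%:R * pi -> exists2 w : R[i], 0 < Im w &
    w ^+ j = cos x +i* sin x.
  move=> x0 xp; exists (cos (x / j%:R) +i* sin (x / j%:R)) => /=.
    by apply: sin_gt0_pi; rewrite divr_gt0//= ltr_pdivrMr// mulrC.
  by rewrite cos_sin_exp mulrC divfK// gt_eqF.
split.
  have [||w w0 wj] := dir (pi / 2); first by rewrite divr_gt0.
    have : 2 * pi <= j%:R * pi :> R by rewrite ler_pM2r.
    by lra.
  by exists w => //; rewrite wj cos_pihalf sin_pihalf.
have [||w w0 wj] := dir (pi / 2 + pi).
- by rewrite addr_gt0// divr_gt0.
- have : 2 * pi <= j%:R * pi :> R by rewrite ler_pM2r.
  by lra.
by exists w => //; rewrite wj cosDpi sinDpi cos_pihalf sin_pihalf oppr0.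
Qed.

(** The ray through w lies in the Stolz angle of slope |Re w| / Im w. At infinity it is parametrized
    by 1 / e, so that small [e] means close to [xi] in both cases. *)
Lemma sector_direction xi w n : 0 < Im w -> exists2 e : R, 0 < e &
  sector xi (`|Re w| / Im w) n
    (if xi is Some b then b%:C + e%:C * w else e^-1%:C * w).
Proof.
move=> w0; have cw0 : 0 < cn w by rewrite cn_gt0 nonreal_neq0// gt_eqF.
have mk (e : R) : 0 < e -> stolz 0 (`|Re w| / Im w) (e%:C * w).
  move=> e0; split; first by rewrite /nonreal/= cImM/= mul0r addr0 mulf_neq0 ?gt_eqF.
  rewrite cReM cImM/= !mul0r subr0 addr0 subr0 !normrM (gtr0_norm w0).
  by rewrite mulrCA divfK ?gt_eqF.
case: xi => [b|].
  pose e := n.+1%:R^-1 / (cn w + 1).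
  have e0 : 0 < e by rewrite divr_gt0 ?invr_gt0// addr_gt0.
  exists e => //; split.
    have [m1 m2] := mk e e0.
    have eI : Im (b%:C + e%:C * w) = Im (e%:C * w) by rewrite cImD add0r.
    have eR : Re (b%:C + e%:C * w) - b = Re (e%:C * w) - 0.
      by rewrite cReD subr0 addrAC subrr add0r.
    by split; rewrite /nonreal /mkset /odflt /oapp ?eI ?eR.
  rewrite addrAC subrr add0r cnM cn_real gtr0_norm// /e -mulrA gtr_pMr ?invr_gt0//.
  by rewrite mulrC ltr_pdivrMr ?mul1r ?ltrDl// addr_gt0.
exists (cn w / n.+1%:R); first by rewrite divr_gt0.
split; first by apply: mk; rewrite invr_gt0 divr_gt0.
rewrite cnM cn_real gtr0_norm ?invr_gt0 ?divr_gt0// invf_div divfK ?gt_eqF//.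
by rewrite ltr_nat.
Qed.

Lemma Re_limit_le0 k :
  (forall e : R, 0 < e -> exists2 v : C, Re v <= 0 & cn (v - k) < e) -> Re k <= 0.
Proof.
move=> h; apply/ler_addgt0Pr => e /h[v v0]; rewrite cnB add0r => vk.
have := le_lt_trans (le_trans (ler_norm _) (Re_le_cn (k - v))) vk.
by rewrite cReD cReN; lra.
Qed.

(* Along the rays where (z - b)^j (resp. z^-j) is a positive multiple of 'i and of -'i,
   Im F >= 0 forces opposite signs on the leading coefficient. *)
Lemma leading_term_eq0 xi F j k : (2 <= j)%N ->
  (forall z, 0 < Im z -> 0 <= Im (F z)) ->
  (if xi is Some b then z - b%:C else z^-1) ^+ j * F z @[z --> nontangential xi] --> k ->
  Im k = 0 -> k = 0.
Proof.
move=> j2 F0 Fk k0; have [[w w0 wj] [v v0 vj]] := upper_root_i j2.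
have ray u e : 0 < Im u -> 0 < e -> exists d p x, [/\ (0 : R) < d, 0 <= p &
    cn ((d%:C * (if xi is Some _ then u else u^-1)) ^+ j * (x +i* p) - k) < e].
  move=> u0 e0; have /nontangential_cvgP/(_ (`|Re u| / Im u) e e0)[n nP] := Fk.
  have [d d0 ds] := sector_direction xi n u0; have := nP _ ds.
  set z := (if xi is Some b then b%:C + d%:C * u else d^-1%:C * u) => h.
  have z0 : 0 < Im z.
    by rewrite /z; case: (xi) => [b|]; rewrite ?cImD cImM/= ?mul0r ?add0r ?addr0 mulr_gt0// invr_gt0.
  exists d, (Im (F z)), (Re (F z)); split => //; first exact: F0.
  rewrite [Re _ +i* _](_ : _ = F z); last exact: complex_ext.
  move: h; rewrite /z; case: (xi) => [b|]; first by rewrite addrAC subrr add0r.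
  by rewrite invfM fmorphV/= invrK.
(* When (d u)^j = d^j s i, the real part of the product is - d^j s Im F, so its sign is opposite to
   that of s. *)
have sgn (u : C) (d p : R) (s : R) x : (u ^+ j = (0 +i* s)) -> 
   Re ((d%:C * u : R[i]) ^+ j * (x +i* p)) = - (d ^+ j * s * p).
  move=> us; rewrite exprMn us -[d%:C ^+ j]rmorphXn !cReM !cImM /=; ring.
(* At infinity the local parameter is u^-1, which exchanges i and - i: there the ray through [v],
   not [w], gives the first inequality. *)
have ViE (u : C) (s : R) : s ^+ 2 = 1 -> u ^+ j = 0 +i* s -> u^-1 ^+ j = 0 +i* - s.
  move=> s1 us; rewrite exprVn us; apply: complex_ext; rewrite ?cReV ?cImV sqr_cn/=.
    by rewrite mul0r.
  by rewrite expr0n/= add0r s1 divr1.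
have k1 : Re k <= 0.
  apply: Re_limit_le0 => // e e0.
  case: (xi) ray => [b|] ray.
    have [d [p [x [d0 p0 h]]]] := ray w e w0 e0.
    eexists; last exact: h.
    by rewrite (sgn _ _ _ 1) ?wj// mulr1 oppr_le0 mulr_ge0// exprn_ge0// ltW.
  have [d [p [x [d0 p0 h]]]] := ray v e v0 e0.
  eexists; last exact: h.
  rewrite (sgn _ _ _ 1) ?mulr1 ?oppr_le0.
    by rewrite mulr_ge0// exprn_ge0// ltW.
  by rewrite (ViE _ (-1)) ?opprK ?sqrrN ?expr1n.
have k2 : Re (- k) <= 0.
  apply: Re_limit_le0 => // e e0.
  case: (xi) ray => [b|] ray.
    have [d [p [x [d0 p0 h]]]] := ray v e v0 e0.
    exists (- ((d%:C * v) ^+ j * (x +i* p))); last by rewrite -opprD cnN; exact: h.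
    rewrite cReN (sgn _ _ _ (-1)) ?vj// opprK mulrN1 mulNr oppr_le0.
    by rewrite mulr_ge0// exprn_ge0// ltW.
  have [d [p [x [d0 p0 h]]]] := ray w e w0 e0.
  exists (- ((d%:C * w^-1) ^+ j * (x +i* p))); last by rewrite -opprD cnN; exact: h.
  rewrite cReN (sgn _ _ _ (-1)) ?(ViE _ 1) ?expr1n ?wj// opprK mulrN1 mulNr oppr_le0.
  by rewrite mulr_ge0// exprn_ge0// ltW.
apply: complex_ext; last by [].
by apply/eqP; rewrite eq_le k1 /=; move: k2; rewrite cReN oppr_le0.
Qed.

End LeadingTerm.

(** * Atoms of the measure and poles of the rational factor *)

Section PoleAtoms.
Context {R : realType} (mu : {measure set R -> \bar R}).
Hypothesis irho : rintegrable mu rho.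
Local Notation C := (R[i]^o).

Lemma kdensity_indic (A : set R) : measurable A -> kdensity mu \1_A.
Proof.
move=> mA; apply: kdensity_le (kdensity1 irho) _; first exact: measurable_indic.
by move=> t; rewrite indicE normr1; case: (_ \in _); rewrite ?normr1 ?normr0.
Qed.

Lemma atom_fin_num (b : R) : mu [set b] \is a fin_num.
Proof.
have [_] := kdensity_indic (measurable_set1 b).
move=> /(rintegrableZ (rho b)^-1); rewrite /rintegrable => i1.
have i2 : mu.-integrable setT (EFin \o \1_[set b]).
  apply: eq_integrable i1 => // t _ /=; congr EFin; rewrite indicE.
  case: (boolP (t \in [set b])) => [|_]; last by rewrite normr0 mul0r mulr0.
  by rewrite inE/= => ->; rewrite normr1 mul1r mulVf// gt_eqF// rho_gt0.
rewrite -[[set b]]setIT -integral_indic//; exact: integrable_fin_num i2.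
Qed.

Lemma kint_atom (b : R) (z : C) :
  kint mu \1_[set b] z = (fine (mu [set b]))%:C * kernel b z.
Proof.
rewrite /kint mulrC.
have -> : (fun t => (\1_[set b] t)%:C * kernel t z) =
    (fun t => kernel b z * (\1_[set b] t)%:C).
  apply/funext => t; rewrite indicE; case: (boolP (t \in [set b])) => [|_].
    by rewrite inE/= => ->; rewrite mulrC.
  by rewrite mul0r mulr0.
have i1 : rintegrable mu \1_[set b].
  apply/integrableP; split; first exact/measurable_EFinP/measurable_indic.
  under eq_integral do rewrite /= ger0_norm//.
  rewrite integral_indic// setIT; have := atom_fin_num b.
  by rewrite fin_numElt => /andP[].
rewrite cintegralZ; last first.
  apply: (cintegrable_le _ i1) => [|t]; last by rewrite cn_real ger0_norm.
  exact/cmeasurable_real/measurable_indic.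
congr (_ * _); apply: complex_ext => /=; last by rewrite Rintegral_cst// mul0r.
by rewrite /Rintegral integral_indic// setIT.
Qed.

(** The density 1 is split into [g], which vanishes at b and disappears in the limit, and the
    indicator of b, which contributes its mass times (z - b) / (b - z) = -1. *)
Lemma cauchyQ_atom (al be b : R) :
  (z - b%:C) * cauchyQ mu al be z @[z --> nontangential (Some b)] -->
    (- (fine (mu [set b]))%:C : C).
Proof.
pose g t : R := 1 - \1_[set b] t.
have kb := kdensity_indic (measurable_set1 b).
have kg : kdensity mu g.
  apply: kdensity_le (kdensity1 irho) _; last first.
    move=> t; rewrite /g normr1 indicE; case: (_ \in _).
      by rewrite subrr normr0.
    by rewrite subr0 normr1.
  by apply: measurable_funB; [exact: measurable_cst|exact: measurable_indic].
have gb : g b = 0 by rewrite /g indicE mem_set// subrr.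
have zb : z - b%:C @[z --> nontangential (Some b)] --> (0 : C).
  rewrite -(subrr (b%:C : C)); apply: cvgCB; last exact: cvgC_cst.
  exact: nontangential_id.
have h : ((z - b%:C) * (al%:C + be%:C * z) + (z - b%:C) * kint mu g z) +
    (fine (mu [set b]))%:C * (- 1 - (z - b%:C) * (b * rho b)%:C)
    @[z --> nontangential (Some b)] -->
    (0 * (al%:C + be%:C * b%:C) + 0 + (fine (mu [set b]))%:C * (- 1 - 0 * (b * rho b)%:C) : C).
  apply: cvgCD; first apply: cvgCD.
  - apply: cvgCM; first exact: zb.
    apply: cvgCD; first exact: cvgC_cst.
    by apply: cvgCM; [exact: cvgC_cst|exact: nontangential_id].
  - exact: kint_ray.
  - apply: cvgCM; first exact: cvgC_cst.
    apply: cvgCB; first exact: cvgC_cst.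
    by apply: cvgCM; [exact: zb|exact: cvgC_cst].
rewrite !mul0r addr0 subr0 add0r mulrN1 in h.
apply: cvgC_near_eq h; near=> z.
have z0 : Im z != 0 by near: z; exact: nontangential_nonreal.
rewrite /mkset (_ : kint mu g z = kint mu (fun=> 1) z - kint mu \1_[set b] z); last first.
  by rewrite -kintB//; exact: kdensity1.
rewrite kint_atom /cauchyQ /kernel; have := nonreal_sub b z0 => bz.
by field.
Unshelve. all: by end_near. Qed.

Lemma prod_XsubC_split (b : R) (s : seq R) :
  \prod_(x <- s) ('X - x%:P) = ('X - b%:P) ^+ count_mem b s *
    \prod_(x <- [seq x <- s | x != b]) ('X - x%:P).
Proof.
elim: s => [|x s IH]; first by rewrite !big_nil mulr1.
rewrite big_cons IH /=; have [->|xb] := eqVneq x b; first by rewrite exprS mulrA.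
by rewrite add0n big_cons mulrCA.
Qed.

Variables (al be : R) (s : seq R) (N : {poly R}).
Local Notation D := (\prod_(x <- s) ('X - x%:P)).
Local Notation Q := (cauchyQ mu al be).
Hypothesis P_Im : forall z, 0 < Im z -> 0 <= Im (peval N z / peval D z * Q z).

(** An atom at a pole of order m of r would give r Q a leading term of order m + 1 >= 2, which
    positivity of the imaginary part excludes. *)
Lemma pole_atom0 b : b \in s -> N.[b] != 0 -> mu [set b] = 0%E.
Proof.
move=> bs Nb; pose m := count_mem b s; pose D1 := \prod_(x <- [seq x <- s | x != b]) ('X - x%:P).
have m0 : (0 < m)%N by rewrite -has_count has_pred1.
have D1b : peval D1 b%:C != 0.
  apply: peval_prod_neq0 => x; rewrite mem_filter => /andP[xb _].
  by apply: contraNneq xb => /complexI ->.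
pose k := (fine (mu [set b])) * (N.[b] / D1.[b]).
have h : (z - b%:C) ^+ m.+1 * (peval N z / peval D z * Q z)
    @[z --> nontangential (Some b)] --> (- k%:C : C).
  have h1 : peval N z / peval D1 z * ((z - b%:C) * Q z) @[z --> nontangential (Some b)]
      --> (peval N b%:C / peval D1 b%:C * - (fine (mu [set b]))%:C : C).
    apply: cvgCM; last exact: cauchyQ_atom.
    apply: cvgCM; first by apply: cvgC_peval; exact: nontangential_id.
    apply: cvgCV; first exact: D1b.
    by apply: cvgC_peval; exact: nontangential_id.
  have -> : (- k%:C : C) = peval N b%:C / peval D1 b%:C * - (fine (mu [set b]))%:C.
    by rewrite !peval_real /k !rmorphM fmorphV/=; ring.
  apply: cvgC_near_eq h1; near=> z.
  have z0 : Im z != 0 by near: z; exact: nontangential_nonreal.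
  rewrite /mkset (prod_XsubC_split b s) pevalM -/m -/D1.
  have -> : peval (('X - b%:P) ^+ m) z = (z - b%:C) ^+ m.
    by rewrite /peval rmorphXn horner_exp -/(peval _ _) pevalXsubC.
  have zb : z - b%:C != 0 by rewrite -opprB oppr_eq0 nonreal_sub.
  have D1z := peval_prod_nonreal [seq x <- s | x != b] z0.
  have zbm : (z - b%:C) ^+ m != 0 by rewrite expf_neq0.
  by rewrite exprS; field; rewrite zbm D1z.
have k0 : (- k%:C : C) = 0.
  by apply: (leading_term_eq0 (xi := Some b) (F := fun z => peval N z / peval D z * Q z) _ P_Im h);
    rewrite // ?ltnS// cImN/= oppr0.
move/eqP : k0; rewrite oppr_eq0 fmorph_eq0 /k mulf_eq0 => /orP[|].
  by rewrite -{2}(fineK (atom_fin_num b)) => /eqP ->.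
move: D1b; rewrite peval_real fmorph_eq0 => D1b.
by rewrite mulf_eq0 invr_eq0 (negbTE Nb) (negbTE D1b).
Unshelve. all: by end_near. Qed.

End PoleAtoms.

(** * Separating a rational part from the product *)

Section RationalPart.
Context {R : realType}.
Local Notation C := (R[i]^o).

Lemma horner_Re_Im (p : {poly R[i]}) : exists a b : {poly R},
  forall z, p.[z] = peval a z + (0 +i* 1) * peval b z.
Proof.
exists (\poly_(i < size p) Re p`_i), (\poly_(i < size p) Im p`_i) => z.
have h (E : nat -> R) n : peval (\poly_(i < n) E i) z = \sum_(i < n) (E i)%:C * z ^+ i.
  rewrite /peval poly_def rmorph_sum horner_sum; apply: eq_bigr => i _.
  by rewrite /= linearZ/= map_polyXn hornerZ hornerXn.
rewrite !h horner_coef mulr_sumr -big_split; apply: eq_bigr => i _ /=.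
rewrite mulrA -mulrDl; congr (_ * _).
by apply: complex_ext; rewrite ?cReD ?cImD ?cReM ?cImM/=; ring.
Qed.

(** Splitting coefficients gives p = a + i b with a and b real polynomials; the symmetry forces b to
    vanish at every nonreal point. *)
Lemma real_poly_of_symmetric (G : C -> C) (p : {poly R[i]}) :
  (forall z, Im z != 0 -> G z = p.[z]) ->
  (forall z, Im z != 0 -> G (conjc z) = conjc (G z)) ->
  exists q : {poly R}, forall z, Im z != 0 -> G z = peval q z.
Proof.
move=> Gp GJ; have [a [b pab]] := horner_Re_Im p; exists a => z z0.
have zJ0 : Im (conjc z) != 0 by rewrite cImJ oppr_eq0.
have := GJ z z0; rewrite !Gp// !pab !peval_conj conjcD conjcM.
have -> : conjc (0 +i* 1) = - (0 +i* 1) :> R[i].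
  by apply: complex_ext; rewrite /= ?oppr0.
move/addrI; rewrite mulNr => /eqP; rewrite -subr_eq0 opprK -mulr2n mulrn_eq0 /=.
rewrite mulf_eq0 => /orP[|].
  by rewrite eq_complex /= oner_eq0 andbF.
rewrite -(inj_eq (can_inj (@conjcK R))) conjcK conjc0 => /eqP ->.
by rewrite mulr0 addr0.
Qed.

Variable mu : {measure set R -> \bar R}.
Variables (s : seq R) (N : {poly R}) (chi : R -> R).
Local Notation D := (\prod_(x <- s) ('X - x%:P)).
Hypotheses (kchi : kdensity mu chi)
  (kchiND : kdensity mu (fun t => chi t * (N.[t] / D.[t])))
  (chiD : forall t, chi t != 0 -> D.[t] != 0).

(* For fixed t the integrand is a polynomial in z, of degree bounded independently
   of t, so it is recovered by interpolation from finitely many nonreal nodes. *)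
Lemma rational_part : exists p : {poly R}, forall z, Im z != 0 ->
  peval N z * kint mu chi z -
  peval D z * kint mu (fun t => chi t * (N.[t] / D.[t])) z = peval p z.
Proof.
pose F t z : R[i] := (peval N z - peval D z * (N.[t] / D.[t])%:C) *
  ((chi t)%:C * kernel t z).
pose d := maxn (size N) (size D); pose n := d.+3.
have Fpoly t : exists2 f : {poly R[i]}, (size f <= n)%N &
    forall z, Im z != 0 -> F t z = f.[z].
  have [c0|c0] := eqVneq (chi t) 0.
    by exists 0 => [|z _]; rewrite ?size_poly0// /F c0 mul0r mulr0 horner0.
  have D0 := chiD c0.
  (* The root t of [p] cancels the pole of the kernel at z = t, so the quotient [q] turns the
     integrand into a polynomial in z. *)
  pose p := D.[t] *: N - N.[t] *: D.
  have : root p t by rewrite /root !hornerE mulrC subrr.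
  move=> /factor_theorem[q pq].
  have sq : (size q <= d)%N.
    have [->|q0] := eqVneq q 0; first by rewrite size_poly0.
    have : (size p <= d)%N.
      apply: leq_trans (size_polyD _ _) _; rewrite size_polyN geq_max.
      by rewrite !(leq_trans (size_scale_leq _ _))// leq_max leqnn ?orbT.
    by rewrite pq size_Mmonic ?monicXsubC// size_XsubC addn2 => /ltnW.
  pose f : {poly R} := - (chi t * rho t / D.[t]) *: (q * (1 + t *: 'X)).
  exists (map_poly (real_complex R) f).
    rewrite size_map_poly; apply: leq_trans (size_scale_leq _ _) _.
    apply: leq_trans (size_polyMleq _ _) _.
    have h2 : (size (1 + t *: 'X : {poly R})%R <= 2)%N.
      apply: leq_trans (size_polyD _ _) _; rewrite size_poly1 geq_max /=.
      by apply: leq_trans (size_scale_leq _ _) _; rewrite size_polyX.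
    apply: leq_trans (leq_pred _) _; apply: leq_trans (leq_add sq h2) _.
    by rewrite addn2.
  move=> z z0; have tz := nonreal_sub t z0; rewrite -[RHS]/(peval f z).
  have pz : peval p z = peval N z * (D.[t])%:C - peval D z * (N.[t])%:C.
    by rewrite pevalB !pevalZ; congr (_ - _); rewrite mulrC.
  have qz : peval q z = (peval N z * (D.[t])%:C - peval D z * (N.[t])%:C) / (z - t%:C).
    rewrite -pz pq pevalM pevalXsubC mulfK//.
    by rewrite -opprB oppr_eq0.
  have fz : peval f z = - ((chi t * rho t / D.[t])%:C * peval q z * (1 + t%:C * z)).
    by rewrite pevalZ pevalM pevalD peval1 pevalZ pevalX rmorphN mulNr mulrA.
  rewrite fz qz /F kernelE//; move: (rho t) => rt.
  have DC0 : (D.[t])%:C != 0 :> R[i] by rewrite fmorph_eq0.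
  rewrite !rmorphM/= !fmorphV/=; field.
  have zt : z - t%:C != 0 by rewrite -opprB oppr_eq0.
  by rewrite DC0 tz zt.
(* The nodes do not depend on t, so integrating in t gives a fixed combination of the Lagrange
   polynomials with coefficients [G (x j)]. *)
pose x (j : nat) : R[i] := 0 +i* j.+1%:R.
have x0 j : Im (x j) != 0 by rewrite /= pnatr_eq0.
have xinj : injective x by move=> i j [] /eqP; rewrite eqr_nat => /eqP[].
pose L (j : 'I_n) : {poly R[i]} := tnth (qpoly.lagrange n x) j.
have FE t z : Im z != 0 -> F t z = \sum_(j < n) F t (x j) * (L j).[z].
  move=> z0; have [f sf fF] := Fpoly t; rewrite fF//.
  rewrite [in LHS](qpoly.lagrange_gen _ xinj sf)// horner_sum.
  by apply: eq_bigr => j _; rewrite hornerM hornerC fF.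
pose G z := peval N z * kint mu chi z -
  peval D z * kint mu (fun t => chi t * (N.[t] / D.[t])) z.
have iF z : Im z != 0 -> cintegrable mu (F^~ z : R -> C) /\ cintegral mu (F^~ z : R -> C) = G z.
  move=> z0.
  have j1 := cintegrableZ (peval N z) (cintegrable_kint z0 kchi).
  have j2 := cintegrableZ (- peval D z) (cintegrable_kint z0 kchiND).
  have FF : (F^~ z : R -> C) = (fun t => peval N z * ((chi t)%:C * kernel t z) +
      - peval D z * ((chi t * (N.[t] / D.[t]))%:C * kernel t z)).
    by apply/funext => t; rewrite /F !rmorphM/=; ring.
  rewrite FF; split; first exact: cintegrableD.
  rewrite cintegralD// !cintegralZ ?mulNr//; exact: cintegrable_kint.
apply: (@real_poly_of_symmetric G (\sum_(j < n) (G (x j))%:P * L j)).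
  move=> z z0; have [jF <-] := iF z z0.
  rewrite (_ : (F^~ z : R -> C) = (fun t => \sum_(j < n)
      (L j).[z] * F t (x j) : C)); last first.
    by apply/funext => t; rewrite FE//; apply: eq_bigr => j _; rewrite mulrC.
  rewrite horner_sum.
  have [|_ ->] := @cintegral_sum _ mu _ (index_enum 'I_n)
    (fun j t => (L j).[z] * F t (x j) : C).
    by move=> j; apply: cintegrableZ; have [] := iF _ (x0 j).
  apply: eq_bigr => j _; have [j1 j2] := iF _ (x0 j).
  by rewrite cintegralZ// j2 hornerM hornerC mulrC.
move=> z z0; rewrite /G !peval_conj !kint_conj//.
by rewrite conjcB !conjcM.
Qed.

End RationalPart.

(** * Partial fractions under a growth condition *)

Section PartialFractions.
Context {R : realType}.
Local Notation C := (R[i]^o).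
Implicit Types (p q : {poly R}) (s : seq R) (G : C -> C) (xi : option R) (z : C).
Local Notation D s := (\prod_(x <- s) ('X - x%:P)).

Definition local_par xi z : C := if xi is Some b then z - b%:C else z^-1.

(** Encodes poles of order at most one on [S] and at infinity in the form that [leading_term_eq0]
    delivers: a real limit with exponent j >= 2, should it exist, is zero. *)
Definition simple_growth (S : pred R) G := forall xi j (k : R),
  (if xi is Some b then S b else true) -> (2 <= j)%N ->
  local_par xi z ^+ j * G z @[z --> nontangential xi] --> (k%:C : C) -> k = 0.

Lemma local_par_cvg0 xi : local_par xi z @[z --> nontangential xi] --> (0 : C).
Proof.
case: xi => [b|] /=; last exact: nontangential_inv.
rewrite -(subrr (b%:C : C)); apply: cvgCB; last exact: cvgC_cst.
exact: nontangential_id.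
Qed.

Lemma local_par_exp_cvg0 xi j : (0 < j)%N ->
  local_par xi z ^+ j @[z --> nontangential xi] --> (0 : C).
Proof.
move=> j0; have -> : (0 : C) = 0 ^+ j by rewrite expr0n gtn_eqF.
by apply: cvgCX; exact: local_par_cvg0.
Qed.

Lemma simple_growth_eq S G H : (forall z, Im z != 0 -> G z = H z) ->
  simple_growth S G -> simple_growth S H.
Proof.
move=> GH hG xi j k xS j2 h; apply: (hG xi j k xS j2).
apply: cvgC_nonreal_eq h => z z0.
by rewrite GH.
Qed.

Lemma local_par_simple_pole xi j (c b : R) : (2 <= j)%N ->
  local_par xi z ^+ j * (c%:C / (b%:C - z)) @[z --> nontangential xi] --> (0 : C).
Proof.
case: j => [//|[//|j]] _; have [->|xib] := eqVneq xi (Some b).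
  have h : - (local_par (Some b) z ^+ j.+1 * c%:C) @[z --> nontangential (Some b)] --> (0 : C).
    rewrite -oppr0 -(mul0r (c%:C : C)); apply: cvgN.
    apply: cvgCM; last exact: cvgC_cst.
    exact: local_par_exp_cvg0.
  apply: cvgC_nonreal_eq h => z z0.
  have bz := nonreal_sub b (z0 : Im z != 0).
  rewrite [in RHS]exprS /=; move: (_ ^+ j.+1) => y.
  by rewrite -[z - _]opprB; field.
rewrite -(mul0r (c%:C * (if xi is Some x then (b%:C - x%:C)^-1 else 0) : C)).
apply: cvgCM; first exact: local_par_exp_cvg0.
apply: cvgCM; first exact: cvgC_cst.
exact: nontangential_resolvent.
Qed.

Lemma simple_growthD S G (c b : R) : simple_growth S G ->
  simple_growth S (fun z => G z + c%:C / (b%:C - z)).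
Proof.
move=> hG xi j k xS j2 h; apply: (hG xi j k xS j2).
have h' : local_par xi z ^+ j * (G z + c%:C / (b%:C - z)) -
    local_par xi z ^+ j * (c%:C / (b%:C - z)) @[z --> nontangential xi] --> (k%:C - 0 : C).
  by apply: cvgCB; [exact: h|exact: local_par_simple_pole].
rewrite subr0 in h'; by apply: cvgC_nonreal_eq h' => z _; rewrite mulrDr addrK.
Qed.

(** Used with j the degree of [p], it reads the leading coefficient off the growth at infinity, so
    that simple growth leaves degree at most 1. *)
Lemma peval_infty p j : ((size p).-1 <= j)%N ->
  local_par None z ^+ j * peval p z @[z --> nontangential None] --> ((p`_j)%:C : C).
Proof.
elim/poly_ind: p j => [|p c IH] j.
  move=> _; rewrite coef0; apply: (@cvgC_nonreal_eq _ None (fun=> 0)); last exact: cvgC_cst.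
  by move=> z _; rewrite /peval rmorph0 horner0 mulr0.
have pX v : peval (p * 'X + c%:P) v = peval p v * v + c%:C.
  by rewrite pevalD pevalM pevalC pevalX.
rewrite coefD coefMX coefC.
have [->|p0] := eqVneq p 0.
  move=> _; rewrite coef0 if_same add0r.
  case: j => [|j] /=.
    apply: (@cvgC_nonreal_eq _ None (fun=> c%:C)); last exact: cvgC_cst.
    by move=> z _; rewrite expr0 mul1r mul0r add0r pevalC.
  have -> : ((0 : R)%:C : C) = 0 * c%:C by rewrite mul0r.
  apply: (@cvgC_nonreal_eq _ None (fun z => local_par None z ^+ j.+1 * c%:C)).
    by move=> z _; rewrite mul0r add0r pevalC.
  apply: cvgCM; last exact: cvgC_cst.
  exact: local_par_exp_cvg0.
rewrite size_MXaddC (negbTE p0) /=.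
case: j => [|j] spj /=; first by move: spj; rewrite leqn0 size_poly_eq0 (negbTE p0).
rewrite addr0.
have h : local_par None z ^+ j * peval p z + local_par None z ^+ j.+1 * c%:C
    @[z --> nontangential None] --> ((p`_j)%:C + 0 * c%:C : C).
  apply: cvgCD; first by apply: IH; case: (size p) spj.
  apply: cvgCM; last exact: cvgC_cst.
  exact: local_par_exp_cvg0.
rewrite mul0r addr0 in h; apply: cvgC_nonreal_eq h => z z0.
have zn0 := nonreal_neq0 (z0 : Im z != 0).
by rewrite pX exprS /=; field.
Qed.

(** Induction on the list of roots of the denominator. At a repeated root b the exponent is at least
    2, so p vanishes at b and one factor cancels; a root occurring once is split off with its
    residue. When no root is left, growth at infinity bounds the degree. *)
Lemma partial_fractions (S : pred R) s p : (forall x, x \in s -> S x) ->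
  simple_growth S (fun z => peval p z / peval (D s) z) ->
  exists A B (c : R -> R), forall z, Im z != 0 -> peval p z / peval (D s) z =
    A%:C + B%:C * z + \sum_(x <- undup s) (c x)%:C / (x%:C - z).
Proof.
elim: s p => [|b s IH] p sS hp.
  have sp : (size p <= 2)%N.
    rewrite leqNgt; apply/negP => sp; have j2 : (2 <= (size p).-1)%N by case: (size p) sp.
    have h := @peval_infty p _ (leqnn _).
    have : p`_(size p).-1 = 0.
      apply: (hp None _ _ isT j2); apply: cvgC_nonreal_eq h => z _.
      by rewrite big_nil peval1 divr1.
    by move/eqP; rewrite -lead_coefE lead_coef_eq0 -size_poly_eq0; case: (size p) sp.
  exists p`_0, p`_1, (fun=> 0) => z _; rewrite /= !big_nil peval1 divr1 addr0.
  rewrite {1}(_ : p = (p`_0)%:P + p`_1 *: 'X); first by rewrite pevalD pevalC pevalZ pevalX.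
  apply/polyP => -[|[|i]]; rewrite coefD coefC coefZ coefX /= ?mulr0 ?mulr1 ?addr0 ?add0r//.
  by apply: nth_default; apply: leq_trans sp _.
have sS' x : x \in s -> S x by move=> xs; apply: sS; rewrite inE xs orbT.
have D0 z : Im z != 0 -> peval (D s) z != 0 by exact: peval_prod_nonreal.
have zb z : Im z != 0 -> z - b%:C != 0.
  by move=> z0; rewrite -opprB oppr_eq0 nonreal_sub.
have [bs|bs] := boolP (b \in s).
  pose m := count_mem b s; pose D1 := D [seq x <- s | x != b].
  have m0 : (0 < m)%N by rewrite -has_count has_pred1.
  have D1b : peval D1 b%:C != 0.
    apply: peval_prod_neq0 => x; rewrite mem_filter => /andP[xb _].
    by apply: contraNneq xb => /complexI ->.
  have pb : p.[b] = 0.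
    have : p.[b] / D1.[b] = 0.
      apply: (hp (Some b) m.+1 _); first by apply: sS; rewrite mem_head.
        by rewrite ltnS.
      have h : peval p z / peval D1 z @[z --> nontangential (Some b)] -->
          ((p.[b] / D1.[b])%:C : C).
        rewrite rmorphM/= fmorphV/= -!peval_real.
        apply: cvgCM; first by apply: cvgC_peval; exact: nontangential_id.
        apply: cvgCV; first exact: D1b.
        by apply: cvgC_peval; exact: nontangential_id.
      apply: cvgC_nonreal_eq h => z z0.
      rewrite big_cons pevalM (prod_XsubC_split b s) pevalM -/m -/D1.
      have -> : peval (('X - b%:P) ^+ m) z = (z - b%:C) ^+ m.
        by rewrite /peval rmorphXn horner_exp -/(peval _ _) pevalXsubC.
      rewrite pevalXsubC /=; have D1z := peval_prod_nonreal [seq x <- s | x != b] z0.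
      have zbm : (z - b%:C) ^+ m != 0 by rewrite expf_neq0// zb.
      by rewrite exprS; field; rewrite zbm D1z zb.
    move: D1b; rewrite peval_real fmorph_eq0 => D1b /eqP.
    by rewrite mulf_eq0 invr_eq0 (negbTE D1b) orbF => /eqP.
  have /factor_theorem[q pq] : root p b by apply/eqP.
  have pq' z : Im z != 0 -> peval p z / peval (D (b :: s)) z = peval q z / peval (D s) z.
    move=> z0; rewrite pq big_cons !pevalM pevalXsubC; field.
    by rewrite D0// zb.
  have [A [B [c h]]] := IH q sS' (simple_growth_eq pq' hp).
  by exists A, B, c => z z0; rewrite pq'// h//= bs.
have Dsb : (D s).[b] != 0.
  have : peval (D s) b%:C != 0.
    by apply: peval_prod_neq0 => x xs; apply: contraNneq bs => /complexI ->.
  by rewrite peval_real fmorph_eq0.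
pose c0 := p.[b] / (D s).[b].
have /factor_theorem[q pq] : root (p - c0 *: D s) b.
  by rewrite /root !hornerE /c0 divfK ?subrr.
have pq' z : Im z != 0 -> peval p z / peval (D (b :: s)) z + c0%:C / (b%:C - z) =
    peval q z / peval (D s) z.
  move=> z0; have := congr1 (peval ^~ z) pq; rewrite pevalB pevalZ pevalM pevalXsubC.
  have zbz := zb z z0; have Dz := D0 z z0.
  have -> : b%:C - z = - (z - b%:C) by rewrite opprB.
  rewrite big_cons pevalM pevalXsubC; move: (peval (D s) z) Dz => d d0.
  move=> /(canRL (subrK _)) ->; field.
  by rewrite d0 zbz.
have [A [B [c h]]] := IH q sS' (simple_growth_eq pq' (simple_growthD (c := c0) (b := b) hp)).
(* The minus sign appears because the fractions are written over x - z. *)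
exists A, B, (fun x => if x == b then - c0 else c x) => z z0.
rewrite /= (negbTE bs) [in RHS]big_cons eqxx.
have -> : \sum_(x <- undup s) (if x == b then - c0 else c x)%:C / (x%:C - z) =
    \sum_(x <- undup s) (c x)%:C / (x%:C - z).
  apply: eq_big_seq => x; rewrite mem_undup => xs; case: eqP => // xb.
  by rewrite xb (negbTE bs) in xs.
rewrite addrCA -h// -pq'// rmorphN/= mulNr [RHS]addrC addrK//.
Qed.

End PartialFractions.

(** * A minimum principle in the upper half-plane *)

Section MinimumPrinciple.
Context {R : realType}.
Local Notation C := (R[i]^o).
Implicit Types (F G : C -> C) (z w : C).

(* Second order Taylor expansions, uniform on the sets {Im z >= y0, |z| <= B}. *)
Definition jet2 F := forall y0 B : R, 0 < y0 -> exists2 M : R, 0 <= M &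
  exists (a b : C -> C) (e : C -> C -> C), forall z w,
    y0 <= Im z -> cn z <= B -> cn w <= y0 / 2 ->
    F (z + w) = F z + w * a z + w ^+ 2 * b z + w ^+ 3 * e z w /\
    [/\ cn (F z) <= M, cn (a z) <= M, cn (b z) <= M & cn (e z w) <= M].

Lemma jet2_cst (c : C) : jet2 (fun=> c).
Proof.
move=> y0 B y00; exists (cn c); first exact: cn_ge0.
exists (fun=> 0), (fun=> 0), (fun _ _ => 0) => z w _ _ _.
by rewrite !mulr0 !addr0 cn0; split => //; split => //; exact: cn_ge0.
Qed.

Lemma jet2_id : jet2 id.
Proof.
move=> y0 B y00; exists (`|B| + 1); first by rewrite addr_ge0.
exists (fun=> 1), (fun=> 0), (fun _ _ => 0) => z w _ zB _.
rewrite !mulr0 !addr0 mulr1 cn0 cn1; split => //; split; rewrite ?addr_ge0//.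
  by apply: le_trans zB _; apply: le_trans (ler_norm _) _; rewrite lerDl.
by rewrite lerDr.
Qed.

Lemma jet2D F G : jet2 F -> jet2 G -> jet2 (fun z => F z + G z).
Proof.
move=> hF hG y0 B y00; have [M M0 [a [b [e he]]]] := hF y0 B y00.
have [M' M'0 [a' [b' [e' he']]]] := hG y0 B y00.
exists (M + M'); first exact: addr_ge0.
exists (fun z => a z + a' z), (fun z => b z + b' z), (fun z w => e z w + e' z w).
move=> z w zy zB wy; have [-> [F1 a1 b1 e1]] := he z w zy zB wy.
have [-> [F2 a2 b2 e2]] := he' z w zy zB wy; split; first by ring.
by split; apply: le_trans (cnD _ _) _; exact: lerD.
Qed.

Lemma jet2M F G : jet2 F -> jet2 G -> jet2 (fun z => F z * G z).
Proof.
move=> hF hG y0 B y00; have [M M0 [a [b [e he]]]] := hF y0 B y00.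
have [M' M'0 [a' [b' [e' he']]]] := hG y0 B y00.
pose T := y0 / 2; have T0 : 0 <= T by rewrite divr_ge0// ltW.
have T2 : 0 <= T ^+ 2 by exact: exprn_ge0.
have T3 : 0 <= T ^+ 3 by exact: exprn_ge0.
pose MM := M * M'; have MM0 : 0 <= MM by exact: mulr_ge0.
(* The remainder of the product collects 4, 3, 2 and 1 products of coefficients at the orders w^3 to
   w^6, each of modulus at most [MM], while |w| <= T. *)
exists (MM * (4 + 3 * T + 2 * T ^+ 2 + T ^+ 3)).
  by rewrite mulr_ge0//; lra.
exists (fun z => F z * a' z + a z * G z),
  (fun z => F z * b' z + a z * a' z + b z * G z),
  (fun z w => (F z * e' z w + a z * b' z + b z * a' z + e z w * G z) +
    w * (a z * e' z w + b z * b' z + e z w * a' z) +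
    w ^+ 2 * (b z * e' z w + e z w * b' z) + w ^+ 3 * (e z w * e' z w)).
move=> z w zy zB wy; have [-> [F1 a1 b1 e1]] := he z w zy zB wy.
have [-> [F2 a2 b2 e2]] := he' z w zy zB wy; split; first by ring.
have le2 (u v : C) : cn u <= M -> cn v <= M' -> cn (u * v) <= MM.
  by move=> hu hv; rewrite cnM; apply: ler_pM; rewrite ?cn_ge0.
have leD (u v : C) c d : cn u <= c -> cn v <= d -> cn (u + v) <= c + d.
  by move=> hu hv; apply: le_trans (cnD _ _) _; exact: lerD.
have leX n (u : C) c : cn u <= c -> cn (w ^+ n * u) <= T ^+ n * c.
  move=> hu; rewrite cnM cnX; apply: ler_pM; rewrite ?exprn_ge0 ?cn_ge0//.
  by apply: lerXn2r; rewrite ?nnegrE ?cn_ge0.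
have TM : 0 <= MM * T by exact: mulr_ge0.
have TM2 : 0 <= MM * T ^+ 2 by exact: mulr_ge0.
have TM3 : 0 <= MM * T ^+ 3 by exact: mulr_ge0.
split.
- apply: le_trans (le2 _ _ F1 F2) _; lra.
- apply: le_trans (leD _ _ _ _ (le2 _ _ F1 a2) (le2 _ _ a1 F2)) _; lra.
- apply: le_trans (leD _ _ _ _ (leD _ _ _ _ (le2 _ _ F1 b2) (le2 _ _ a1 a2)) (le2 _ _ b1 F2)) _; lra.
have h0 := leD _ _ _ _ (leD _ _ _ _ (leD _ _ _ _ (le2 _ _ F1 e2) (le2 _ _ a1 b2))
  (le2 _ _ b1 a2)) (le2 _ _ e1 F2).
have h1 := leX 1%N _ _ (leD _ _ _ _ (leD _ _ _ _ (le2 _ _ a1 e2) (le2 _ _ b1 b2)) (le2 _ _ e1 a2)).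
have h2 := leX 2%N _ _ (leD _ _ _ _ (le2 _ _ b1 e2) (le2 _ _ e1 b2)).
have h3 := leX 3%N _ _ (le2 _ _ e1 e2); rewrite !expr1 in h1.
apply: le_trans (leD _ _ _ _ (leD _ _ _ _ (leD _ _ _ _ h0 h1) h2) h3) _.
by rewrite le_eqVlt; apply/orP; left; apply/eqP; ring.
Qed.

Lemma jet2_eq F G : (forall z, 0 < Im z -> F z = G z) -> jet2 F -> jet2 G.
Proof.
move=> FG hF y0 B y00; have [M M0 [a [b [e he]]]] := hF y0 B y00.
exists M => //; exists a, b, e => z w zy zB wy.
have z0 : 0 < Im z by exact: lt_le_trans zy.
have zw0 : 0 < Im (z + w).
  rewrite cImD; have := le_trans (Im_le_cn w) wy; rewrite ler_norml; lra.
by have := he z w zy zB wy; rewrite !FG.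
Qed.

Lemma resolvent_expand (t : R) z w : Im z != 0 -> Im (z + w) != 0 ->
  (t%:C - (z + w))^-1 = (t%:C - z)^-1 + w * (t%:C - z)^-1 ^+ 2 +
    w ^+ 2 * (t%:C - z)^-1 ^+ 3 +
    w ^+ 3 * ((t%:C - z)^-1 ^+ 3 * (t%:C - (z + w))^-1).
Proof.
move=> z0 zw0; have h1 := nonreal_sub t z0; have h2 := nonreal_sub t zw0.
by field; rewrite h1 h2.
Qed.

Lemma jet2_resolvent (t : R) : jet2 (fun z => (t%:C - z)^-1).
Proof.
move=> y0 B y00; pose c := 2 / y0.
have c0 : 0 < c by rewrite divr_gt0.
exists (c + c ^+ 2 + c ^+ 3 + c ^+ 4).
  by rewrite !addr_ge0// ?exprn_ge0// ltW.
exists (fun z => (t%:C - z)^-1 ^+ 2), (fun z => (t%:C - z)^-1 ^+ 3),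
  (fun z w => (t%:C - z)^-1 ^+ 3 * (t%:C - (z + w))^-1) => z w zy zB wy.
have z0 : Im z != 0 by rewrite gt_eqF// (lt_le_trans y00).
have zwy : y0 / 2 <= Im (z + w).
  rewrite cImD; have := le_trans (Im_le_cn w) wy; rewrite ler_norml; lra.
have zw0 : Im (z + w) != 0 by rewrite gt_eqF// (lt_le_trans _ zwy)// divr_gt0.
split; first exact: resolvent_expand.
have bnd (v : C) : y0 / 2 <= Im v -> cn (t%:C - v)^-1 <= c.
  move=> vy; rewrite cnV /c -[2 / y0]invf_div lef_pV2 ?posrE; last first.
  - by rewrite divr_gt0.
  - by rewrite cn_gt0 nonreal_sub// gt_eqF// (lt_le_trans _ vy)// divr_gt0.
  by apply: le_trans vy _; apply: le_trans (ler_norm _) _; exact: Im_le_cn_sub.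
have bz : cn (t%:C - z)^-1 <= c.
  by apply: bnd; apply: le_trans zy; rewrite ler_pdivrMr// ler_pMr//; lra.
have bzX n : cn ((t%:C - z)^-1 ^+ n) <= c ^+ n.
  by rewrite cnX; apply: lerXn2r; rewrite ?nnegrE ?cn_ge0// ltW.
have [c2 c3 c4] : [/\ 0 < c ^+ 2, 0 < c ^+ 3 & 0 < c ^+ 4] by split; exact: exprn_gt0.
have := bzX 2%N; have := bzX 3%N.
have : cn ((t%:C - z)^-1 ^+ 3 * (t%:C - (z + w))^-1) <= c ^+ 4.
  by rewrite cnM [leRHS]exprSr; apply: ler_pM; rewrite ?cn_ge0// bnd.
by split; lra.
Qed.

(** The geometric expansion of the resolvent is integrated term by term: all coefficients after the
    zeroth contain at least two resolvent factors at z, and |t - z|^-2 is at most E times [rho t]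
    uniformly on the set. *)
Lemma jet2_kint (mu : {measure set R -> \bar R}) (g : R -> R) : kdensity mu g ->
  jet2 (kint mu g).
Proof.
move=> kg y0 B y00; pose c := 2 / y0; have c0 : 0 < c by rewrite divr_gt0.
have [mg ig] := kg.
pose A := `|B| + c * (1 + `|B| ^+ 2); pose E := 2 + (1 + 2 * `|B| ^+ 2) * c ^+ 2.
have B0 : 0 <= `|B| by []. 
have A0 : 0 <= A by rewrite addr_ge0// mulr_ge0 ?addr_ge0 ?sqr_ge0// ltW.
have c2 : 0 <= c ^+ 2 by exact: sqr_ge0.
have B2 : 0 <= `|B| ^+ 2 by exact: sqr_ge0.
have E0 : 0 <= E by rewrite addr_ge0// mulr_ge0//; lra.
have Ec : 0 <= E * c by rewrite mulr_ge0// ltW.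
have Ec2 : 0 <= E * c ^+ 2 by rewrite mulr_ge0.
pose J := \int[mu]_t (`|g t| * rho t).
have J0 : 0 <= J by apply: Rintegral_ge0 => t _; rewrite mulr_ge0// ltW// rho_gt0.
pose M := 2 * ((A + E + E * c + E * c ^+ 2) * J).
exists M; first by rewrite mulr_ge0// mulr_ge0//; lra.
pose u n t z : C := (g t)%:C * (t%:C - z)^-1 ^+ n.
exists (fun z => cintegral mu (u 2%N ^~ z)), (fun z => cintegral mu (u 3%N ^~ z)),
  (fun z w => cintegral mu (fun t => u 3%N t z * (t%:C - (z + w))^-1)).
move=> z w zy zB wy.
have z0 : Im z != 0 by rewrite gt_eqF// (lt_le_trans y00).
have zwy : y0 / 2 <= Im (z + w).
  rewrite cImD; have := le_trans (Im_le_cn w) wy; rewrite ler_norml; lra.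
have zw0 : Im (z + w) != 0 by rewrite gt_eqF// (lt_le_trans _ zwy)// divr_gt0.
have bnd t (v : C) : y0 / 2 <= Im v -> cn (t%:C - v)^-1 <= c.
  move=> vy; rewrite cnV /c -[2 / y0]invf_div lef_pV2 ?posrE; last first.
  - by rewrite divr_gt0.
  - by rewrite cn_gt0 nonreal_sub// gt_eqF// (lt_le_trans _ vy)// divr_gt0.
  by apply: le_trans vy _; apply: le_trans (ler_norm _) _; exact: Im_le_cn_sub.
have zB' : cn z <= `|B| by exact: le_trans (ler_norm _).
have zy2 : y0 / 2 <= Im z by apply: le_trans zy; rewrite ler_pdivrMr// ler_pMr//; lra.
have bE t : cn (t%:C - z)^-1 ^+ 2 <= E * rho t.
  rewrite /rho ler_pdivlMr ?ltr_wpDr ?sqr_ge0//.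
  have tz : `|t| <= cn (t%:C - z) + cn z.
    by rewrite -cn_real -{1}(subrK z t%:C) cnD.
  have h1 : t ^+ 2 <= 2 * cn (t%:C - z) ^+ 2 + 2 * `|B| ^+ 2.
    rewrite -real_normK ?num_real//.
    apply: le_trans (_ : (cn (t%:C - z) + cn z) ^+ 2 <= _).
      by apply: lerXn2r; rewrite ?nnegrE ?addr_ge0 ?cn_ge0.
    have h3 : cn z ^+ 2 <= `|B| ^+ 2 by apply: lerXn2r; rewrite ?nnegrE ?cn_ge0.
    have := sqr_ge0 (cn (t%:C - z) - cn z); lra.
  have tz0 : 0 < cn (t%:C - z) by rewrite cn_gt0 nonreal_sub.
  have h4 : cn (t%:C - z)^-1 ^+ 2 * cn (t%:C - z) ^+ 2 = 1.
    by rewrite cnV exprVn mulVf// gt_eqF// exprn_gt0.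
  have h5 : cn (t%:C - z)^-1 ^+ 2 <= c ^+ 2.
    by apply: lerXn2r; rewrite ?nnegrE ?cn_ge0 ?bnd// ltW.
  apply: le_trans (_ : cn (t%:C - z)^-1 ^+ 2 * (1 + (2 * cn (t%:C - z) ^+ 2 + 2 * `|B| ^+ 2)) <= _).
    by rewrite ler_wpM2l ?sqr_ge0// lerD2l.
  rewrite addrCA mulrDr mulrCA h4 mulr1 /E lerD2l mulrC.
  by apply: ler_wpM2l => //; lra.
have mu2 n : cmeasurable (u n ^~ z).
  apply: cmeasurableM; first exact: cmeasurable_real.
  elim: n => [|n IH]; first by under eq_fun do rewrite expr0; exact: cmeasurable_cst.
  by under eq_fun do rewrite exprS; apply: cmeasurableM => //; exact: cmeasurable_resolvent.
have igE x := rintegrableZ x ig.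
have b2 t : cn (u 2%N t z) <= E * (`|g t| * rho t).
  by rewrite cnM cn_real cnX [leRHS]mulrCA ler_wpM2l.
have b3 t : cn (u 3%N t z) <= E * c * (`|g t| * rho t).
  rewrite /u exprSr [X in cn X]mulrA cnM [leRHS]mulrAC.
  by apply: ler_pM; rewrite ?cn_ge0// ?bnd//; exact: b2.
have b4 t : cn (u 3%N t z * (t%:C - (z + w))^-1) <= E * c ^+ 2 * (`|g t| * rho t).
  rewrite cnM [c ^+ 2]expr2 [E * _]mulrA [leRHS]mulrAC.
  by apply: ler_pM; rewrite ?cn_ge0// ?bnd//; exact: b3.
have m4 : cmeasurable (fun t => u 3%N t z * (t%:C - (z + w))^-1 : C).
  by apply: cmeasurableM => //; exact: cmeasurable_resolvent.
have i1 := cintegrable_kint z0 kg.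
have i2 := cintegrable_le (mu2 2%N) (igE _) b2.
have i3 := cintegrable_le (mu2 3%N) (igE _) b3.
have i4 := cintegrable_le m4 (igE _) b4.
split.
  have z2 := cintegrableZ w i2; have z3 := cintegrableZ (w ^+ 2) i3.
  have z4 := cintegrableZ (w ^+ 3) i4.
  have s1 := cintegrableD i1 z2; have s2 := cintegrableD s1 z3.
  rewrite /kint -!cintegralZ// -!cintegralD//.
  congr cintegral; apply/funext => t; rewrite /kernel [in LHS](resolvent_expand t z0 zw0) /u.
  by ring.
have leM (f : R -> C) x : cmeasurable f -> (forall t, cn (f t) <= x * (`|g t| * rho t)) ->
    x <= A + E + E * c + E * c ^+ 2 -> cn (cintegral mu f) <= M.
  move=> mf fx xM; apply: le_trans (cn_cintegral_le mf (igE x) fx) _.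
  by rewrite RintegralZl// ler_pM2l// ler_wpM2r.
split.
- apply: (leM _ A) => //; last by lra.
    exact: cmeasurable_kint.
  move=> t; rewrite cnM cn_real [leRHS]mulrCA ler_wpM2l//.
  apply: le_trans (cn_kernel_le t z0) _; rewrite mulrC ler_wpM2r ?(ltW (rho_gt0 t))//.
  rewrite /A; apply: lerD => //; rewrite -cnV mulrC; apply: ler_pM; rewrite ?cn_ge0 ?bnd//.
  apply: le_trans (cnD _ _) _; rewrite cn1 cnX lerD2l.
  by apply: lerXn2r; rewrite ?nnegrE ?cn_ge0.
- by apply: (leM _ E) => //; lra.
- by apply: (leM _ (E * c)) => //; lra.
- by apply: (leM _ (E * c ^+ 2)) => //; lra.
Qed.

Lemma jet2_peval (p : {poly R}) : jet2 (peval p).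
Proof.
elim/poly_ind: p => [|p c IH].
  by apply: jet2_eq (jet2_cst 0) => z _; rewrite /peval rmorph0 horner0.
apply: (@jet2_eq (fun z => peval p z * z + c%:C)).
  by move=> z _; rewrite pevalD pevalM pevalC pevalX.
by apply: jet2D; [apply: jet2M => //; exact: jet2_id|exact: jet2_cst].
Qed.

Lemma jet2_inv_prod (s : seq R) :
  jet2 (fun z => (peval (\prod_(x <- s) ('X - x%:P)) z)^-1).
Proof.
elim: s => [|x s IH].
  by apply: jet2_eq (jet2_cst 1) => z _; rewrite big_nil peval1 invr1.
apply: (@jet2_eq (fun z => -1 * (x%:C - z)^-1 * (peval (\prod_(x <- s) ('X - x%:P)) z)^-1)).
  by move=> z _; rewrite big_cons pevalM pevalXsubC invfM mulN1r -invrN opprB.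
by apply: jet2M => //; apply: jet2M; [exact: jet2_cst|exact: jet2_resolvent].
Qed.

(* Im G is harmonic, so Im G - d |z|^2 has Laplacian - 4 d < 0 and no interior minimum. *)
Lemma half_plane_minimum G : jet2 G ->
  (forall e : R, 0 < e -> exists (y0 B : R), [/\ 0 < y0, 0 < B & forall z, 0 < Im z ->
     Im z < y0 \/ B < cn z -> - e <= Im (G z)]) ->
  forall z, 0 < Im z -> 0 <= Im (G z).
Proof.
move=> jG bG z1 z10; rewrite leNgt; apply/negP => Gz1.
(* A third of the depth at [z1]: outside [K] the function [v] stays above - 2 e, while its infimum
   on [K] is at most - 3 e. *)
pose e := - Im (G z1) / 3; have e0 : 0 < e by rewrite divr_gt0// oppr_gt0.
have eE : Im (G z1) = - 3 * e by rewrite /e; field.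
have [y0 [B [y00 B0 bd]]] := bG e e0.
have [M M0 [a [b [r hr]]]] := jG y0 B y00.
pose K : set C := [set z | y0 <= Im z /\ cn z <= B].
(* Makes the correction d |z|^2 at most [e] on the disc of radius B + 1, which contains every
   neighbour z + w tested below. *)
pose d := e / (B + 1) ^+ 2.
have B1 : 0 < (B + 1) ^+ 2 by rewrite exprn_gt0// addr_gt0.
have d0 : 0 < d by rewrite divr_gt0.
pose v z := Im (G z) - d * cn z ^+ 2.
have vout z : 0 < Im z -> cn z <= B + 1 -> ~ K z -> - 2 * e <= v z.
  move=> z0 zB nK; have : - e <= Im (G z).
    apply: bd => //; have [|zy] := ltP (Im z) y0; first by left.
    by right; rewrite ltNge; apply/negP => zB'; apply: nK.
  have : d * cn z ^+ 2 <= e.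
    rewrite -[leRHS](divfK (lt0r_neq0 B1)) ler_pM2l//.
    by apply: lerXn2r; rewrite ?nnegrE ?cn_ge0// addr_ge0// ltW.
  by rewrite /v; lra.
have vz1 : v z1 <= - 3 * e by rewrite /v eE gerBl mulr_ge0 ?sqr_ge0// ltW.
have Kz1 : K z1.
  apply: contrapT => nK; have : - e <= Im (G z1).
    apply: bd => //; have [|zy] := ltP (Im z1) y0; first by left.
    by right; rewrite ltNge; apply/negP => zB'; apply: nK.
  by rewrite eE; lra.
have T0 : 0 <= y0 / 2 by rewrite divr_ge0// ltW.
pose V := v @` K.
have V0 : V (v z1) by exists z1.
have lV : has_lbound V.
  exists (- M - d * B ^+ 2) => _ [z [zy zB] <-].
  have T0' : cn (0 : C) <= y0 / 2 by rewrite cn0.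
  have [_ [GM _ _ _]] := hr z 0 zy zB T0'.
  have := le_trans (Im_le_cn _) GM; rewrite ler_norml => /andP[h _].
  by rewrite /v lerB// ler_pM2l//; apply: lerXn2r; rewrite ?nnegrE ?cn_ge0 ?(ltW B0).
(* The infimum replaces an attained minimum: [step] bounds every value on [K] below by [m] plus one
   fixed positive amount. *)
pose m := inf V.
have mK z : K z -> m <= v z by move=> Kz; apply: ge_inf => //; exists z.
have m3 : m <= - 3 * e by apply: le_trans vz1; exact: mK.
(* The three bounds keep neighbours in the disc of radius B + 1, keep them in the range of the jets,
   and let d h^2 dominate the cubic remainders. *)
pose h := Num.min 1 (Num.min (y0 / 2) (d / (2 * M + 1))).
have M1 : 0 < 2 * M + 1 by rewrite ltr_wpDl// mulr_ge0.
have h0 : 0 < h.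
  by rewrite !lt_min ltr01 /= (divr_gt0 y00)// (divr_gt0 d0).
have [h1 hy hd] : [/\ h <= 1, h <= y0 / 2 & h <= d / (2 * M + 1)].
  by split; rewrite /h !ge_min lexx ?orbT.
have step z : K z -> m + d * h ^+ 2 / 2 <= v z.
  move=> Kz; have [zy zB] := Kz.
  have near w : cn w = h -> m <= v (z + w).
    move=> wh; have [//|nK] := pselect (K (z + w)); first exact: mK.
    apply: le_trans m3 _; apply: le_trans (vout _ _ _ nK); first by lra.
      rewrite cImD; have := Im_le_cn w; rewrite wh ler_norml; lra.
    by apply: le_trans (cnD _ _) _; rewrite wh; lra.
  pose ii : C := 0 +i* h.
  have cr : cn (h%:C : C) = h by rewrite cn_real gtr0_norm.
  have ci : cn ii = h by rewrite cnE/= expr0n/= add0r sqrtr_sqr gtr0_norm.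
  have [n1 n2] := (near h%:C cr, near (- h%:C) (etrans (cnN _) cr)).
  have [n3 n4] := (near ii ci, near (- ii) (etrans (cnN _) ci)).
  have w1 : cn (h%:C : C) <= y0 / 2 by rewrite cr.
  have w2 : cn (- h%:C : C) <= y0 / 2 by rewrite cnN cr.
  have w3 : cn ii <= y0 / 2 by rewrite ci.
  have w4 : cn (- ii) <= y0 / 2 by rewrite cnN ci.
  have [E1 [_ _ _ e1]] := hr z _ zy zB w1; have [E2 [_ _ _ e2]] := hr z _ zy zB w2.
  have [E3 [_ _ _ e3]] := hr z _ zy zB w3; have [E4 [_ _ _ e4]] := hr z _ zy zB w4.
  have i2 : ii ^+ 2 = - (h%:C ^+ 2).
    by apply: complex_ext; rewrite /ii !expr2 ?cReN ?cImN ?cReM ?cImM/=; ring.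
  (* Discrete mean value property on the four points z + h, z - h, z + i h, z - i h: the first and
     second order terms cancel since (i h)^2 = - h^2, whereas the squares |.|^2 gain 4 h^2 in
     total. *)
  have sumG : G (z + h%:C) + G (z - h%:C) + G (z + ii) + G (z - ii) = 4 * G z +
    (h%:C ^+ 3 * r z h%:C - h%:C ^+ 3 * r z (- h%:C) + ii ^+ 3 * r z ii - ii ^+ 3 * r z (- ii)).
    rewrite E1 E2 E3 E4 !sqrrN i2; ring.
  have rest : cn (h%:C ^+ 3 * r z h%:C - h%:C ^+ 3 * r z (- h%:C) + ii ^+ 3 * r z ii -
      ii ^+ 3 * r z (- ii)) <= 4 * (h ^+ 3 * M).
    have t (x y : C) : cn x = h -> cn y <= M -> cn (x ^+ 3 * y) <= h ^+ 3 * M.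
      by move=> xh yM; rewrite cnM cnX xh ler_wpM2l// exprn_ge0// ltW.
    have tt (x y : C) p q : cn x <= p -> cn y <= q -> cn (x - y) <= p + q.
      by move=> hx hy'; apply: le_trans (cnD _ _) _; rewrite cnN; exact: lerD.
    have tp (x y : C) p q : cn x <= p -> cn y <= q -> cn (x + y) <= p + q.
      by move=> hx hy'; apply: le_trans (cnD _ _) _; exact: lerD.
    apply: le_trans (tt _ _ _ _ (tp _ _ _ _ (tt _ _ _ _ (t _ _ cr e1) (t _ _ cr e2))
      (t _ _ ci e3)) (t _ _ ci e4)) _; lra.
  have ImS := congr1 (@complex.Im R) sumG; rewrite 3!cImD [in RHS]cImD in ImS.
  have I4 : Im (4 * G z) = 4 * Im (G z).
    rewrite (_ : 4 * G z = G z + G z + G z + G z); last by ring.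
    by rewrite !cImD; ring.
  rewrite I4 in ImS; have Irest := le_trans (le_trans (ler_norm _) (Im_le_cn _)) rest.
  have sumN : cn (z + h%:C) ^+ 2 + cn (z - h%:C) ^+ 2 + cn (z + ii) ^+ 2 + cn (z - ii) ^+ 2
     = 4 * cn z ^+ 2 + 4 * h ^+ 2.
    by rewrite !sqr_cn !cReD !cImD !cReN !cImN/=; ring.
  have h3 : 2 * h ^+ 3 * M <= d * h ^+ 2.
    have hM : h * (2 * M + 1) <= d by rewrite -ler_pdivlMr.
    have h20 : 0 <= h ^+ 2 by exact: sqr_ge0.
    have := ler_wpM2r h20 hM.
    have h30 : 0 <= h * h ^+ 2 by rewrite mulr_ge0// ltW.
    by rewrite [h ^+ 3]exprS; lra.
  have sumd := congr1 (fun x => d * x) sumN; rewrite /= in sumd.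
  by move: n1 n2 n3 n4; rewrite /v; lra.
have : m + d * h ^+ 2 / 2 <= m.
  by apply: lb_le_inf => [|_ [z Kz <-]]; [exists (v z1)|exact: step].
by rewrite gerDl leNgt divr_gt0// mulr_gt0// exprn_gt0.
Qed.

End MinimumPrinciple.

(** * Functions with real boundary behaviour *)

Section TameFunctions.
Context {R : realType}.
Local Notation C := (R[i]^o).
Implicit Types (W : set C) (f g : C -> C).

(** Models functions that extend with real values across the part of the real line touched by [W].
    Boundedness is included so that products keep Im f = O(Im z). *)
Definition tame W f := exists2 c : R, 0 <= c &
  forall z, W z -> cn (f z) <= c /\ `|Im (f z)| <= c * `|Im z|.

Lemma tame_cst W (c : R) : tame W (fun=> c%:C).
Proof.
by exists `|c| => // z _; rewrite cn_real normr0; split; rewrite ?mulr_ge0.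
Qed.

Lemma tameD W f g : tame W f -> tame W g -> tame W (fun z => f z + g z).
Proof.
move=> [c c0 hf] [d d0 hg]; exists (c + d) => [|z Wz]; first exact: addr_ge0.
have [[f1 f2] [g1 g2]] := (hf z Wz, hg z Wz); split.
  by apply: le_trans (cnD _ _) _; exact: lerD.
by rewrite cImD mulrDl; apply: le_trans (ler_normD _ _) _; exact: lerD.
Qed.

Lemma tameM W f g : tame W f -> tame W g -> tame W (fun z => f z * g z).
Proof.
move=> [c c0 hf] [d d0 hg]; exists (2 * (c * d)) => [|z Wz].
  by rewrite !mulr_ge0.
have [[f1 f2] [g1 g2]] := (hf z Wz, hg z Wz); split.
  rewrite cnM; apply: le_trans (_ : c * d <= _).
    by apply: ler_pM; rewrite ?cn_ge0.
  by rewrite ler_peMl ?mulr_ge0// ler1n.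
rewrite cImM; apply: le_trans (ler_normD _ _) _; rewrite !normrM.
rewrite [leRHS](_ : _ = c * (d * `|Im z|) + c * `|Im z| * d); last by ring.
by apply: lerD; apply: ler_pM => //; exact: le_trans (Re_le_cn _) _.
Qed.

Lemma tame_eq W f g : (forall z, W z -> f z = g z) -> tame W f -> tame W g.
Proof. by move=> fg [c c0 hf]; exists c => // z Wz; rewrite -fg//; exact: hf. Qed.

Lemma tame_peval W (B : R) (p : {poly R}) : (forall z, W z -> cn z <= B) ->
  tame W (peval p).
Proof.
move=> WB; have [L L0 hL] := peval_Im p B.
by exists L => [|z /WB/hL//]; exact: ltW.
Qed.

Lemma tame_inv_prod W (d : R) (s : seq R) : 0 < d ->
  (forall z x, W z -> x \in s -> d <= cn (z - x%:C)) ->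
  tame W (fun z => (peval (\prod_(x <- s) ('X - x%:P)) z)^-1).
Proof.
move=> d0; elim: s => [|x s IH] Wd.
  by apply: (tame_eq _ (tame_cst W 1)) => z _; rewrite big_nil peval1 invr1.
have Ws : tame W (fun z => (peval (\prod_(x <- s) ('X - x%:P)) z)^-1).
  by apply: IH => z y Wz ys; apply: Wd => //; rewrite inE ys orbT.
have Wx : tame W (fun z => (z - x%:C)^-1).
  exists (d^-1 + (d ^+ 2)^-1); first by rewrite addr_ge0// invr_ge0 ?sqr_ge0// ltW.
  move=> z Wz; have dz : d <= cn (z - x%:C) by apply: Wd; rewrite ?mem_head.
  have z0 : 0 < cn (z - x%:C) by exact: lt_le_trans dz.
  have d2 : 0 < d ^+ 2 by exact: exprn_gt0.
  split.
    rewrite cnV; apply: le_trans (_ : d^-1 <= _); first by rewrite lef_pV2.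
    by rewrite lerDl invr_ge0 ltW.
  rewrite cImV normrM normrN cImD cImN/= subr0 mulrC.
  apply: ler_wpM2r => //; rewrite gtr0_norm ?invr_gt0 ?exprn_gt0//.
  apply: le_trans (_ : (d ^+ 2)^-1 <= _).
    by rewrite lef_pV2 ?posrE ?exprn_gt0// lerXn2r// nnegrE ltW.
  by rewrite lerDr invr_ge0 ltW.
apply: (tame_eq _ (tameM Wx Ws)) => z _.
by rewrite big_cons pevalM pevalXsubC invfM.
Qed.

Lemma inv_cn_le_rho (t d B : R) (z : C) : 0 < d -> d <= cn (t%:C - z) -> cn z <= B ->
  (cn (t%:C - z) ^+ 2)^-1 <= (2 + (1 + 2 * B ^+ 2) / d ^+ 2) * rho t.
Proof.
move=> d0 dt zB; have t0 : 0 < cn (t%:C - z) by exact: lt_le_trans dt.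
have tz : `|t| <= cn (t%:C - z) + cn z.
  by rewrite -cn_real -{1}(subrK z t%:C) cnD.
rewrite /rho ler_pdivlMr ?ltr_wpDr ?sqr_ge0// mulrC ler_pdivrMr ?exprn_gt0//.
have h1 : t ^+ 2 <= 2 * cn (t%:C - z) ^+ 2 + 2 * B ^+ 2.
  rewrite -real_normK ?num_real//.
  apply: le_trans (_ : (cn (t%:C - z) + cn z) ^+ 2 <= _).
    by apply: lerXn2r; rewrite ?nnegrE ?addr_ge0 ?cn_ge0.
  have h3 : cn z ^+ 2 <= B ^+ 2.
    by apply: lerXn2r; rewrite ?nnegrE ?cn_ge0// (le_trans (cn_ge0 z)).
  by have := sqr_ge0 (cn (t%:C - z) - cn z); lra.
have h2 : 1 <= cn (t%:C - z) ^+ 2 / d ^+ 2.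
  rewrite ler_pdivlMr ?exprn_gt0// mul1r; apply: lerXn2r => //; rewrite nnegrE ltW//.
have h3 : 0 <= 1 + 2 * B ^+ 2 by have := sqr_ge0 B; lra.
have := ler_wpM2l h3 h2; rewrite mulr1.
by rewrite mulrDl mulrAC -mulrA [_ / d ^+ 2]mulrC => h4; lra.
Qed.

(** The support of [g] keeps the distance [d] from [W], so the kernel is not singular there and both
    bounds follow by comparison with [rho]. *)
Lemma tame_kint (mu : {measure set R -> \bar R}) (g : R -> R) W (d B : R) :
  kdensity mu g -> 0 < d -> (forall z, W z -> [/\ Im z != 0, cn z <= B &
    forall t, g t != 0 -> d <= cn (t%:C - z)]) ->
  tame W (kint mu g).
Proof.
move=> kg d0 hW; have [mg ig] := kg.
pose J := \int[mu]_t (`|g t| * rho t).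
have J0 : 0 <= J by apply: Rintegral_ge0 => t _; rewrite mulr_ge0// ltW// rho_gt0.
pose A := `|B| + (1 + B ^+ 2) / d; pose E := 2 + (1 + 2 * B ^+ 2) / d ^+ 2.
have B2 : 0 <= B ^+ 2 by exact: sqr_ge0.
have A0 : 0 <= A by rewrite addr_ge0// divr_ge0 ?(ltW d0)//; lra.
have E0 : 0 <= E by rewrite addr_ge0// divr_ge0 ?sqr_ge0//; lra.
exists (2 * A * J + E * J); first by rewrite addr_ge0// !mulr_ge0.
move=> z Wz; have [z0 zB gd] := hW z Wz; split.
  apply: le_trans (_ : 2 * A * J <= _); last by rewrite lerDl mulr_ge0.
  rewrite -mulrA -RintegralZl//; apply: cn_cintegral_le.
  - exact: cmeasurable_kint.
  - exact: rintegrableZ.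
  move=> t; rewrite cnM cn_real [leRHS]mulrCA.
  have [->|gt] := eqVneq (g t) 0; first by rewrite normr0 !mul0r.
  have dt := gd t gt; rewrite ler_wpM2l//.
  apply: le_trans (cn_kernel_le t z0) _; rewrite mulrC ler_wpM2r ?(ltW (rho_gt0 t))//.
  have B0 : 0 <= B by apply: le_trans zB; exact: cn_ge0.
  rewrite /A (ger0_norm B0); apply: lerD => //; apply: ler_pM; rewrite ?cn_ge0 ?invr_ge0 ?cn_ge0//.
    apply: le_trans (cnD _ _) _; rewrite cn1 cnX lerD2l.
    by apply: lerXn2r; rewrite ?nnegrE ?cn_ge0.
  by rewrite lef_pV2 ?posrE// (lt_le_trans d0).
rewrite Im_kint//; apply: le_trans (_ : E * J * `|Im z| <= _); last first.
  by rewrite ler_wpM2r// lerDr !mulr_ge0.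
have i1 := Im_kint_integrable z0 kg.
apply: le_trans (le_normr_Rintegral measurableT i1) _.
rewrite mulrAC -RintegralZl//; apply: le_rintegral.
- exact: rintegrable_norm.
- exact: rintegrableZ.
move=> t; rewrite normrM; have [->|gt] := eqVneq (g t) 0.
  by rewrite normr0 !mul0r mulr0.
rewrite [leRHS]mulrCA ler_wpM2l// normrM [leRHS]mulrAC mulrC ler_wpM2r//.
rewrite ger0_norm ?invr_ge0 ?sqr_ge0//; apply: inv_cn_le_rho => //; exact: gd.
Qed.

End TameFunctions.

(** * Positivity and integrability of the new density *)

Section DensityIntegrable.
Context {R : realType} (mu : {measure set R -> \bar R}) (al be : R).
Hypotheses (irho : rintegrable mu rho) (be0 : 0 <= be).
Variables (s : seq R) (N : {poly R}).
Local Notation C := (R[i]^o).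
Local Notation D := (\prod_(x <- s) ('X - x%:P)).
Local Notation Q := (cauchyQ mu al be).
Local Notation r t := (N.[t] / D.[t]).
Local Notation rQ z := (peval N z / peval D z * Q z).
Hypothesis P_Im : forall z, 0 < Im z -> 0 <= Im (rQ z).

Lemma measurable_ratio : measurable_fun setT (fun t => r t).
Proof.
apply: measurable_funM; first exact: measurable_horner.
by apply: measurable_inv; exact: measurable_horner.
Qed.

(** Multiplying r Q by |D|^2 replaces N / D by N conj(D), the form treated by [density_sign_null];
    and N D has the sign of N / D. *)
Lemma ratio_ge0 : {ae mu, forall t, 0 <= r t}.
Proof.
have ND z : 0 < Im z -> 0 <= Im (peval N z * conjc (peval D z) * Q z).
  move=> z0; have Dz := peval_prod_nonreal s (lt0r_neq0 z0).
  have -> : peval N z * conjc (peval D z) * Q z = (cn (peval D z) ^+ 2)%:C * rQ z.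
    by rewrite -mulJc; field.
  by rewrite cImM /= mul0r addr0 mulr_ge0 ?sqr_ge0 ?P_Im.
apply: negligibleS (density_sign_null irho be0 ND) => t /= /negP.
rewrite -ltNge => rt; have D0 : D.[t] != 0.
  by apply: contraTneq rt => ->; rewrite invr0 mulr0 ltxx.
have D2 : 0 < D.[t] ^+ 2 by rewrite lt_def sqr_ge0 andbT expf_neq0.
have -> : N.[t] * D.[t] = r t * D.[t] ^+ 2 by field.
by rewrite pmulr_llt0.
Qed.

(** One parameter controls the distance to the poles and to infinity; as [d] decreases to 0 these
    closed bounded sets exhaust the complement of [s]. *)
Definition far_set (d : R) : set R :=
  [set t | all (fun x => d <= `|t - x|) s && (`|t| <= d^-1)].

Lemma measurable_far_set d : measurable (far_set d).
Proof.
have mabs (x : R) : measurable_fun setT (fun t : R => `|t - x|).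
  by apply: measurableT_comp => //; apply: measurable_funB => //; exact: measurable_cst.
have m1 : measurable [set t : R | `|t| <= d^-1].
  rewrite (_ : [set _ | _] = (fun t : R => `|t - 0|) @^-1` `]-oo, d^-1]).
    by rewrite -[X in measurable X]setTI; exact: mabs.
  by apply/seteqP; split => t /=; rewrite subr0 in_itv.
rewrite (_ : far_set d = [set t | all (fun x => d <= `|t - x|) s] `&` [set t : R | `|t| <= d^-1]).
  apply: measurableI => //; elim: s => [|x s' IH].
    by rewrite [X in measurable X](_ : _ = setT)//; apply/seteqP; split.
  rewrite (_ : [set _ | _] = (fun t : R => `|t - x|) @^-1` `[d, +oo[ `&`
      [set t | all (fun x => d <= `|t - x|) s']).
    by apply: measurableI => //; rewrite -[X in measurable X]setTI; exact: mabs.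
  by apply/seteqP; split => t /=; rewrite in_itv/= andbT; [move/andP|move=> ?; exact/andP].
by apply/seteqP; split => t /=; [move/andP|move=> ?; exact/andP].
Qed.

Lemma measurable_chi d : measurable_fun setT (\1_(far_set d) : R -> R).
Proof. by apply: measurable_indic; exact: measurable_far_set. Qed.

Lemma kdensity_bounded (g : R -> R) c : measurable_fun setT g ->
  (forall t, `|g t| <= c) -> kdensity mu g.
Proof.
move=> mg gc; split => //; apply: rintegrable_le (rintegrableZ c irho) _.
  by apply: measurable_funM; [exact: measurableT_comp|exact: measurable_rho].
by move=> t; rewrite normrM normr_id (gtr0_norm (rho_gt0 t)) ler_wpM2r// ltW// rho_gt0.
Qed.

Lemma horner_prod_far d t : 0 < d -> t \in far_set d -> d ^+ size s <= `|D.[t]|.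
Proof.
move=> d0; rewrite inE => /andP[+ _]; elim: s => [|x s' IH].
  by rewrite big_nil hornerC normr1.
move=> /= /andP[xt st]; rewrite big_cons hornerM normrM !hornerE exprS.
by apply: ler_pM; rewrite ?exprn_ge0 ?(ltW d0)// IH.
Qed.

Lemma ratio_far_bounded d : 0 < d -> exists2 c, 0 <= c &
  forall t, t \in far_set d -> `|r t| <= c.
Proof.
move=> d0; have [L L0 hL] := peval_lipschitz N d^-1.
have dn : 0 < d ^+ size s by exact: exprn_gt0.
exists (L / d ^+ size s) => [|t td]; first by rewrite divr_ge0// ltW.
have Dt := horner_prod_far d0 td.
rewrite normrM normfV; apply: ler_pM; rewrite ?invr_ge0//.
  move: td; rewrite inE => /andP[_ td].
  have tC : cn (t%:C : R[i]) <= d^-1 by rewrite cn_real.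
  by have [+ _] := hL _ _ tC tC; rewrite peval_real cn_real.
by rewrite lef_pV2 ?posrE// (lt_le_trans dn).
Qed.

Lemma horner_prod_far_neq0 d t : 0 < d -> t \in far_set d -> D.[t] != 0.
Proof.
move=> d0 td; rewrite -normr_gt0; apply: lt_le_trans (horner_prod_far d0 td).
exact: exprn_gt0.
Qed.

Section Truncation.
Variable d : R.
Hypotheses (d0 : 0 < d) (d1 : d < 1).
Local Notation chi := (\1_(far_set d) : R -> R).
Local Notation chi2 := (\1_(far_set (d / 2)) : R -> R).

Lemma kdensity_chi_ratio e (g : R -> R) : 0 < e -> measurable_fun setT g ->
  (forall t, `|g t| = `|r t|) -> kdensity mu (fun t => \1_(far_set e) t * g t).
Proof.
move=> e0 mg gr; have [c c0 hc] := ratio_far_bounded e0.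
apply: (@kdensity_bounded _ c).
  by apply: measurable_funM => //; exact: measurable_chi.
move=> t; rewrite indicE; case: (boolP (t \in _)) => te.
  by rewrite mul1r gr hc.
by rewrite mul0r normr0.
Qed.

(** The thresholds 3 d / 4 and 3 / (2 d) lie halfway between those of [far_set d] and
    [far_set (d / 2)]. The gaps are d / 4 near a pole and 1 / (2 d) at infinity, the latter at least
    d / 4 since d < 1. *)
Lemma chi_ratio_dist t z : ~ [/\ cn z <= 3 / (2 * d) &
    forall x, x \in s -> 3 * d / 4 <= cn (z - x%:C)] ->
  t \in far_set d -> d / 4 <= cn (t%:C - z).
Proof.
move=> nW; rewrite inE => /andP[/allP ts td].
have [zB|zB] := leP (cn z) (3 / (2 * d)); last first.
  have := cn_le_sub z t%:C; rewrite cn_real cnB.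
  have : d / 4 <= 3 / (2 * d) - d^-1.
    have -> : 3 / (2 * d) - d^-1 = (2 * d)^-1 by field; rewrite gt_eqF.
    rewrite -(@ler_pM2r _ (4 * (2 * d))) ?mulr_gt0// [leRHS](_ : _ = 4); last first.
      by field; rewrite gt_eqF.
    rewrite [leLHS](_ : _ = 2 * (d * d)); last by field.
    have : d * d <= 1 by rewrite -[leRHS]mulr1; apply: ler_pM => //; exact: ltW.
    by lra.
  by lra.
have [x xs xz] : exists2 x, x \in s & cn (z - x%:C) < 3 * d / 4.
  apply: contrapT => nx; apply: nW; split => // x xs.
  by rewrite leNgt; apply/negP => xz; apply: nx; exists x.
have := ts x xs; have := cnD (t%:C - z) (z - x%:C).
rewrite addrA subrK -rmorphB cn_real; lra.
Qed.

(* On the neighbourhood W of the support of chi, rational_part separates the density chi2 r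
   from r Q up to a tame function; off W, chi_ratio_dist bounds the imaginary part of the
   subtracted term by O(Im z). Either way the imaginary part is almost nonnegative near the
   boundary, and half_plane_minimum applies. *)
Lemma truncated_min : forall z, 0 < Im z ->
  0 <= Im (rQ z - kint mu (fun t => chi t * `|r t|) z).
Proof.
(* The absolute value makes the truncated densities nonnegative everywhere; it agrees with r only
   almost everywhere. *)
pose a t := `|r t|.
have ma : measurable_fun setT a by apply: measurableT_comp => //; exact: measurable_ratio.
have d20 : 0 < d / 2 by rewrite divr_gt0.
have ka e : 0 < e -> kdensity mu (fun t => \1_(far_set e) t * a t).
  by move=> e0; apply: kdensity_chi_ratio => // t; rewrite /a normr_id.
have [k1 k2] := (ka d d0, ka _ d20).
have k3 : kdensity mu (fun t => chi2 t * r t).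
  by apply: kdensity_chi_ratio => //; exact: measurable_ratio.
have kchi2 : kdensity mu chi2.
  apply: (@kdensity_bounded _ 1); first exact: measurable_chi.
  by move=> t; rewrite indicE; case: (_ \in _); rewrite ?normr1 ?normr0.
have kone := kdensity1 irho.
have knchi : kdensity mu (fun t => 1 - chi2 t).
  apply: (@kdensity_bounded _ 1).
    by apply: measurable_funB; [exact: measurable_cst|exact: measurable_chi].
  by move=> t; rewrite indicE; case: (_ \in _); rewrite ?subrr ?subr0 ?normr1 ?normr0.
have [p hp] : exists p : {poly R}, forall z, Im z != 0 ->
    peval N z * kint mu chi2 z - peval D z * kint mu (fun t => chi2 t * r t) z = peval p z.
  apply: rational_part => // t; rewrite indicE => tz.
  by apply: (horner_prod_far_neq0 d20); case: (boolP (t \in _)) tz; rewrite ?eqxx.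
have chi_a z : kint mu (fun t => chi2 t * r t) z = kint mu (fun t => chi2 t * a t) z.
  apply: ae_cintegral.
  - by apply: cmeasurable_kint; have [] := k3.
  - by apply: cmeasurable_kint; have [] := k2.
  by apply: filterS ratio_ge0 => t rt; rewrite /a ger0_norm.
pose G z : C := rQ z - kint mu (fun t => chi t * a t) z.
pose G1 z : C := peval N z * (peval D z)^-1 * ((al%:C + be%:C * z) + kint mu (fun t => 1 - chi2 t) z) +
  peval p z * (peval D z)^-1.
(* [rational_part] trades r times the transform of [chi2] for the transform of [chi2] r plus p / D.
   The bracket has nonnegative imaginary part because chi <= chi2, and [G1] is tame on [W]. *)
have GG1 z : Im z != 0 -> G z = G1 z + (kint mu (fun t => chi2 t * a t) z - kint mu (fun t => chi t * a t) z).
  move=> z0; rewrite /G /G1 kintB// -hp// chi_a /cauchyQ.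
  by have Dz := peval_prod_nonreal s z0; field.
have chi0 t : 0 <= chi t by rewrite indicE.
have a0 t : 0 <= a t by exact: normr_ge0.
have chi_le t : chi t <= chi2 t.
  rewrite !indicE; case: (boolP (t \in far_set d)) => //; rewrite inE => /andP[/allP ts td].
  rewrite mem_set//= /far_set /mkset; apply/andP; split.
    by apply/allP => x xs; apply: le_trans (ts x xs); rewrite ler_pdivrMr// ler_pMr//; lra.
  by apply: le_trans td _; rewrite lef_pV2 ?posrE// ler_pdivrMr// ler_pMr//; lra.
pose W : set C := [set z | 0 < Im z /\ (cn z <= 3 / (2 * d) /\
  forall x, x \in s -> 3 * d / 4 <= cn (z - x%:C))].
have tG1 : tame W G1.
  have d340 : 0 < 3 * d / 4 by lra.
  have WB z : W z -> cn z <= 3 / (2 * d) by move=> [_ []].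
  have tD : tame W (fun z => (peval D z)^-1).
    by apply: (tame_inv_prod d340) => z x [_ [_ h]]; exact: h.
  have tN q := tame_peval q WB.
  apply: tameD; last exact: tameM.
  apply: tameM; first exact: tameM.
  apply: tameD.
    apply: (tame_eq _ (tN (al%:P + be *: 'X))) => z _.
    by rewrite pevalD pevalC pevalZ pevalX.
  apply: (@tame_kint _ mu _ W (d / 4) (3 / (2 * d))) => //; first by rewrite divr_gt0.
  move=> z [z0 [zB zs]]; split => //; first exact: lt0r_neq0.
  move=> t; rewrite indicE; case: (boolP (t \in _)); rewrite ?subrr ?eqxx// => tn _.
  move: tn; rewrite notin_setE => tn; rewrite leNgt; apply/negP => tz; apply: tn.
  apply/andP; split.
    apply/allP => x xs; have := zs x xs; have := cnD (z - t%:C) (t%:C - x%:C).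
    by rewrite addrA subrK -rmorphB cn_real [cn (z - t%:C)]cnB; lra.
  have := cn_le_sub t%:C z; rewrite cn_real invf_div.
  have : d / 4 <= 2 / d - 3 / (2 * d).
    have -> : 2 / d - 3 / (2 * d) = (2 * d)^-1 by field; rewrite gt_eqF.
    rewrite -(@ler_pM2r _ (4 * (2 * d))) ?mulr_gt0// [leRHS](_ : _ = 4); last first.
      by field; rewrite gt_eqF.
    rewrite [leLHS](_ : _ = 2 * (d * d)); last by field.
    have : d * d <= 1 by rewrite -[leRHS]mulr1; apply: ler_pM => //; exact: ltW.
    by lra.
  by lra.
have [c c0 cG1] := tG1.
have [cr cr0 hcr] := ratio_far_bounded d0.
pose J := \int[mu]_t rho t.
have J0 : 0 <= J by apply: Rintegral_ge0 => t _; rewrite ltW// rho_gt0.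
(* On [far_set d] one has 1 + t^2 <= 1 + d^-2, so a bound on r there becomes a multiple of [rho]. *)
pose H := cr * (1 + d^-1 ^+ 2).
have H0 : 0 <= H by rewrite mulr_ge0// addr_ge0// sqr_ge0.
have aH t : chi t * a t <= H * rho t.
  rewrite indicE; case: (boolP (t \in _)) => [td|_]; last first.
    by rewrite mul0r mulr_ge0// ltW// rho_gt0.
  rewrite mul1r /H -mulrA; apply: le_trans (hcr t td) _; rewrite ler_peMr//.
  rewrite /rho ler_pdivlMr ?ltr_wpDr ?sqr_ge0// mul1r lerD2l.
  move: td; rewrite inE => /andP[_ td]; rewrite -[leLHS]real_normK ?num_real//.
  by apply: lerXn2r; rewrite ?nnegrE ?invr_ge0// ltW.
have kle z (e : R) : 0 < Im z -> 0 < e -> (forall t, t \in far_set d -> e <= cn (t%:C - z)) ->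
    Im (kint mu (fun t => chi t * a t) z) <= Im z / e ^+ 2 * (H * J).
  move=> z0 e0 he; rewrite Im_kint ?lt0r_neq0//.
  rewrite mulrA -RintegralZl//; apply: le_rintegral.
  - by apply: Im_kint_integrable => //; exact: lt0r_neq0.
  - exact: rintegrableZ.
  move=> t; have [td|td] := boolP (t \in far_set d); last first.
    rewrite indicE (negbTE td) !mul0r mulr_ge0 ?(ltW (rho_gt0 t))// mulr_ge0//.
    by rewrite divr_ge0 ?sqr_ge0// ltW.
  rewrite mulrC -[leRHS]mulrA; apply: ler_pM.
  - by rewrite divr_ge0 ?sqr_ge0// ltW.
  - exact: mulr_ge0 (chi0 t) (a0 t).
  - rewrite ler_pM2l// lef_pV2 ?posrE ?exprn_gt0//.
      by apply: lerXn2r; rewrite ?nnegrE ?cn_ge0 ?he// ltW.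
    by rewrite (lt_le_trans e0)// he.
  - exact: aH.
apply: half_plane_minimum.
  have jN := jet2_peval N; have jD := jet2_inv_prod s.
  have jQ : jet2 Q.
    apply: jet2D; last exact: jet2_kint.
    apply: jet2D; first exact: jet2_cst.
    by apply: jet2M; [exact: jet2_cst|exact: jet2_id].
  apply: (@jet2_eq _ (fun z => peval N z * (peval D z)^-1 * Q z +
    (-1) * kint mu (fun t => chi t * a t) z)).
    by move=> w _; rewrite mulN1r.
  apply: jet2D; first by apply: jet2M => //; exact: jet2M.
  by apply: jet2M; [exact: jet2_cst|exact: jet2_kint].
move=> e e0.
have HJ0 : 0 <= H * J by exact: mulr_ge0.
(* For |w| > B the support of [chi] is at distance at least |w| / 2 from w, and the resulting bound
   4 H J / |w| is at most [e]. *)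
pose B := 2 / d + 4 * (H * J) / e + 1.
have dd : 0 <= 2 / d by rewrite divr_ge0// ltW.
have ee : 0 <= 4 * (H * J) / e by rewrite divr_ge0 ?(ltW e0)// mulr_ge0.
have B0 : 0 < B by rewrite /B; lra.
pose c1 := (H * J) * (4 / d) ^+ 2.
have c10 : 0 <= c1 by rewrite mulr_ge0 ?sqr_ge0.
(* Below this height both error terms, c Im w on [W] and c1 Im w off [W], are at most [e]. *)
exists (e / (c + c1 + 1)), B; split => //.
  by rewrite divr_gt0// ltr_wpDl// addr_ge0.
have dB : 2 / d <= B by rewrite /B; lra.
move=> w w0 [wy|wB]; last first.
  have cw0 : 0 < cn w by exact: lt_trans wB.
  have : Im (kint mu (fun t => chi t * a t) w) <= e.
    apply: le_trans (kle w (cn w / 2) w0 _ _) _.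
    - by rewrite divr_gt0.
    - move=> t; rewrite inE => /andP[_ td]; have := cn_le_sub w t%:C.
      rewrite cn_real cnB; have : d^-1 <= cn w / 2.
        rewrite ler_pdivlMr// mulrC; apply: le_trans dB _; exact: ltW.
      by lra.
    have wI : Im w <= cn w by apply: le_trans (ler_norm _) (Im_le_cn _).
    apply: le_trans (_ : cn w / (cn w / 2) ^+ 2 * (H * J) <= _).
      by rewrite ler_wpM2r// ler_wpM2r// invr_ge0 sqr_ge0.
    have -> : cn w / (cn w / 2) ^+ 2 * (H * J) = 4 * (H * J) / cn w.
      by field; rewrite gt_eqF.
    rewrite ler_pdivrMr// -ler_pdivrMl// [e^-1 * _]mulrC; apply: le_trans (ltW wB).
    by rewrite /B; lra.
  by have := P_Im w0; rewrite cImD cImN; lra.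
have w0' := lt0r_neq0 w0.
have yb : Im w * (c + c1 + 1) <= e by rewrite -ler_pdivlMr ?ltW// ltr_wpDl// addr_ge0.
have yc : 0 <= Im w * c by rewrite mulr_ge0// ltW.
have yc1 : 0 <= Im w * c1 by rewrite mulr_ge0// ltW.
have [Ww|nW] := pselect (W w).
  rewrite -[X in Im X]/(G w) GG1// cImD.
  have [_] := cG1 w Ww; rewrite (gtr0_norm w0) ler_norml => /andP[h _].
  have : 0 <= Im (kint mu (fun t => chi2 t * a t) w - kint mu (fun t => chi t * a t) w).
    rewrite -kintB//; have kB : kdensity mu (fun t => chi2 t * a t - chi t * a t).
      apply: (@kdensity_le _ mu (fun t => chi2 t * a t)) => //.
        by apply: measurable_funB; [have [] := k2|have [] := k1].
      move=> t; rewrite -mulrBl !normrM ler_wpM2r//.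
      rewrite !indicE; have := chi_le t; rewrite !indicE.
      by case: (_ \in _); case: (_ \in _); rewrite ?subrr ?subr0 ?normr0 ?normr1 ?ler10// lexx.
    rewrite Im_kint//; apply: Rintegral_ge0 => t _; rewrite mulr_ge0//.
      by rewrite -mulrBl mulr_ge0// subr_ge0.
    by rewrite divr_ge0 ?sqr_ge0// ltW.
  by lra.
have : Im (kint mu (fun t => chi t * a t) w) <= Im w * c1.
  apply: le_trans (kle w (d / 4) w0 _ _) _.
  - by rewrite divr_gt0.
  - by move=> t; apply: chi_ratio_dist => h; apply: nW.
  rewrite le_eqVlt; apply/orP; left; apply/eqP.
  by rewrite /c1; field; rewrite gt_eqF.
by have := P_Im w0; rewrite cImD cImN; lra.
Qed.

End Truncation.

Lemma far_set_eventually t : t \notin s -> exists n0, forall n, (n0 <= n)%N ->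
  t \in far_set n.+2%:R^-1.
Proof.
move=> ts.
have small (y : R) : 0 < y -> exists n0, forall n, (n0 <= n)%N -> n.+2%:R^-1 <= y.
  move=> y0; exists (Num.truncn y^-1) => n ny.
  rewrite invf_ple ?posrE//; apply: le_trans (ltW (truncnS_gt _)) _.
  by rewrite ler_nat ltnS (leq_trans ny).
have [n1 h1] : exists n1, forall n, (n1 <= n)%N -> all (fun x => n.+2%:R^-1 <= `|t - x|) s.
  elim: (s) ts => [_|x s' IH]; first by exists 0%N.
  rewrite inE negb_or => /andP[tx /IH[n1 h1]].
  have tx0 : 0 < `|t - x| by rewrite normr_gt0 subr_eq0.
  have [n2 h2] := small _ tx0.
  exists (maxn n1 n2) => n; rewrite geq_max => /andP[m1 m2] /=.
  by rewrite h1// h2.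
exists (maxn n1 (Num.truncn `|t|)) => n; rewrite geq_max => /andP[m1 m2].
rewrite inE /far_set /mkset h1//= invrK; apply: le_trans (ltW (truncnS_gt _)) _.
by rewrite ler_nat ltnS (leq_trans m2).
Qed.

(** At z = i the imaginary part of the kernel is [rho t], so [truncated_min] bounds all truncated
    integrals of |r| rho by the single number Im (r Q)(i), and monotone convergence applies. *)
Lemma density_integrable : kdensity mu (fun t => r t).
Proof.
split; first exact: measurable_ratio.
pose c := Im (rQ (0 +i* 1)).
pose f n t : R := \1_(far_set n.+2%:R^-1) t * `|r t|.
have dn0 n : 0 < n.+2%:R^-1 :> R by rewrite invr_gt0.
have dn1 n : n.+2%:R^-1 < 1 :> R by rewrite invf_lt1// ltr1n.
have kf n : kdensity mu (f n).
  apply: kdensity_chi_ratio => //; last by move=> t; rewrite normr_id.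
  by apply: measurableT_comp => //; exact: measurable_ratio.
have f0 n t : 0 <= f n t by rewrite mulr_ge0.
have intf n : (\int[mu]_t (f n t * rho t)%:E <= c%:E)%E.
  have i0 : Im (0 +i* 1 : R[i]) != 0 by rewrite /= oner_eq0.
  have i1 : rintegrable mu (fun t => f n t * rho t).
    by have [_] := kf n; under eq_fun do rewrite ger0_norm//.
  rewrite -(fineK (integrable_fin_num measurableT i1)) lee_fin.
  have := truncated_min (dn0 n) (dn1 n) (ltr01 : 0 < Im (0 +i* 1 : R[i])).
  rewrite cImD cImN subr_ge0 -/c (Im_kint i0 (kf n)) => h; apply: le_trans h.
  rewrite le_eqVlt; apply/orP; left; apply/eqP; apply: eq_Rintegral => t _.
  by rewrite sqr_cn /= subr0 sub0r sqrrN expr1n div1r [_ + 1]addrC.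
have mf n : measurable_fun setT (fun t => (f n t * rho t)%:E).
  apply/measurable_EFinP; apply: measurable_funM; last exact: measurable_rho.
  by have [] := kf n.
have fle n m t : (n <= m)%N -> f n t <= f m t.
  move=> nm; rewrite ler_wpM2r// !indicE.
  case: (boolP (t \in far_set n.+2%:R^-1)) => //; rewrite inE => /andP[/allP ts td].
  have nm' : m.+2%:R^-1 <= n.+2%:R^-1 :> R by rewrite lef_pV2 ?posrE// ler_nat.
  rewrite mem_set//= /far_set /mkset; apply/andP; split.
    by apply/allP => x xs; apply: le_trans (ts x xs).
  by apply: le_trans td _; rewrite lef_pV2 ?posrE.
apply/integrableP; split.
  apply/measurable_EFinP; apply: measurable_funM; last exact: measurable_rho.
  by apply: measurableT_comp => //; exact: measurable_ratio.
have -> : (\int[mu]_t `|(EFin \o (fun t => `|r t| * rho t)%R) t| =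
    \int[mu]_t limn (fun n => (f n t * rho t)%R%:E))%E.
  apply: eq_integral => t _; apply/esym/cvg_lim => //.
  rewrite /= normrM normr_id (gtr0_norm (rho_gt0 t)).
  apply: cvg_near_cst; have [ts|ts] := boolP (t \in s).
    (* At a pole the convention 1 / 0 = 0 makes every truncation and the limit vanish. *)
    have D0 : D.[t] = 0.
      rewrite (big_rem t)//= hornerM hornerXsubC subrr mul0r//.
    by apply: nearW => n; rewrite /f D0 invr0 mulr0 normr0 mulr0.
  have [n0 hn] := far_set_eventually ts.
  by exists n0 => // n /hn tn; rewrite /f indicE tn mul1r.
rewrite (monotone_convergence mu measurableT) => //; last 2 first.
- by move=> n t _; rewrite lee_fin mulr_ge0// ltW// rho_gt0.
- move=> t _ n m nm; rewrite lee_fin; apply: ler_wpM2r; last exact: fle.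
  by rewrite ltW// rho_gt0.
apply: (@le_lt_trans _ _ c%:E); last exact: ltry.
apply: lime_le; last exact: nearW.
apply: ereal_nondecreasing_is_cvgn => n m nm; apply: ge0_le_integral => //.
- by move=> t _; rewrite lee_fin mulr_ge0// ltW// rho_gt0.
- move=> t _; rewrite lee_fin; apply: ler_wpM2r; last exact: fle.
  by rewrite ltW// rho_gt0.
Qed.

End DensityIntegrable.

(** * Integral representation of the product *)

Section Boundary.
Context {R : realType}.
Local Notation C := (R[i]^o).

(** On the vertical ray both local parameters, b - z and z^-1, equal - i d with d > 0, so the
    product has real part d Im F >= 0. *)
Lemma residue_ge0 (xi : option R) (F : C -> C) (k : R) :
  (forall z, 0 < Im z -> 0 <= Im (F z)) ->
  (if xi is Some b then b%:C - z else z^-1) * F z @[z --> nontangential xi] --> (k%:C : C) ->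
  0 <= k.
Proof.
move=> F0 Fk; have i0 : 0 < Im (0 +i* 1 : R[i]) by exact: ltr01.
rewrite -oppr_le0 -[- k]/(Re (- k%:C)); apply: Re_limit_le0 => e e0.
have /nontangential_cvgP/(_ (`|Re (0 +i* 1 : R[i])| / Im (0 +i* 1 : R[i])) e e0)[n nP] := Fk.
have [d d0 ds] := sector_direction xi n i0; have := nP _ ds => {nP ds Fk}.
set z := (if xi is Some b then b%:C + d%:C * (0 +i* 1) else d^-1%:C * (0 +i* 1)).
have zI : 0 < Im z.
  by rewrite /z; case: (xi) => [b|]; rewrite ?cImD cImM/= ?mul0r ?add0r ?addr0 ?mulr1 ?invr_gt0.
have -> : (if xi is Some b then b%:C - z else z^-1) = 0 +i* - d.
  rewrite /z; case: (xi) => [b|].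
    by rewrite opprD addNKr; apply: complex_ext; rewrite ?cReN ?cImN ?cReM ?cImM/=; ring.
  rewrite invfM fmorphV/= invrK.
  have -> : (0 +i* 1)^-1 = 0 +i* -1 :> R[i].
    by apply: complex_ext; rewrite ?cReV ?cImV sqr_cn/= expr0n expr1n add0r ?mul0r ?divr1.
  by apply: complex_ext; rewrite ?cReM ?cImM/=; ring.
move=> h; exists (- ((0 +i* - d) * F z)); last by rewrite -opprD cnN.
rewrite cReN cReM /= mul0r sub0r opprK mulNr oppr_le0.
by rewrite mulr_ge0 ?F0// ltW.
Qed.

Lemma cvgC_sum (I : Type) (rs : seq I) (F : set_system C) (FF : Filter F) (f : I -> C -> C)
  (l : I -> C) : (forall i, f i @ F --> l i) ->
  (\sum_(i <- rs) f i z : C) @[z --> F] --> (\sum_(i <- rs) l i : C).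
Proof.
move=> fl; elim: rs => [|i rs IH].
  by rewrite big_nil; under eq_fun do rewrite big_nil; exact: cvgC_cst.
rewrite big_cons; under eq_fun do rewrite big_cons.
by apply: cvgCD; [exact: fl|exact: IH].
Qed.

End Boundary.

Section Product.
Context {R : realType} (mu : {measure set R -> \bar R}) (al be : R).
Hypotheses (irho : rintegrable mu rho) (be0 : 0 <= be).
Variables (s : seq R) (N : {poly R}).
Local Notation C := (R[i]^o).
Local Notation D := (\prod_(x <- s) ('X - x%:P)).
Local Notation Q := (cauchyQ mu al be).
Local Notation r t := (N.[t] / D.[t]).
Local Notation rQ z := (peval N z / peval D z * Q z).
Hypothesis P_Im : forall z, 0 < Im z -> 0 <= Im (rQ z).
Hypothesis Ns : forall x, x \in s -> N.[x] != 0.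

Lemma prod_XsubC_eq0 t : (D.[t] == 0) = (t \in s).
Proof. by rewrite -/(root D t) root_prod_XsubC. Qed.

Lemma ratio_pole x : x \in s -> r x = 0.
Proof. by rewrite -prod_XsubC_eq0 => /eqP ->; rewrite invr0 mulr0. Qed.

Lemma kint_par xi : (if xi is Some b then b \in s else true) -> 
  local_par xi z * kint mu (fun t => r t) z @[z --> nontangential xi] --> (0 : C).
Proof.
have kr := density_integrable irho be0 P_Im.
case: xi => [b bs|_]; last exact: kint_infty.
by apply: kint_ray => //; exact: ratio_pole.
Qed.

Lemma product_representation : exists A B (c : R -> R), forall z, Im z != 0 ->
  rQ z = A%:C + B%:C * z + \sum_(x <- undup s) (c x)%:C / (x%:C - z) +
    kint mu (fun t => r t) z.
Proof.
have kr := density_integrable irho be0 P_Im.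
(* Equal to 1 almost everywhere, since the poles carry no atoms, yet zero at the roots of D as
   [rational_part] demands. *)
pose chi t : R := if D.[t] == 0 then 0 else 1.
have s0 x : x \in s -> mu [set x] = 0%E.
  by move=> xs; apply: pole_atom0 xs (Ns xs) => //; exact: P_Im.
have chi1 : {ae mu, forall t, chi t = 1}.
  apply: (@negligibleS _ _ _ _ [set` s]).
    move=> t /= ht; rewrite -prod_XsubC_eq0; apply/negP => /negP Dt.
    by apply: ht; rewrite /chi (negbTE Dt).
  have -> : [set` s] = \bigcup_(x in [set` s]) [set x].
    apply/seteqP; split => t /=; first by move=> ts; exists t.
    by move=> [x xs ->].
  elim: (s) s0 => [_|x s' IH sx].
    rewrite (_ : \bigcup_(_ in _) _ = set0); first exact: negligible_set0.
    by apply/seteqP; split => t // [].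
  rewrite (_ : \bigcup_(_ in _) _ = [set x] `|` \bigcup_(x in [set` s']) [set x]).
    apply: negligibleU.
      by apply/negligibleP; [exact: measurable_set1|apply: sx; rewrite mem_head].
    by apply: IH => y ys; apply: sx; rewrite inE ys orbT.
  apply/seteqP; split => t /=.
    by move=> [y]; rewrite /= inE => /orP[/eqP -> ->|ys ->]; [left|right; exists y].
  by move=> [->|[y ys ->]]; [exists x; rewrite //= mem_head|exists y; rewrite //= inE ys orbT].
have mchi : measurable_fun setT chi.
  rewrite (_ : chi = fun t => D.[t] * (D.[t])^-1).
    apply: measurable_funM; first exact: measurable_horner.
    by apply: measurable_inv; exact: measurable_horner.
  apply/funext => t; rewrite /chi; case: eqP => [->|/eqP D0]; first by rewrite mul0r.
  by rewrite mulfV.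
have kchi : kdensity mu chi.
  apply: (kdensity_bounded irho mchi (c := 1)) => t.
  by rewrite /chi; case: ifP; rewrite ?normr0 ?normr1.
have chir : (fun t => chi t * r t) = (fun t => r t).
  apply/funext => t; rewrite /chi; case: eqP => [->|]; last by rewrite mul1r.
  by rewrite mul0r invr0 mulr0.
have chi0 z : kint mu chi z = kint mu (fun=> 1) z.
  apply: ae_cintegral; [exact: cmeasurable_kint|apply: cmeasurable_kint; exact: measurable_cst|].
  by apply: filterS chi1 => t ->.
have [|t ct|p hp] := @rational_part _ mu s N chi kchi.
- by rewrite chir.
- by move: ct; rewrite /chi; case: ifP; rewrite ?eqxx.
rewrite chir in hp; pose q := N * (al%:P + be *: 'X) + p.
have qE z : Im z != 0 -> peval q z / peval D z = rQ z - kint mu (fun t => r t) z.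
  move=> z0; rewrite /q pevalD pevalM pevalD pevalC pevalZ pevalX -hp// chi0 /cauchyQ.
  by have Dz := peval_prod_nonreal s z0; field.
(* The transform of r is negligible at exponents j >= 2, at the poles because r t = 0 there; so q /
   D inherits its growth from r Q, to which [leading_term_eq0] applies. *)
have [|A [B [c h]]] := @partial_fractions _ (mem s) s q (fun x xs => xs).
  move=> xi j k xiS j2 h; apply: complexI.
  apply: (@leading_term_eq0 _ xi (fun z => rQ z) j) => //.
  have h0 : local_par xi z ^+ j * (peval q z / peval D z) + local_par xi z ^+ j.-1 *
     (local_par xi z * kint mu (fun t => r t) z) @[z --> nontangential xi] --> (k%:C + 0 * 0 : C).
    apply: cvgCD; first exact: h.
    apply: cvgCM; last exact: kint_par.
    by apply: local_par_exp_cvg0; case: j j2 {h} => [|[]].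
  rewrite mul0r addr0 in h0; apply: cvgC_nonreal_eq h0 => z z0.
  rewrite mulrA -exprSr prednK ?(ltn_trans _ j2)// -mulrDr qE// subrK.
  by case: (xi).
by exists A, B, c => z z0; rewrite -h// qE// subrK.
Qed.

Variables (A B : R) (c : R -> R).
Hypothesis rQE : forall z, Im z != 0 ->
  rQ z = A%:C + B%:C * z + \sum_(x <- undup s) (c x)%:C / (x%:C - z) +
    kint mu (fun t => r t) z.

Lemma product_infty : rQ z / z @[z --> nontangential None] --> (B%:C : C).
Proof.
have h : A%:C * z^-1 + B%:C + \sum_(x <- undup s) z^-1 * ((c x)%:C * (x%:C - z)^-1) +
    z^-1 * kint mu (fun t => r t) z @[z --> nontangential None] -->
    (A%:C * 0 + B%:C + \sum_(x <- undup s) (0 : C) + 0 : C).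
  apply: cvgCD; last exact: (@kint_par None).
  apply: cvgCD; first apply: cvgCD.
  - by apply: cvgCM; [exact: cvgC_cst|exact: nontangential_inv].
  - exact: cvgC_cst.
  apply: cvgC_sum => x; rewrite -(mul0r ((c x)%:C * 0 : C)).
  apply: cvgCM; first exact: nontangential_inv.
  by apply: cvgCM; [exact: cvgC_cst|exact: (@nontangential_resolvent _ None)].
rewrite mulr0 add0r addr0 big1_eq addr0 in h.
apply: cvgC_nonreal_eq h => z z0; rewrite rQE// -mulr_sumr.
by have zn0 := nonreal_neq0 z0; field.
Qed.

Lemma product_pole b : b \in s ->
  (b%:C - z) * rQ z @[z --> nontangential (Some b)] --> ((c b)%:C : C).
Proof.
move=> bs; have pb : b%:C - z @[z --> nontangential (Some b)] --> (0 : C).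
  rewrite -(subrr (b%:C : C)); apply: cvgCB; first exact: cvgC_cst.
  exact: nontangential_id.
have h : (b%:C - z) * (A%:C + B%:C * z) +
    \sum_(x <- undup s) (b%:C - z) * ((c x)%:C * (x%:C - z)^-1) -
    local_par (Some b) z * kint mu (fun t => r t) z @[z --> nontangential (Some b)] -->
    (0 * (A%:C + B%:C * b%:C) + \sum_(x <- undup s) (if x == b then c x else 0)%:C - 0 : C).
  apply: cvgCB; last exact: (@kint_par (Some b)).
  apply: cvgCD.
    apply: cvgCM; first exact: pb.
    apply: cvgCD; first exact: cvgC_cst.
    by apply: cvgCM; [exact: cvgC_cst|exact: nontangential_id].
  apply: cvgC_sum => x; case: eqP => [->|/eqP xb].
    apply: (@cvgC_nonreal_eq _ _ (fun=> (c b)%:C)); last exact: cvgC_cst.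
    by move=> z z0; have bz := nonreal_sub b z0; field.
  have -> : (0%:C : C) = 0 * ((c x)%:C * (x%:C - b%:C)^-1) by rewrite mul0r.
  apply: cvgCM; first exact: pb.
  apply: cvgCM; first exact: cvgC_cst.
  apply: (@nontangential_resolvent _ (Some b)).
  by apply: contra_neqN xb => /eqP[].
rewrite mul0r add0r subr0 in h.
have sumE : \sum_(x <- undup s) ((if x == b then c x else 0)%:C : C) = (c b)%:C.
  rewrite (bigD1_seq b) ?mem_undup ?undup_uniq//= eqxx big1 ?addr0// => x xb.
  by rewrite (negbTE xb).
rewrite sumE in h; apply: cvgC_nonreal_eq h => z z0; rewrite rQE// -mulr_sumr /=; ring.
Qed.

Lemma product_infty_ge0 : 0 <= B.
Proof.
apply: (@residue_ge0 _ None (fun z => rQ z)) => //.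
by apply: cvgC_nonreal_eq product_infty => z z0; rewrite mulrC.
Qed.

Lemma product_pole_ge0 b : b \in s -> 0 <= c b.
Proof.
move=> bs; apply: (@residue_ge0 _ (Some b) (fun z => rQ z)) => //.
exact: product_pole.
Qed.

End Product.

(** * The Weyl function of the model *)

Section WeightedSpaces.
Context {R : realType} (mu : {measure set R -> \bar R}) (beta : R).
Hypothesis beta0 : 0 <= beta.
Local Notation C := (R[i]^o).
Local Notation V := ((R -> C) * C)%type.
Implicit Types (x y p q : V) (f g : R -> C) (k h : R -> R) (xi : option R).

Definition wL2 k f := cmeasurable f /\ rintegrable mu (fun t => k t * cn (f t) ^+ 2).

Lemma sqintegrableP k f : measurable_fun setT k -> (forall t, 0 <= k t) ->
  sqintegrable mu k f <-> wL2 k f.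
Proof.
move=> mk k0; have kE t : `|(EFin \o (fun t => k t * cn (f t) ^+ 2)%R) t|%E =
    (k t * (Re (f t) ^+ 2 + Im (f t) ^+ 2))%:E.
  by rewrite -sqr_cn abse_EFin ger0_norm// mulr_ge0// sqr_ge0.
split => -[mf i]; split => //.
  apply/integrableP; split.
    by apply/measurable_EFinP; apply: measurable_funM => //; apply: measurable_funX; exact: measurable_cn.
  by rewrite (eq_integral _ _ (fun t _ => kE t)).
move/integrableP : i => [_].
by rewrite (eq_integral _ _ (fun t _ => kE t)).
Qed.

Lemma cn_sqrD (a b : R[i]) : cn (a + b) ^+ 2 <= 2 * cn a ^+ 2 + 2 * cn b ^+ 2.
Proof.
have h : cn (a + b) ^+ 2 <= (cn a + cn b) ^+ 2.
  by apply: lerXn2r; rewrite ?nnegrE ?addr_ge0 ?cn_ge0// cnD.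
by have := sqr_ge0 (cn a - cn b); lra.
Qed.

Lemma wL2_measurable k f : measurable_fun setT k -> cmeasurable f ->
  measurable_fun setT (fun t => k t * cn (f t) ^+ 2).
Proof.
move=> mk mf; apply: measurable_funM => //; apply: measurable_funX.
exact: measurable_cn.
Qed.

Lemma wL2_le k k' c f : measurable_fun setT k' -> (forall t, 0 <= k' t <= c * k t) ->
  wL2 k f -> wL2 k' f.
Proof.
move=> mk kk [mf i]; split => //; apply: rintegrable_le (rintegrableZ c i) _.
  exact: wL2_measurable.
move=> t; have /andP[k0 k1] := kk t.
by rewrite ger0_norm ?mulr_ge0 ?cn_ge0// mulrA ler_wpM2r ?sqr_ge0.
Qed.

Lemma wL2_mul k k' c f (g : R -> C) : measurable_fun setT k' -> cmeasurable g ->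
  (forall t, 0 <= k' t) -> (forall t, k' t * cn (g t) ^+ 2 <= c * k t) ->
  wL2 k f -> wL2 k' (fun t => f t * g t).
Proof.
move=> mk mg k0 kk [mf i]; split; first exact: cmeasurableM.
apply: rintegrable_le (rintegrableZ c i) _.
  by apply: wL2_measurable => //; exact: cmeasurableM.
move=> t; rewrite ger0_norm ?mulr_ge0 ?cn_ge0// cnM exprMn.
rewrite [leLHS](_ : _ = k' t * cn (g t) ^+ 2 * cn (f t) ^+ 2); last by ring.
by rewrite mulrA ler_wpM2r ?sqr_ge0.
Qed.

Lemma wL2D k f g : measurable_fun setT k -> (forall t, 0 <= k t) ->
  wL2 k f -> wL2 k g -> wL2 k (fun t => f t + g t).
Proof.
move=> mk k0 [mf i] [mg j]; split; first exact: cmeasurableD.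
apply: rintegrable_le (rintegrableD (rintegrableZ 2 i) (rintegrableZ 2 j)) _.
  by apply: wL2_measurable => //; exact: cmeasurableD.
move=> t; rewrite ger0_norm ?mulr_ge0 ?cn_ge0//.
have := ler_wpM2l (k0 t) (cn_sqrD (f t) (g t)).
by rewrite mulrDr; lra.
Qed.

Lemma wL2Z k (c : R[i]) f : wL2 k f -> wL2 k (fun t => c * f t).
Proof.
move=> [mf i]; split; first by apply: cmeasurableM => //; exact: cmeasurable_cst.
have -> : (fun t => k t * cn (c * f t) ^+ 2) = (fun t => cn c ^+ 2 * (k t * cn (f t) ^+ 2)).
  by apply/funext => t; rewrite cnM exprMn mulrCA.
exact: rintegrableZ.
Qed.

Lemma measurable_absval xi : measurable_fun setT (absval xi : R -> R).
Proof.
case: xi => [x|] /=; last exact: measurableT_comp.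
apply: measurable_inv; apply: measurableT_comp => //.
by apply: measurable_funB => //; exact: measurable_cst.
Qed.

Lemma absval_ge0 xi t : 0 <= absval xi t :> R.
Proof. by case: xi => [x|] /=; rewrite ?invr_ge0. Qed.

Definition wminus xi t : R := (1 + absval xi t)^-1.

Lemma measurable_wminus xi : measurable_fun setT (wminus xi).
Proof.
apply: measurable_inv; apply: measurable_funD; first exact: measurable_cst.
exact: measurable_absval.
Qed.

Lemma wminus_gt0 xi t : 0 < wminus xi t.
Proof. by rewrite invr_gt0 ltr_wpDr// absval_ge0. Qed.

Definition wplus xi t : R := 1 + absval xi t.

Lemma measurable_wplus xi : measurable_fun setT (wplus xi).
Proof.
by apply: measurable_funD; [exact: measurable_cst|exact: measurable_absval].
Qed.

Lemma wplus_gt0 xi t : 0 < wplus xi t.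
Proof. by rewrite ltr_wpDr// absval_ge0. Qed.

Lemma HspaceP x : Hspace mu beta x <-> wL2 (fun=> 1) x.1.
Proof. by apply: sqintegrableP; [exact: measurable_cst|]. Qed.

Lemma HminusP xi x : Hminus mu beta xi x <-> wL2 (wminus xi) x.1.
Proof.
by apply: sqintegrableP => [|t]; [exact: measurable_wminus|exact: ltW (wminus_gt0 _ _)].
Qed.

Lemma cn_sqrtabs xi t (v : R[i]) : cn ((Num.sqrt (absval xi t))%:C * v) ^+ 2 =
  absval xi t * cn v ^+ 2.
Proof.
by rewrite cnM exprMn cn_real real_normK ?num_real// sqr_sqrtr// absval_ge0.
Qed.

(** The two square-integrability conditions add up to the single weight 1 + [absval], because
    [sqrtabs] contributes its square. *)
Lemma HplusP xi x : Hplus mu beta xi x <-> wL2 (wplus xi) x.1.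
Proof.
split => [[/HspaceP[mx i] /HspaceP[_ /= j]]|[mx i]].
  split => //; move: (rintegrableD i j).
  by under eq_fun do rewrite !mul1r cn_sqrtabs -{1}[cn _ ^+ 2]mul1r -mulrDl.
have h : wL2 (wplus xi) x.1 by [].
split; apply/HspaceP.
  apply: (@wL2_le _ _ 1 _ _ _ h) => [|t]; first exact: measurable_cst.
  by rewrite ler01 mul1r lerDl absval_ge0.
split.
  apply: cmeasurableM => //; apply: cmeasurable_real.
  apply: (measurableT_comp (continuous_measurable_fun (@sqrt_continuous R))).
  exact: measurable_absval.
have [_] : wL2 (absval xi) x.1.
  apply: (@wL2_le _ _ 1 _ _ _ h) => [|t]; first exact: measurable_absval.
  by rewrite absval_ge0 mul1r /wplus lerDr ler01.
by under [X in _ -> rintegrable _ X]eq_fun do rewrite mul1r cn_sqrtabs.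
Qed.

Lemma Re_pairing k x : Re (pairing mu beta (fun t => (k t)%:C * x.1 t, x.2) x) =
  beta * cn x.2 ^+ 2 + \int[mu]_t (k t * cn (x.1 t) ^+ 2).
Proof.
rewrite cReD; congr (_ + _); first by rewrite mulrAC mulJc -rmorphM /= mulrC.
by apply: eq_Rintegral => t _; rewrite mulrCA mulJc cReM /= mul0r subr0.
Qed.

Lemma Re_pairing1 x : Re (pairing mu beta x x) =
  beta * cn x.2 ^+ 2 + \int[mu]_t cn (x.1 t) ^+ 2.
Proof.
rewrite cReD; congr (_ + _); first by rewrite mulrAC mulJc -rmorphM /= mulrC.
by apply: eq_Rintegral => t _; rewrite mulJc.
Qed.

Lemma nrm2_H x : nrm2 (Hspace mu beta) x = beta * cn x.2 ^+ 2 + \int[mu]_t cn (x.1 t) ^+ 2.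
Proof. exact: Re_pairing1. Qed.

Lemma nrm2_minus xi x : nrm2 (Hminus mu beta xi) x =
  beta * cn x.2 ^+ 2 + \int[mu]_t (wminus xi t * cn (x.1 t) ^+ 2).
Proof. exact: Re_pairing. Qed.

Lemma nrm2_plus xi x : Hplus mu beta xi x -> nrm2 (Hplus mu beta xi) x =
  beta * cn x.2 ^+ 2 + \int[mu]_t (wplus xi t * cn (x.1 t) ^+ 2).
Proof.
move=> /HplusP h; rewrite /nrm2 (cReD (pairing mu beta x x)) !Re_pairing1.
rewrite [cn (sqrtabs xi x).2]cn0 expr0n mulr0 add0r -addrA.
have h1 : wL2 (fun=> 1) x.1.
  apply: (@wL2_le _ _ 1 _ _ _ h) => [|t]; first exact: measurable_cst.
  by rewrite ler01 mul1r lerDl absval_ge0.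
have h2 : wL2 (absval xi) x.1.
  apply: (@wL2_le _ _ 1 _ _ _ h) => [|t]; first exact: measurable_absval.
  by rewrite absval_ge0 mul1r /wplus lerDr ler01.
congr (_ + _); have [[_ i1] [_ i2]] := (h1, h2).
rewrite (eq_Rintegral _ (fun t _ => cn_sqrtabs xi t (x.1 t))).
rewrite (eq_Rintegral _ (fun t _ => esym (mul1r (cn (x.1 t) ^+ 2)))).
by rewrite -RintegralD//; apply: eq_Rintegral => t _; rewrite -mulrDl.
Qed.

End WeightedSpaces.

(** * Closed graphs of the rigged relations *)

Section Closures.
Context {R : realType} (mu : {measure set R -> \bar R}) (beta : R).
Hypothesis beta0 : 0 <= beta.
Local Notation C := (R[i]^o).
Local Notation V := ((R -> C) * C)%type.
Implicit Types (x y p q : V) (f g F G : R -> C) (k h : R -> R) (xi : option R).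

Lemma ae_eq0_small h : measurable_fun setT h -> (forall t, 0 <= h t) ->
  (forall e, 0 < e -> exists k, [/\ rintegrable mu k, {ae mu, forall t, h t <= k t}
     & \int[mu]_t k t <= e]) ->
  {ae mu, forall t, h t = 0}.
Proof.
move=> mh h0 hk; have mhE : measurable_fun setT (EFin \o h) by exact/measurable_EFinP.
suff /(ae_eq_integral_abs _ measurableT mhE) hae : (\int[mu]_t `|(EFin \o h) t| = 0)%E.
  by apply: filterS hae => t /(_ I)[].
apply/eqP; rewrite eq_le integral_ge0 ?andbT; last by move=> t _; exact: abse_ge0.
apply/lee_addgt0Pr => e e0; rewrite add0e; have [k [ik hlek ke]] := hk e e0.
apply: le_trans (_ : (\int[mu]_t `|(EFin \o k) t| <= _)%E).
  apply: ae_ge0_le_integral => //.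
  - exact: measurableT_comp.
  - by apply: measurableT_comp => //; exact: (measurable_int _ ik).
  by apply: filterS hlek => t hk' _; rewrite /= lee_fin ger0_norm ?h0// (le_trans hk')// ler_norm.
have kk : {ae mu, forall t, `|k t| = k t}.
  by apply: filterS hlek => t hk'; rewrite ger0_norm// (le_trans (h0 t)).
rewrite (_ : (\int[mu]_t _)%E = (\int[mu]_t (k t)%:E)%E).
  by rewrite -(fineK (integrable_fin_num measurableT ik)) lee_fin.
apply: ae_eq_integral => //.
- by apply: measurableT_comp => //; exact: (measurable_int _ ik).
- exact: (measurable_int _ ik).
by apply: filterS kk => t + _ => /= ->.
Qed.

Lemma ae_eq0_of_integral k f : measurable_fun setT k -> (forall t, 0 < k t) ->
  wL2 mu k f -> \int[mu]_t (k t * cn (f t) ^+ 2) = 0 -> {ae mu, forall t, f t = 0}.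
Proof.
move=> mk k0 [mf i] h; have kf0 t : 0 <= k t * cn (f t) ^+ 2 by rewrite mulr_ge0 ?sqr_ge0// ltW.
have : {ae mu, forall t, k t * cn (f t) ^+ 2 = 0}.
  apply: ae_eq0_small => [| |e e0]; [exact: wL2_measurable|exact: kf0|].
  by exists (fun t => k t * cn (f t) ^+ 2); split => //; [exact: aeW|rewrite h ltW].
by apply: filterS => t /eqP; rewrite mulf_eq0 gt_eqF// expf_eq0 /= cn_eq0 => /eqP.
Qed.

(** Multiplication by [s] has a closed graph: F - s G, taken with the weight (1 + |s|)^-2, is
    dominated by the weighted errors of F and G, which can be made arbitrarily small. *)
Lemma closure_ae (s kF kG : R -> R) F G :
  measurable_fun setT s -> measurable_fun setT kF -> measurable_fun setT kG ->
  (forall t, (1 + `|s t|) ^- 2 <= kF t) -> (forall t, s t ^+ 2 / (1 + `|s t|) ^+ 2 <= kG t) ->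
  wL2 mu kF F -> wL2 mu kG G ->
  (forall e, 0 < e -> exists F' G', [/\ wL2 mu kF F', wL2 mu kG G',
     {ae mu, forall t, F' t = (s t)%:C * G' t}, \int[mu]_t (kF t * cn (F t - F' t) ^+ 2) <= e &
     \int[mu]_t (kG t * cn (G t - G' t) ^+ 2) <= e]) ->
  {ae mu, forall t, F t = (s t)%:C * G t}.
Proof.
move=> ms mkF mkG hF hG LF LG appr.
have w0 t : 0 < (1 + `|s t|) ^- 2 by rewrite invr_gt0 exprn_gt0// ltr_wpDr.
have kF0 t : 0 <= kF t by apply: le_trans (hF t); exact: ltW.
have kG0 t : 0 <= kG t by apply: le_trans (hG t); rewrite divr_ge0 ?sqr_ge0.
have mw : measurable_fun setT (fun t => (1 + `|s t|) ^- 2).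
  apply: measurable_inv; apply: measurable_funX; apply: measurable_funD.
    exact: measurable_cst.
  exact: measurableT_comp.
pose X t : C := F t - (s t)%:C * G t.
have mX : cmeasurable X.
  case: LF LG => [mF _] [mG _]; apply: cmeasurableD => //; apply: cmeasurableN.
  by apply: cmeasurableM => //; exact: cmeasurable_real.
have : {ae mu, forall t, (1 + `|s t|) ^- 2 * cn (X t) ^+ 2 = 0}.
  apply: ae_eq0_small => [|t|e e0]; first exact: wL2_measurable.
    by rewrite mulr_ge0 ?sqr_ge0// ltW.
  have e4 : 0 < e / 4 by rewrite divr_gt0.
  have [F' [G' [LF' LG' FG' Fe Ge]]] := appr _ e4.
  have LN k f : wL2 mu k f -> wL2 mu k (fun t => - f t).
    by move=> /(wL2Z (-1)); under eq_fun do rewrite mulN1r.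
  have [_ i1] := wL2D mkF kF0 LF (LN _ _ LF').
  have [_ i2] := wL2D mkG kG0 LG (LN _ _ LG').
  exists (fun t => 2 * (kF t * cn (F t - F' t) ^+ 2) + 2 * (kG t * cn (G t - G' t) ^+ 2)).
  split.
  - by apply: rintegrableD; exact: rintegrableZ.
  - apply: filterS FG' => t FGt.
    have -> : X t = (F t - F' t) + (s t)%:C * (G' t - G t) by rewrite /X FGt; ring.
    apply: le_trans (ler_wpM2l (ltW (w0 t)) (cn_sqrD _ _)) _.
    rewrite mulrDr mulrCA [_ * (2 * cn (_ * _) ^+ 2)]mulrCA; apply: lerD.
      by rewrite ler_pM2l// ler_wpM2r ?sqr_ge0.
    rewrite ler_pM2l// cnM exprMn cn_real real_normK ?num_real// mulrA (cnB (G' t)).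
    by rewrite ler_wpM2r ?sqr_ge0// mulrC.
  rewrite RintegralD//; [|exact: rintegrableZ..].
  rewrite !RintegralZl//; lra.
apply: filterS => t /eqP; rewrite mulf_eq0 gt_eqF//= expf_eq0 /= cn_eq0 /X subr_eq0.
by move/eqP.
Qed.

Lemma beta_cn_ge0 (v : R[i]) : 0 <= beta * cn v ^+ 2.
Proof. by rewrite mulr_ge0 ?sqr_ge0. Qed.

Lemma wint_ge0 k f : (forall t, 0 <= k t) -> 0 <= \int[mu]_t (k t * cn (f t) ^+ 2).
Proof. by move=> k0; apply: Rintegral_ge0 => t _; rewrite mulr_ge0 ?sqr_ge0. Qed.

Lemma wL2B k f g : measurable_fun setT k -> (forall t, 0 <= k t) ->
  wL2 mu k f -> wL2 mu k g -> wL2 mu k (fun t => f t - g t).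
Proof.
move=> mk k0 hf /(wL2Z (-1)) hg; have := wL2D mk k0 hf hg.
by under eq_fun do rewrite mulN1r.
Qed.

Lemma nrm2_H_eq0 x : Hspace mu beta x -> nrm2 (Hspace mu beta) x = 0 ->
  {ae mu, forall t, x.1 t = 0} /\ beta * cn x.2 ^+ 2 = 0.
Proof.
move=> /HspaceP hx; rewrite nrm2_H => h.
have i0 : 0 <= \int[mu]_t cn (x.1 t) ^+ 2 by apply: Rintegral_ge0 => t _; exact: sqr_ge0.
have b0 := beta_cn_ge0 x.2; split; last by lra.
apply: (@ae_eq0_of_integral (fun=> 1)) => //.
under eq_Rintegral do rewrite mul1r.
by lra.
Qed.

(** The clause on beta |f_infty|^2 says that the component at infinity is null as a vector: it is
    zero if beta > 0 and arbitrary if beta = 0. *)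
Lemma Arel_graph (q : V * V) : Arel mu beta q -> [/\ Hspace mu beta q.1, Hspace mu beta q.2,
  {ae mu, forall t, q.2.1 t = t%:C * q.1.1 t} & beta * cn q.1.2 ^+ 2 = 0].
Proof.
move=> [h1 h2 [f [c /= [hu hv n1 n2]]]].
have HB u v : Hspace mu beta u -> Hspace mu beta v -> Hspace mu beta (u - v).
  move=> /(HspaceP mu beta u) Hu /(HspaceP mu beta v) Hv; apply/(HspaceP mu beta (u - v)).
  by apply: wL2B Hu Hv => // _; exact: ler01.
have [a1 b1] := nrm2_H_eq0 (HB _ (f, 0) h1 hu) n1.
have [a2 _] := nrm2_H_eq0 (HB _ (fun t => t%:C * f t, c) h2 hv) n2.
split => //; last by move: b1; rewrite /= subr0.
apply: filterS2 a1 a2 => t /eqP; rewrite subr_eq0 => /eqP -> /eqP.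
by rewrite subr_eq0 => /eqP.
Qed.

Lemma wplus_ge0 xi t : 0 <= wplus xi t :> R. Proof. exact: ltW (wplus_gt0 _ _). Qed.
Lemma wminus_ge0 xi t : 0 <= wminus xi t :> R. Proof. exact: ltW (wminus_gt0 _ _). Qed.

Lemma Hspace_plus_minus xi p q : Hplus mu beta xi p -> Hminus mu beta xi q ->
  forall p' q', Hplus mu beta xi p' -> Hminus mu beta xi q' -> forall e : R,
  nrm2 (Hplus mu beta xi) (p - p') < e -> nrm2 (Hminus mu beta xi) (q - q') < e ->
  [/\ \int[mu]_t (wplus xi t * cn (p.1 t - p'.1 t) ^+ 2) <= e,
      \int[mu]_t (wminus xi t * cn (q.1 t - q'.1 t) ^+ 2) <= e,
      beta * cn (p.2 - p'.2) ^+ 2 <= e & beta * cn (q.2 - q'.2) ^+ 2 <= e].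
Proof.
move=> hp hq p' q' hp' hq' e.
have d1 : Hplus mu beta xi (p - p').
  move: hp hp' => /(HplusP mu beta xi p) Hp /(HplusP mu beta xi p') Hp'.
  apply/(HplusP mu beta xi (p - p')).
  by apply: wL2B Hp Hp'; [exact: measurable_wplus|exact: wplus_ge0].
rewrite nrm2_plus// nrm2_minus /= => n1 n2.
have i1 := wint_ge0 (fun t => p.1 t - p'.1 t) (wplus_ge0 xi).
have i2 := wint_ge0 (fun t => q.1 t - q'.1 t) (wminus_ge0 xi).
have b1 := beta_cn_ge0 (p.2 - p'.2); have b2 := beta_cn_ge0 (q.2 - q'.2).
by split; lra.
Qed.

Lemma beta_cn_approx (v : R[i]) :
  (forall e : R, 0 < e -> exists2 u : R[i], beta * cn u ^+ 2 = 0 & beta * cn (v - u) ^+ 2 <= e) ->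
  beta * cn v ^+ 2 = 0.
Proof.
move=> h; apply/eqP; rewrite eq_le beta_cn_ge0 andbT; apply/ler_addgt0Pr => e e0; rewrite add0r.
have e2 : 0 < e / 2 by rewrite divr_gt0.
have [u u0 uv] := h _ e2.
have := ler_wpM2l beta0 (cn_sqrD (v - u) u); rewrite subrK mulrDr; lra.
Qed.

(** [closure_ae] applies with s = t: the weights (1 + |t|)^-1 of the image and 1 + |t| of the
    argument dominate the two weights required there. *)
Lemma Ainf_graph (p : V * V) : Ainf mu beta p ->
  {ae mu, forall t, p.2.1 t = t%:C * p.1.1 t} /\ beta * cn p.1.2 ^+ 2 = 0.
Proof.
move=> [h1 h2 appr]; split.
  apply: (@closure_ae id (wminus None) (wplus None)) => //.
  - exact: measurable_wminus.
  - exact: measurable_wplus.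
  - move=> t; rewrite /wminus /= -exprVn; have t1 : 0 < 1 + `|t| by rewrite ltr_wpDr.
    by rewrite expr2 ler_piMl ?invr_ge0 ?(ltW t1)// invf_le1// lerDl.
  - move=> t; rewrite /wplus /=; have t1 : 0 < 1 + `|t| by rewrite ltr_wpDr.
    apply: le_trans (_ : 1 <= _); last by rewrite lerDl.
    rewrite ler_pdivrMr ?exprn_gt0// mul1r -real_normK ?num_real//.
    by apply: lerXn2r; rewrite ?nnegrE ?(ltW t1)// lerDr.
  - exact/(HminusP mu beta None p.2).
  - exact/(HplusP mu beta None p.1).
  move=> e e0; have [q [Aq q1 q2 n1 n2]] := appr e e0.
  have [_ _ Aae _] := Arel_graph Aq; exists q.2.1, q.1.1.
  have [i1 i2 _ _] := Hspace_plus_minus h1 h2 q1 q2 n1 n2.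
  by split => //; [exact/(HminusP mu beta None q.2)|exact/(HplusP mu beta None q.1)].
apply: beta_cn_approx => e e0; have [q [Aq q1 q2 n1 n2]] := appr e e0.
have [_ _ _ b0] := Arel_graph Aq; exists q.1.2 => //.
by have [] := Hspace_plus_minus h1 h2 q1 q2 n1 n2.
Qed.

(** Expressed as multiplication by t - x of the second component, since the inverse relation is
    multivalued on functions supported at x, where no division is possible. *)
Lemma Rclos_graph (x : R) (p : V * V) : Rclos mu beta x p ->
  {ae mu, forall t, p.1.1 t = (t - x)%:C * p.2.1 t} /\ beta * cn p.2.2 ^+ 2 = 0.
Proof.
move=> [h1 h2 appr]; split.
  apply: (@closure_ae (fun t => t - x) (wplus (Some x)) (wminus (Some x))) => //.
  - by apply: measurable_funB => //; exact: measurable_cst.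
  - exact: measurable_wplus.
  - exact: measurable_wminus.
  - move=> t; apply: le_trans (_ : 1 <= _); last by rewrite lerDl absval_ge0.
    by rewrite invf_le1 ?exprn_gt0// ?ltr_wpDr// expr_ge1 ?lerDl ?addr_ge0.
  - move=> t; rewrite /wminus /=; have t1 : 0 < 1 + `|t - x| by rewrite ltr_wpDr.
    have [->|tx] := eqVneq (t - x) 0.
      by rewrite expr0n mul0r normr0 invr0 addr0 invr1.
    have tx0 : 0 < `|t - x| by rewrite normr_gt0.
    rewrite -real_normK ?num_real//; set u := `|t - x| in tx0 t1 *.
    rewrite (_ : (1 + u^-1)^-1 = u / (1 + u)); last first.
      by field; rewrite !gt_eqF// addrC.
    rewrite (_ : u ^+ 2 / _ = u / (1 + u) * (u / (1 + u))); last by field; rewrite gt_eqF.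
    rewrite ler_piMl ?divr_ge0 ?(ltW t1) ?(ltW tx0)// ler_pdivrMr// mul1r lerDr//.
  - exact/(HplusP mu beta (Some x) p.1).
  - exact/(HminusP mu beta (Some x) p.2).
  move=> e e0; have [q [Aq q1 q2 n1 n2]] := appr e e0.
  have [_ _ Aae _] := Arel_graph Aq; exists q.1.1, q.2.1.
  have [i1 i2 _ _] := Hspace_plus_minus h1 h2 q1 q2 n1 n2.
  split => //; [exact/(HplusP mu beta (Some x) q.1)|exact/(HminusP mu beta (Some x) q.2)|].
  apply: filterS Aae => t /= ht; rewrite rmorphB mulrBl.
  by apply/eqP; rewrite -subr_eq opprK; apply/eqP.
apply: beta_cn_approx => e e0; have [q [Aq q1 q2 n1 n2]] := appr e e0.
have [_ _ _ b0] := Arel_graph Aq; exists q.2.2 => //.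
by have [] := Hspace_plus_minus h1 h2 q1 q2 n1 n2.
Qed.

End Closures.

(** * The explicit Weyl function *)

Section WeylFunction.
Context {R : realType} (mu : {measure set R -> \bar R}) (beta : R).
Hypothesis beta0 : 0 <= beta.
Local Notation C := (R[i]^o).
Local Notation V := ((R -> C) * C)%type.
Variables (xi : option R) (om : R -> C).
Hypothesis omL : wL2 mu (wminus xi) om.

(** Numerator of the multiplier in the Weyl function: the inverse of I + (x - z) (A - x)^-1
    multiplies by (t - x) / (t - z), and the resolvent used at infinity by 1 / (t - z). *)
Definition kap t : R := if xi is Some x then t - x else 1.

Definition weylM z : C :=
  cintegral mu (fun t => (cn (om t) ^+ 2 * kap t)%:C * (t%:C - z)^-1).

(** For real [xi] the component at infinity lies in ker (A - x)^-1, so the multiplier acts on it as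
    the identity and it contributes [beta]; at infinity it lies in mul A and contributes nothing. *)
Definition weylfun (eta : R) z : C :=
  if xi is Some x then eta%:C + (z - x%:C) * (beta%:C + weylM z) else eta%:C + weylM z.

Lemma measurable_kap : measurable_fun setT kap.
Proof.
rewrite /kap; case: xi => [x|]; last exact: measurable_cst.
by apply: measurable_funB => //; exact: measurable_cst.
Qed.

Lemma measurable_om2 : measurable_fun setT (fun t => cn (om t) ^+ 2).
Proof. by apply: measurable_funX; apply: measurable_cn; case: omL. Qed.

Lemma cmeasurable_om2kap : cmeasurable (fun t => (cn (om t) ^+ 2 * kap t)%:C : C).
Proof.
apply: cmeasurable_real; apply: measurable_funM; first exact: measurable_om2.
exact: measurable_kap.
Qed.

Lemma pairing_om (f : V) : pairing mu beta f (om, 1) =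
  beta%:C * f.2 + cintegral mu (fun t => conjc (om t) * f.1 t).
Proof.
rewrite /pairing; congr (_ * _ + _).
by rewrite (_ : conjc (1 : R[i]) = 1) ?mul1r//; exact: conjc1.
Qed.

(** The uniqueness half: the closed-graph lemmas determine the solution almost everywhere, hence its
    pairing with [om]. *)
Lemma weyl_value l eta m : Im l != 0 -> weyl mu beta xi (om, 1) eta l m ->
  m = weylfun eta l.
Proof.
have [mom _] := omL => l0.
have b2 (v : C) : beta * cn v ^+ 2 = 0 -> beta%:C * v = 0.
  move=> /eqP; rewrite mulf_eq0 expf_eq0 /= cn_eq0 => /orP[|]/eqP ->; first by rewrite mul0r.
  by rewrite mulr0.
have mfin := cmeasurableM cmeasurable_om2kap (cmeasurable_resolvent l).
have fin (f : V) : cmeasurable f.1 ->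
    {ae mu, forall t, f.1 t = (kap t)%:C * om t * (t%:C - l)^-1} ->
    cintegral mu (fun t => conjc (om t) * f.1 t) = weylM l.
  move=> mf fE; apply: ae_cintegral => //.
    by apply: cmeasurableM => //; exact: cmeasurableJ.
  by apply: filterS fE => t ->; rewrite rmorphM /= -mulJc; ring.
rewrite /weyl /weylfun; move: fin; rewrite /kap; case: (xi) => [x|] fin [f].
  move=> [y HR hw ->]; have [h1 h2] := Rclos_graph beta0 HR.
  have [hf hy _] := HR; rewrite pairing_om; congr (_ + _ * (_ + _)).
    have w2 : 1 = f.2 + (x%:C - l) * y.2 by move: hw; case: (f) => ? ?; case: (y) => ? ? [_ ->].
    by rewrite -[f.2](addrK ((x%:C - l) * y.2)) -w2 mulrBr mulr1 mulrCA b2// mulr0 subr0.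
  apply: fin.
    by have [] := (HplusP mu beta (Some x) f).1 hf.
  have w1 t : om t = f.1 t + (x%:C - l) * y.1 t.
    by move: hw; case: (f) => ? ?; case: (y) => ? ? [-> _].
  apply: filterS h1 => t /= ft; have tl := nonreal_sub t l0.
  by rewrite w1 ft rmorphB/=; field.
move=> HA ->; have [h1 h2] := Ainf_graph beta0 HA; have [hf _ _] := HA.
rewrite pairing_om b2// add0r; congr (_ + _); apply: fin.
  by have [] := (HplusP mu beta None f).1 hf.
apply: filterS h1 => t /= ft; have tl := nonreal_sub t l0.
have -> : om t = (t%:C - l) * f.1 t.
  by rewrite mulrBl -ft addrK.
by field.
Qed.

(* The resolvent multiplier, cut off on a null set so that it is bounded. *)
Section GoodPoint.
Variables (l : C) (c : R).
Hypotheses (c0 : 0 < c) (good : {ae mu, forall t : R, c <= cn (t%:C - l)}).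

Definition cutset : set R := [set t : R | c <= cn (t%:C - l)].

Definition cutres t : C := (\1_cutset t)%:C * (t%:C - l)^-1.

Lemma measurable_cutset : measurable cutset.
Proof.
rewrite (_ : cutset = (fun t : R => cn (t%:C - l)) @^-1` `[c, +oo[).
  rewrite -[X in measurable X]setTI; apply: measurable_cn => //.
  by apply: cmeasurableD; [exact: cmeasurable_real|exact: cmeasurable_cst].
by apply/seteqP; split => t /=; rewrite in_itv/= andbT.
Qed.

Lemma cmeasurable_cutres : cmeasurable cutres.
Proof.
apply: cmeasurableM; last exact: cmeasurable_resolvent.
by apply: cmeasurable_real; apply: measurable_indic; exact: measurable_cutset.
Qed.

Lemma ae_cutset : {ae mu, forall t, \1_cutset t = 1 :> R}.
Proof. by apply: filterS good => t ct; rewrite indicE mem_set. Qed.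

Lemma cutres_good : {ae mu, forall t, cutres t = (t%:C - l)^-1 /\ (t%:C - l) * cutres t = 1}.
Proof.
apply: filterS2 good ae_cutset => t ct t1; rewrite /cutres t1 mul1r; split => //.
by rewrite mulfV// -cn_eq0 gt_eqF// (lt_le_trans c0).
Qed.

Lemma cn_cutres_le t : cn (cutres t) <= c^-1.
Proof.
rewrite /cutres indicE; case: (boolP (t \in cutset)) => tc; last first.
  by rewrite mul0r cn0 invr_ge0 ltW.
rewrite mul1r cnV; move: tc; rewrite inE /cutset /mkset => tc.
by rewrite lef_pV2 ?posrE// (lt_le_trans c0).
Qed.

Lemma cutres_growth (x : R) : exists2 K : R, 0 <= K &
  forall t, (1 + `|t - x|) * cn (cutres t) <= K.
Proof.
exists (1 + (1 + cn (l - x%:C)) / c).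
  by rewrite addr_ge0// divr_ge0 ?addr_ge0 ?cn_ge0// ltW.
move=> t; have := cn_cutres_le t; rewrite /cutres indicE.
case: (boolP (t \in cutset)) => tc; last first.
  move=> _; rewrite mul0r cn0 mulr0 addr_ge0// divr_ge0 ?addr_ge0 ?cn_ge0//; exact: ltW.
rewrite mul1r cnV => h; have tl : 0 < cn (t%:C - l).
  by move: tc; rewrite inE /cutset /mkset => /(lt_le_trans c0).
have tx : `|t - x| <= cn (t%:C - l) + cn (l - x%:C).
  by have := cnD (t%:C - l) (l - x%:C); rewrite addrA subrK -rmorphB cn_real.
apply: le_trans (_ : (1 + (cn (t%:C - l) + cn (l - x%:C))) * (cn (t%:C - l))^-1 <= _).
  by rewrite ler_wpM2r ?invr_ge0 ?cn_ge0// lerD2l.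
rewrite addrCA mulrDl mulfV ?gt_eqF// lerD2l ler_wpM2l//.
by rewrite addr_ge0// cn_ge0.
Qed.

(** |om|^2 is integrable only against [wminus]; this bound is what makes |om|^2 times the multiplier
    integrable. *)
Lemma cutres_kap : exists2 K : R, 0 <= K &
  forall t, `|kap t| * cn (cutres t) <= K * wminus xi t.
Proof.
have [K K0 hK] := cutres_growth (odflt 0 xi); exists K => // t; have := hK t.
rewrite /kap /wminus /absval; case: xi => [x|] /=.
  have [->|tx] := eqVneq (t - x) 0.
    by move=> _; rewrite normr0 mul0r invr0 addr0 invr1 mulr1.
  have tx0 : 0 < `|t - x| by rewrite normr_gt0.
  rewrite (_ : (1 + `|t - x|^-1)^-1 = `|t - x| / (1 + `|t - x|)); last first.
    by field; rewrite !gt_eqF// addrC ltr_wpDr.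
  by move=> h; rewrite mulrCA ler_pM2l// ler_pdivlMr ?ltr_wpDr// mulrC.
by rewrite subr0 normr1 mul1r => h; rewrite ler_pdivlMr ?ltr_wpDr// mulrC.
Qed.

Lemma weylM_cutres : weylM l = cintegral mu (fun t => (cn (om t) ^+ 2 * kap t)%:C * cutres t).
Proof.
apply: ae_cintegral.
- by apply: cmeasurableM; [exact: cmeasurable_om2kap|exact: cmeasurable_resolvent].
- by apply: cmeasurableM; [exact: cmeasurable_om2kap|exact: cmeasurable_cutres].
by apply: filterS cutres_good => t [-> _].
Qed.

(** The bounded factor [g] is 1 for the Weyl integral itself and a second cut resolvent for its
    difference quotients. *)
Lemma cintegrable_cutres : exists2 K : R, 0 <= K & forall (g : R -> C) (M : R),
  cmeasurable g -> (forall t, cn (g t) <= M) ->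
  cintegrable mu (fun t => (cn (om t) ^+ 2 * kap t)%:C * cutres t * g t : C) /\
  cn (cintegral mu (fun t => (cn (om t) ^+ 2 * kap t)%:C * cutres t * g t : C)) <= K * M.
Proof.
have [K K0 hK] := cutres_kap; have [_ iom] := omL.
exists (2 * (K * \int[mu]_t (wminus xi t * cn (om t) ^+ 2))).
  rewrite mulr_ge0// mulr_ge0//; apply: Rintegral_ge0 => t _.
  by rewrite mulr_ge0 ?sqr_ge0// ltW// wminus_gt0.
move=> g M mg gM; have iK := rintegrableZ (K * M) iom.
have bnd t : cn ((cn (om t) ^+ 2 * kap t)%:C * cutres t * g t) <=
    K * M * (wminus xi t * cn (om t) ^+ 2).
  rewrite 2!cnM cn_real normrM (ger0_norm (sqr_ge0 _)).
  rewrite [leRHS](_ : _ = cn (om t) ^+ 2 * (K * wminus xi t) * M); last by ring.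
  apply: ler_pM; [|exact: cn_ge0| |exact: gM].
    by apply: mulr_ge0; [apply: mulr_ge0 (normr_ge0 _); exact: sqr_ge0|exact: cn_ge0].
  by rewrite -[leLHS]mulrA; apply: ler_wpM2l => //; exact: sqr_ge0.
have mf : cmeasurable (fun t => (cn (om t) ^+ 2 * kap t)%:C * cutres t * g t : C).
  apply: cmeasurableM => //; apply: cmeasurableM; first exact: cmeasurable_om2kap.
  exact: cmeasurable_cutres.
split; first exact: cintegrable_le iK bnd.
apply: le_trans (cn_cintegral_le mf iK bnd) _.
by rewrite RintegralZl//; set I := Rintegral _ _ _; rewrite le_eqVlt; apply/orP; left; apply/eqP; ring.
Qed.

(** By the resolvent identity the difference is z - l times an integral with two resolvents; on the
    cut set |t - z| >= c / 2 as soon as |z - l| < c / 2. *)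
Lemma weylM_lipschitz : exists2 K : R, 0 <= K & forall z, Im z != 0 -> cn (z - l) < c / 2 ->
  cn (weylM z - weylM l) <= K * cn (z - l).
Proof.
have [K K0 hK] := cintegrable_cutres.
exists (K * (2 / c)) => [|z z0 zl]; first by rewrite mulr_ge0// divr_ge0// ltW.
pose g t : C := (\1_cutset t)%:C * (t%:C - z)^-1.
have mg : cmeasurable g.
  apply: cmeasurableM; last exact: cmeasurable_resolvent.
  by apply: cmeasurable_real; apply: measurable_indic; exact: measurable_cutset.
have gM t : cn (g t) <= 2 / c.
  rewrite /g indicE; case: (boolP (t \in cutset)) => tc; last first.
    by rewrite mul0r cn0 divr_ge0// ltW.
  rewrite mul1r cnV -[2 / c]invf_div lef_pV2 ?posrE ?divr_gt0 ?cn_gt0 ?nonreal_sub//.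
  move: tc; rewrite inE /cutset /mkset => tc.
  by have := cnD (t%:C - z) (z - l); rewrite addrA subrK; lra.
have m1 : cmeasurable (fun=> 1 : C) by exact: cmeasurable_cst.
have le1 (t : R) : cn (1 : C) <= 1 by rewrite cn1.
have [i1 _] := hK _ _ m1 le1; have [i2 b2] := hK _ _ mg gM.
have -> : weylM z = weylM l + (z - l) * cintegral mu
    (fun t => (cn (om t) ^+ 2 * kap t)%:C * cutres t * g t : C).
  rewrite weylM_cutres -cintegralZ//.
  have {}i1 : cintegrable mu (fun t => (cn (om t) ^+ 2 * kap t)%:C * cutres t : C).
    by move: i1; rewrite (_ : (fun t => _) = (fun t => (cn (om t) ^+ 2 * kap t)%:C * cutres t))//;
      apply/funext => t; rewrite mulr1.
  rewrite -cintegralD//; last exact: cintegrableZ.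
  apply: ae_cintegral.
  - by apply: cmeasurableM; [exact: cmeasurable_om2kap|exact: cmeasurable_resolvent].
  - apply: cmeasurableD; first by case: i1.
    by apply: cmeasurableM; [exact: cmeasurable_cst|case: i2].
  apply: filterS2 cutres_good ae_cutset => t [_ t1] t2.
  rewrite /g t2 mul1r; have tz := nonreal_sub t z0.
  have e1 : (t%:C - z)^-1 = cutres t + (z - l) * (cutres t * (t%:C - z)^-1).
    move: (cutres t) t1 => u t1; apply: (mulIf tz); rewrite mulVf// mulrDl -!mulrA mulVf// mulr1.
    by rewrite -[LHS]t1; ring.
  by rewrite {1}e1; ring.
rewrite addrAC subrr add0r cnM mulrC ler_wpM2r ?cn_ge0//.
Qed.

End GoodPoint.

Lemma good_nonreal z : Im z != 0 -> 0 < `|Im z| /\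
  {ae mu, forall t : R, `|Im z| <= cn (t%:C - z)}.
Proof.
by move=> z0; rewrite normr_gt0 z0; split => //; apply: aeW => t; exact: Im_le_cn_sub.
Qed.

Lemma weylfun_continuous eta (l : C) c : 0 < c -> {ae mu, forall t : R, c <= cn (t%:C - l)} ->
  weylfun eta z @[z --> within nonreal (nbhs l)] --> (weylfun eta l : C).
Proof.
move=> c0 good.
have Ml : weylM z @[z --> within nonreal (nbhs l)] --> (weylM l : C).
  have [K K0 hK] := weylM_lipschitz c0 good; apply/cvgC_P => e e0.
  apply/nbhsC_P; exists (Num.min (c / 2) (e / (K + 1))).
    by rewrite lt_min !divr_gt0// ltr_wpDl.
  move=> z; rewrite lt_min => /andP[z1 z2] zn; rewrite /mkset.
  apply: le_lt_trans (hK z zn z1) _; apply: le_lt_trans (_ : (K + 1) * cn (z - l) < e).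
    by rewrite ler_wpM2r ?cn_ge0// lerDl.
  by rewrite mulrC -ltr_pdivlMr// ltr_wpDl.
have idl : z @[z --> within nonreal (nbhs l)] --> (l : C).
  by apply: cvg_trans (@cvg_id _ _); exact: cvg_within.
move: Ml; rewrite /weylfun; case: xi => [x|] Ml; last first.
  by apply: cvgCD; [exact: cvgC_cst|exact: Ml].
apply: cvgCD; first exact: cvgC_cst.
apply: cvgCM; first by apply: cvgCB; [exact: idl|exact: cvgC_cst].
by apply: cvgCD; [exact: cvgC_cst|exact: Ml].
Qed.

(** Identifies [eta] as the nontangential limit of the Weyl function at [xi]. An atom at a real [xi]
    does no harm, because [kap] vanishes there. *)
Lemma weylM_nontangential :
  (if xi is Some x then z - x%:C else 1) * weylM z @[z --> nontangential xi] --> (0 : C).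
Proof.
pose fac z : C := if xi is Some x then z - x%:C else 1.
have mint z : cmeasurable (fun t => (cn (om t) ^+ 2 * kap t)%:C * (t%:C - z)^-1 : C).
  by apply: cmeasurableM; [exact: cmeasurable_om2kap|exact: cmeasurable_resolvent].
have [_ iom] := omL.
have h : cintegral mu (fun t => fac z * ((cn (om t) ^+ 2 * kap t)%:C * (t%:C - z)^-1) : C)
    @[z --> nontangential xi] --> (0 : C).
  apply: nontangential_dct.
  - by move=> z _; apply: cmeasurableM; [exact: cmeasurable_cst|exact: mint].
  (* The constant adds two bounds by (|K| + 1) |t - z| and one by |t - z|; index 1 ensures |z - x| <
     1, or |z| > 1 at infinity. *)
  - move=> K; exists 1%N, (fun t => (2 * `|K| + 3) * (wminus xi t * cn (om t) ^+ 2)).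
    split; first exact: rintegrableZ.
    move=> z t; rewrite !cnM cn_real normrM (ger0_norm (sqr_ge0 _)) cnV => sec.
    suff : cn (fac z) * (`|kap t| / cn (t%:C - z)) <= (2 * `|K| + 3) * wminus xi t.
      move=> hh; rewrite [leRHS](_ : _ = cn (om t) ^+ 2 * ((2 * `|K| + 3) * wminus xi t)); last by ring.
      rewrite [leLHS](_ : _ = cn (om t) ^+ 2 * (cn (fac z) * (`|kap t| / cn (t%:C - z)))); last by ring.
      by rewrite ler_wpM2l ?sqr_ge0.
    have K0 : 0 <= `|K| by [].
    move: sec; rewrite /sector /fac /kap /wminus /absval; case: (xi) => [x|] [sz zs].
      have [z0 _] := sz; have tz : 0 < cn (t%:C - z) by rewrite cn_gt0 nonreal_sub.
      have [->|tx] := eqVneq (t - x) 0.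
        by rewrite normr0 mul0r mulr0 invr0 addr0 invr1 mulr1; lra.
      have tx0 : 0 < `|t - x| by rewrite normr_gt0.
      rewrite (_ : (1 + `|t - x|^-1)^-1 = `|t - x| / (1 + `|t - x|)); last first.
        by field; rewrite !gt_eqF// addrC ltr_wpDr.
      rewrite mulrCA [leRHS]mulrCA ler_pM2l// ler_pdivlMr ?ltr_wpDr// mulrAC ler_pdivrMr//.
      have h1 : cn (z - x%:C) <= (`|K| + 1) * cn (t%:C - z).
        apply: le_trans (stolz_cn_le sz) _; rewrite ler_wpM2l ?addr_ge0//.
        exact: Im_le_cn_sub.
      have h2 : `|t - x| <= cn (t%:C - z) + cn (z - x%:C).
        by have := cnD (t%:C - z) (z - x%:C); rewrite addrA subrK -rmorphB cn_real.
      have z1 : cn (z - x%:C) <= 1.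
        by apply: ltW; apply: lt_trans zs _; rewrite invf_lt1// ltr1n.
      have h3 : cn (z - x%:C) * `|t - x| <= cn (t%:C - z) + cn (z - x%:C).
        by apply: le_trans h2; rewrite ler_piMl.
      by rewrite mulrDr mulr1; lra.
    have [z0 _] := sz; have tz : 0 < cn (t%:C - z) by rewrite cn_gt0 nonreal_sub.
    rewrite cn1 mul1r normr1 mul1r ler_pdivlMr ?ltr_wpDr// mulrC ler_pdivrMr//.
    have h1 : cn z <= (`|K| + 1) * cn (t%:C - z).
      rewrite -[X in cn X <= _]subr0 -[X in cn (z - X) <= _]/((0 : R)%:C).
      apply: le_trans (stolz_cn_le sz) _; rewrite ler_wpM2l ?addr_ge0//.
      exact: Im_le_cn_sub.
    have h2 : `|t| <= cn (t%:C - z) + cn z.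
      by have := cnD (t%:C - z) z; rewrite subrK cn_real.
    by lra.
  - move=> t; rewrite /fac /kap; case: (xi) => [x|].
      have [->|tx] := eqVneq t x.
        apply: (@cvgC_nonreal_eq _ _ (fun=> 0)); last exact: cvgC_cst.
        by move=> z _; rewrite subrr mulr0 mul0r mulr0.
      rewrite -[X in _ --> X](mul0r ((cn (om t) ^+ 2 * (t - x))%:C * (t%:C - x%:C)^-1 : C)).
      apply: cvgCM.
        rewrite -(subrr (x%:C : C)); apply: cvgCB; last exact: cvgC_cst.
        exact: nontangential_id.
      apply: cvgCM; first exact: cvgC_cst.
      by apply: (@nontangential_resolvent _ (Some x)); apply: contra_neqN tx => /eqP[].
    rewrite -[X in _ --> X](mulr0 (1 * (cn (om t) ^+ 2 * 1)%:C : C)).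
    apply: (@cvgC_nonreal_eq _ _ (fun z => 1 * (cn (om t) ^+ 2 * 1)%:C * (t%:C - z)^-1)).
      by move=> z _; rewrite mulrA.
    by apply: cvgCM; [exact: cvgC_cst|exact: (@nontangential_resolvent _ None)].
apply: cvgC_nonreal_eq h => z z0; rewrite cintegralZ//.
have [c0 _] := good_nonreal z0; have [K _ hK] := @cintegrable_cutres z _ c0.
have m1 : cmeasurable (fun=> 1 : C) by exact: cmeasurable_cst.
have le1 (t : R) : cn (1 : C) <= 1 by rewrite cn1.
have [i1 _] := hK _ _ m1 le1.
rewrite (_ : (fun t => _) = (fun t => (cn (om t) ^+ 2 * kap t)%:C * cutres z `|Im z| t * 1))//.
apply/funext => t; rewrite mulr1 /cutres indicE mem_set ?mul1r//.
exact: Im_le_cn_sub.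
Qed.

Lemma weylfun_nontangential eta : weylfun eta z @[z --> nontangential xi] --> (eta%:C : C).
Proof.
have := weylM_nontangential; rewrite /weylfun; case: xi => [x|] h.
  have h2 : eta%:C + ((z - x%:C) * beta%:C + (z - x%:C) * weylM z) @[z --> nontangential (Some x)]
      --> (eta%:C + (0 * beta%:C + 0) : C).
    apply: cvgCD; first exact: cvgC_cst.
    apply: cvgCD; last exact: h.
    apply: cvgCM; last exact: cvgC_cst.
    rewrite -(subrr (x%:C : C)); apply: cvgCB; last exact: cvgC_cst.
    exact: nontangential_id.
  rewrite mul0r !addr0 in h2; apply: cvgC_nonreal_eq h2 => z _.
  by rewrite mulrDr.
have h2 : eta%:C + 1 * weylM z @[z --> nontangential None] --> (eta%:C + 0 : C).
  by apply: cvgCD; [exact: cvgC_cst|exact: h].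
by rewrite addr0 in h2; apply: cvgC_nonreal_eq h2 => z _; rewrite mul1r.
Qed.

End WeylFunction.

(** * Membership in A and its resolvent set *)

Section Realization.
Context {R : realType} (mu : {measure set R -> \bar R}) (beta : R).
Hypothesis beta0 : 0 <= beta.
Local Notation C := (R[i]^o).
Local Notation V := ((R -> C) * C)%type.
Implicit Types (x y p q : V) (f g F G : R -> C) (k h : R -> R) (xi : option R).

Lemma wL2_ae k f g : measurable_fun setT k -> cmeasurable g ->
  {ae mu, forall t, f t = g t} -> wL2 mu k f -> wL2 mu k g.
Proof.
move=> mk mg fg [_ i]; split => //; apply: ae_rintegrable i; first exact: wL2_measurable.
by apply: filterS fg => t ->.
Qed.

Lemma ae_Rintegral h h' : measurable_fun setT h -> measurable_fun setT h' ->
  {ae mu, forall t, h t = h' t} -> \int[mu]_t h t = \int[mu]_t h' t.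
Proof.
move=> mh mh' hh; rewrite /Rintegral; congr fine; apply: ae_eq_integral => //.
- exact/measurable_EFinP.
- exact/measurable_EFinP.
by apply: filterS hh => t + _ => ->.
Qed.

Lemma ae_le_rintegral h h' : rintegrable mu h -> rintegrable mu h' ->
  {ae mu, forall t, h t <= h' t} -> \int[mu]_t h t <= \int[mu]_t h' t.
Proof.
move=> ih ih' hh; have [mh mh'] := (rintegrable_measurable ih, rintegrable_measurable ih').
have mm : measurable_fun setT (fun t => Num.min (h t) (h' t)) by exact: measurable_minr.
rewrite (@ae_Rintegral _ (fun t => Num.min (h t) (h' t)))//; last first.
  by apply: filterS hh => t /min_idPl ->.
apply: le_rintegral => // [|t]; last by rewrite ge_min lexx orbT.
apply: rintegrable_le (rintegrableD (rintegrable_norm ih) (rintegrable_norm ih')) _ => // t.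
by case: (leP (h t) (h' t)) => _; [rewrite lerDl|rewrite lerDr]; exact: normr_ge0.
Qed.

Lemma ae_Rintegral0 h : measurable_fun setT h -> {ae mu, forall t, h t = 0} ->
  \int[mu]_t h t = 0.
Proof.
move=> mh h0; rewrite (ae_Rintegral mh _ h0); last exact: measurable_cst.
by rewrite /Rintegral integral0.
Qed.

Lemma wL2_cn f : wL2 mu (fun=> 1) f -> rintegrable mu (fun t => cn (f t) ^+ 2).
Proof.
move=> [_]; rewrite (_ : (fun t => 1 * _) = (fun t => cn (f t) ^+ 2))//.
by apply/funext => t; rewrite mul1r.
Qed.

Lemma Arel_intro x y : wL2 mu (fun=> 1) x.1 -> wL2 mu (fun=> 1) y.1 -> x.2 = 0 ->
  {ae mu, forall t, y.1 t = t%:C * x.1 t} -> Arel mu beta (x, y).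
Proof.
move=> hx hy x2 xy.
have mt : cmeasurable (fun t => t%:C * x.1 t).
  by apply: cmeasurableM; [exact: cmeasurable_real|case: hx].
have ht : wL2 mu (fun=> 1) (fun t => t%:C * x.1 t).
  by apply: wL2_ae hy => //; exact: measurable_cst.
split; [exact/(HspaceP mu beta x)|exact/(HspaceP mu beta y)|].
exists x.1, y.2 => u v; split; [exact/(HspaceP mu beta u)|exact/(HspaceP mu beta v)|..].
  rewrite nrm2_H /= x2 subrr cn0 expr0n mulr0 add0r; apply: ae_Rintegral0.
    by under eq_fun do rewrite subrr cn0 expr0n; exact: measurable_cst.
  by apply: aeW => t; rewrite subrr cn0 expr0n.
rewrite nrm2_H /= subrr cn0 expr0n mulr0 add0r; apply: ae_Rintegral0.
  apply: measurable_funX; apply: measurable_cn; apply: cmeasurableD; first by case: hy.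
  exact: cmeasurableN.
apply: filterS xy => t; rewrite /= => xyt.
by rewrite -[X in cn X]/(y.1 t - t%:C * x.1 t) xyt subrr cn0 expr0n.
Qed.

Lemma wint_tail k f (s : R -> R) : measurable_fun setT k -> (forall t, 0 <= k t) ->
  measurable_fun setT s -> wL2 mu k f -> forall e, 0 < e -> exists n : nat,
  forall m : nat, (n <= m)%N ->
  \int[mu]_t (k t * cn (f t - f t * (\1_[set t | s t <= m%:R] t)%:C) ^+ 2) < e.
Proof.
move=> mk k0 ms [mf i] e e0.
have mI (m : nat) : measurable_fun setT (\1_[set t | s t <= m%:R] : R -> R).
  apply: measurable_indic; rewrite (_ : [set t | _] = s @^-1` `]-oo, m%:R]).
    by rewrite -[X in measurable X]setTI; exact: ms.
  by apply/seteqP; split => t /=; rewrite in_itv.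
pose tail (m : nat) t : R := k t * cn (f t - f t * (\1_[set t | s t <= m%:R] t)%:C) ^+ 2.
have tail0 m t : s t <= m%:R -> tail m t = 0.
  by move=> tm; rewrite /tail indicE mem_set//= mulr1 subrr cn0 expr0n mulr0.
have tail_le m t : 0 <= tail m t <= k t * cn (f t) ^+ 2.
  rewrite mulr_ge0 ?sqr_ge0//= /tail; apply: ler_wpM2l => //.
  rewrite indicE; case: (_ \in _); rewrite ?mulr1 ?subrr ?mulr0 ?subr0//.
  by rewrite cn0 expr0n sqr_ge0.
have mtail m : measurable_fun setT (tail m).
  apply: wL2_measurable => //; apply: cmeasurableD => //; apply: cmeasurableN.
  by apply: cmeasurableM => //; exact: cmeasurable_real.
(* [dominated_small] takes complex parameters: the cutoff levels are embedded in C and recovered by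
   truncating the real part. *)
pose U (n : nat) : set C := [set z | exists2 m : nat, (n <= m)%N & z = (m%:R : R)%:C].
have [] // := @dominated_small R mu U (fun z t => (tail (Num.Def.trunc (Re z)) t)%:C)
    (fun t => k t * cn (f t) ^+ 2) _ _ i _ _ e e0.
- by move=> n m nm z [j mj ->]; exists j => //; exact: leq_trans mj.
- by move=> z _; exact: cmeasurable_real.
- by move=> z t _; rewrite cn_real; have /andP[? ?] := tail_le (Num.Def.trunc (Re z)) t; rewrite ger0_norm.
- move=> t d d0; exists (Num.Def.trunc `|s t|).+1 => z [j tj ->]; rewrite tail0 ?cn0//.
  rewrite /= natrK; apply: le_trans (ler_norm _) _; apply: ltW.
  apply: lt_le_trans (truncnS_gt _) _; by rewrite ler_nat.
move=> n hn; exists n => m nm.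
have := hn _ (ex_intro2 _ _ m nm erefl).
rewrite -[Re _]/(m%:R : R) natrK => h; apply: le_lt_trans h.
exact: le_trans (ler_norm _) (Re_le_cn (cintegral mu (fun t => (tail m t)%:C))).
Qed.

(** Division by t - l is bounded by 1 / |Im l|. The preimage has component 0 at infinity, since that
    component of the image is absorbed by mul A. *)
Lemma resolvent_nonreal (l : C) : Im l != 0 -> resolvent_set (Hspace mu beta) (Arel mu beta) l.
Proof.
move=> l0; have [c0 good] := good_nonreal mu l0; set c := `|Im l| in c0 good.
have m1 : measurable_fun [set: R] (fun=> 1 : R) by exact: measurable_cst.
split=> [y /(HspaceP mu beta y) hy|].
  have hx : wL2 mu (fun=> 1) (fun t => y.1 t * cutres l c t).
    apply: (@wL2_mul _ _ _ _ (c^-1 ^+ 2) _ _ _ _ _ _ hy) => [//|||t].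
    - exact: cmeasurable_cutres.
    - by move=> _; exact: ler01.
    rewrite mul1r mulr1; apply: lerXn2r; rewrite ?nnegrE ?cn_ge0// ?invr_ge0 ?(ltW c0)//.
    exact: cn_cutres_le.
  exists (fun t => y.1 t * cutres l c t, 0); apply: Arel_intro => //.
    by apply: wL2D => //; exact: wL2Z.
  apply: filterS (cutres_good c0 good) => t [_ t1] /=.
  have -> : t%:C * (y.1 t * cutres l c t) =
    y.1 t * ((t%:C - l) * cutres l c t) + l * (y.1 t * cutres l c t) by ring.
  by rewrite t1 mulr1.
exists (c^-1 ^+ 2) => x y /(Arel_graph beta0) [/(HspaceP mu beta x) hx hyx yx b0].
have hy : wL2 mu (fun=> 1) y.1.
  move: hyx => /(HspaceP mu beta (y + l *: x)) hyx.
  have := wL2B m1 (fun=> ler01) hyx (wL2Z l hx).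
  by rewrite (_ : (fun t => _) = y.1)//; apply/funext => t; exact: addrK.
have xy : {ae mu, forall t, x.1 t = y.1 t * (t%:C - l)^-1}.
  apply: filterS yx => t /= yt; have tl := nonreal_sub t l0.
  have {}yt : y.1 t + l * x.1 t = t%:C * x.1 t by [].
  by apply: (mulIf tl); rewrite mulfVK// mulrBr [_ * t%:C]mulrC -yt [_ * l]mulrC addrK.
have my : cmeasurable (fun t => y.1 t * (t%:C - l)^-1).
  by apply: cmeasurableM; [case: hy|exact: cmeasurable_resolvent].
rewrite !nrm2_H b0 add0r (@ae_Rintegral _ (fun t => cn (y.1 t * (t%:C - l)^-1) ^+ 2)).
- apply: le_trans (_ : \int[mu]_t (c^-1 ^+ 2 * cn (y.1 t) ^+ 2) <= _).
    have iy := wL2_cn hy; have bnd t : cn (y.1 t * (t%:C - l)^-1) ^+ 2 <= c^-1 ^+ 2 * cn (y.1 t) ^+ 2.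
      rewrite cnM exprMn mulrC ler_wpM2r ?sqr_ge0// cnV.
      apply: lerXn2r; rewrite ?nnegrE ?invr_ge0 ?cn_ge0 ?(ltW c0)//.
      by rewrite lef_pV2 ?posrE ?cn_gt0 ?nonreal_sub//; exact: Im_le_cn_sub.
    apply: (le_rintegral _ (rintegrableZ _ iy) bnd).
    apply: rintegrable_le (rintegrableZ (c^-1 ^+ 2) iy) _.
      by apply: measurable_funX; exact: measurable_cn.
    by move=> t; rewrite (ger0_norm (sqr_ge0 _)); exact: bnd.
  rewrite RintegralZl//; last exact: wL2_cn.
  by apply: ler_wpM2l; [exact: sqr_ge0|rewrite lerDr beta_cn_ge0].
- by apply: measurable_funX; apply: measurable_cn; case: hx.
- by apply: measurable_funX; exact: measurable_cn.
by apply: filterS xy => t ->.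
Qed.

Lemma admissible_irho : admissible mu beta -> rintegrable mu rho.
Proof.
move=> [_ adm]; apply/integrableP; split.
  by apply/measurable_EFinP; exact: measurable_rho.
rewrite (_ : (fun t => _) = (fun t : R => ((1 + t ^+ 2)^-1)%:E))//.
by apply/funext => t; rewrite abse_EFin ger0_norm// ltW// rho_gt0.
Qed.

(** Tested on the indicator y of the points closer than c to x0: its preimage x satisfies |y| <= c
    |x|, so the squared norm of y is at most c^2 M times itself, and c^2 M < 1 makes y null. *)
Lemma resolvent_real_good (x0 : R) : admissible mu beta ->
  resolvent_set (Hspace mu beta) (Arel mu beta) x0%:C ->
  exists2 c : R, 0 < c & {ae mu, forall t : R, c <= cn (t%:C - x0%:C)}.
Proof.
move=> adm [surj [M bnd]]; pose c := (`|M| + 2)^-1.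
have c0 : 0 < c by rewrite invr_gt0 ltr_wpDl.
exists c => //; pose B := [set t : R | cn (t%:C - x0%:C) < c].
have mB : measurable B.
  rewrite (_ : B = (fun t : R => cn (t%:C - x0%:C)) @^-1` `]-oo, c[).
    rewrite -[X in measurable X]setTI; apply: measurable_cn => //.
    by apply: cmeasurableD; [exact: cmeasurable_real|exact: cmeasurable_cst].
  by apply/seteqP; split => t /=; rewrite in_itv.
have irho := admissible_irho adm.
have iB : rintegrable mu (fun t => cn ((\1_B t)%:C : C) ^+ 2).
  apply: rintegrable_le (rintegrableZ (1 + (`|x0| + c) ^+ 2) irho) _.
    apply: measurable_funX; apply: measurable_cn; apply: cmeasurable_real.
    exact: measurable_indic.
  move=> t; rewrite cn_real indicE; case: (boolP (t \in B)) => tB /=; last first.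
    rewrite !normr0 expr0n normr0 mulr_ge0 ?addr_ge0 ?sqr_ge0//.
    by rewrite ltW// rho_gt0.
  rewrite !normr1 expr1n normr1 /rho -[_^-1]/(1 + t ^+ 2)^-1 ler_pdivlMr ?ltr_wpDr ?sqr_ge0// mul1r.
  rewrite lerD2l -real_normK ?num_real//; apply: lerXn2r; rewrite ?nnegrE ?addr_ge0// ?(ltW c0)//.
  move: tB; rewrite inE /B /mkset -rmorphB cn_real => tB.
  by have := ler_normD (t - x0) x0; rewrite subrK; lra.
have yL : wL2 mu (fun=> 1) (fun t => (\1_B t)%:C).
  split; first by apply: cmeasurable_real; exact: measurable_indic.
  by rewrite (_ : (fun t => _) = (fun t => cn ((\1_B t)%:C : C) ^+ 2))//; apply/funext => t; rewrite mul1r.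
pose y : V := (fun t => (\1_B t)%:C, 0).
have [x xy] := surj y ((HspaceP mu beta y).2 yL).
have := bnd _ _ xy; move: xy => /(Arel_graph beta0) [/(HspaceP mu beta x) hx _ /= yx b0].
rewrite !nrm2_H b0 add0r -[y.2]/(0 : C) cn0 expr0n mulr0 add0r => xM.
set I := (\int[mu]_t cn (\1_B t)%:C ^+ 2) in xM.
have I0 : 0 <= I by apply: Rintegral_ge0 => t _; exact: sqr_ge0.
have xB : {ae mu, forall t, cn ((\1_B t)%:C) ^+ 2 <= c ^+ 2 * cn (x.1 t) ^+ 2}.
  apply: filterS yx => t yt.
  have {}yt : (\1_B t)%:C + x0%:C * x.1 t = t%:C * x.1 t by [].
  have -> : ((\1_B t)%:C : C) = (\1_B t)%:C * ((t%:C - x0%:C) * x.1 t).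
    rewrite mulrBl -yt addrK -rmorphM indicE; case: (_ \in _); by rewrite ?mulr1 ?mulr0.
  rewrite !cnM !exprMn cn_real indicE; case: (boolP (t \in B)) => tB /=; last first.
    by rewrite normr0 expr0n mul0r mulr_ge0 ?sqr_ge0.
  rewrite normr1 expr1n mul1r ler_wpM2r ?sqr_ge0//; apply: lerXn2r; rewrite ?nnegrE ?cn_ge0 ?(ltW c0)//.
  by move: tB; rewrite inE => /ltW.
have : I <= c ^+ 2 * \int[mu]_t cn (x.1 t) ^+ 2.
  rewrite -RintegralZl//; last exact: wL2_cn.
  by apply: ae_le_rintegral => //; apply: rintegrableZ; exact: wL2_cn.
move/le_trans => /(_ _ (ler_wpM2l (sqr_ge0 c) xM)); rewrite mulrA => IM.
have cM : c ^+ 2 * M < 1.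
  apply: le_lt_trans (_ : c ^+ 2 * `|M| < 1); first by rewrite ler_wpM2l ?sqr_ge0 ?ler_norm.
  rewrite /c exprVn mulrC ltr_pdivrMr ?exprn_gt0 ?ltr_wpDl// mul1r.
  by have := normr_ge0 M; nra.
have I00 : I = 0 by nra.
have : {ae mu, forall t, ((\1_B t)%:C : C) = 0}.
  apply: (@ae_eq0_of_integral _ _ (fun=> 1)) => //.
  by under eq_Rintegral do rewrite mul1r.
apply: filterS => t; rewrite indicE; case: (boolP (t \in B)) => tB.
  by move=> /complexI /= /eqP; rewrite oner_eq0.
by move=> _; rewrite leNgt; apply: contraNN tB => tB; rewrite inE.
Qed.

End Realization.

(** * Existence of the Weyl value by truncation *)

Section WeylExistence.
Context {R : realType} (mu : {measure set R -> \bar R}) (beta : R).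
Hypothesis beta0 : 0 <= beta.
Local Notation C := (R[i]^o).
Local Notation V := ((R -> C) * C)%type.
Implicit Types (x y p q : V) (f g F G : R -> C) (k h : R -> R).
Variable xi : option R.

(** On the set where [absval] is at most n the weights are comparable to 1, so the truncations lie
    in the Hilbert space. One common cutoff for F and G preserves a multiplication relation between
    them. *)
Lemma truncation F G e : wL2 mu (wplus xi) F -> wL2 mu (wminus xi) G -> 0 < e ->
  exists h : R -> R, let F' t := F t * (h t)%:C in let G' t := G t * (h t)%:C in
  [/\ wL2 mu (fun=> 1) F', wL2 mu (fun=> 1) G', wL2 mu (wplus xi) F' /\ wL2 mu (wminus xi) G',
    \int[mu]_t (wplus xi t * cn (F t - F' t) ^+ 2) < e &
    \int[mu]_t (wminus xi t * cn (G t - G' t) ^+ 2) < e].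
Proof.
move=> hF hG e0; have ms := @measurable_absval R xi.
have [n1 N1] := wint_tail (measurable_wplus xi) (wplus_ge0 xi) ms hF e0.
have [n2 N2] := wint_tail (measurable_wminus xi) (wminus_ge0 xi) ms hG e0.
pose n := maxn n1 n2; pose B := [set t : R | absval xi t <= n%:R].
have mB : measurable_fun setT (\1_B : R -> R).
  apply: measurable_indic; rewrite (_ : B = absval xi @^-1` `]-oo, n%:R]).
    by rewrite -[X in measurable X]setTI; exact: ms.
  by apply/seteqP; split => t /=; rewrite in_itv.
have B01 t : cn ((\1_B t)%:C : C) ^+ 2 <= 1.
  by rewrite cn_real indicE; case: (_ \in _); rewrite /= ?normr1 ?normr0 ?expr1n ?expr0n.
have m1 : measurable_fun [set: R] (fun=> 1 : R) by exact: measurable_cst.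
have cB := cmeasurable_real mB.
exists (\1_B); split => //.
- apply: (@wL2_mul _ _ (wplus xi) _ 1) => // t; rewrite ?ler01// !mul1r.
  by apply: le_trans (B01 t) _; rewrite /wplus lerDl absval_ge0.
- apply: (@wL2_mul _ _ (wminus xi) _ (1 + n%:R)) => // t; rewrite ?ler01// mul1r.
  rewrite cn_real indicE; case: (boolP (t \in B)) => tB /=.
    rewrite normr1 expr1n /wminus ler_pdivlMr ?mul1r ?ltr_wpDr ?absval_ge0// lerD2l.
    by move: tB; rewrite inE.
  by rewrite normr0 expr0n mulr_ge0 ?wminus_ge0.
- have mwp := @measurable_wplus R xi; have mwm := @measurable_wminus R xi.
  split; [apply: (@wL2_mul _ _ (wplus xi) _ 1)|apply: (@wL2_mul _ _ (wminus xi) _ 1)] => // t.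
  + exact: wplus_ge0.
  + by rewrite mul1r ler_piMr ?wplus_ge0.
  + exact: wminus_ge0.
  by rewrite mul1r ler_piMr ?wminus_ge0.
- by apply: N1; rewrite leq_maxl.
- by apply: N2; rewrite leq_maxr.
Qed.

Variable om : R -> C.
Hypothesis omL : wL2 mu (wminus xi) om.

(** The existence half: the formal solution lies in the rigged spaces, its truncations lie in the
    unclosed relation, and they converge in both norms. *)
Lemma weyl_exists eta (l : C) c : 0 < c -> {ae mu, forall t : R, c <= cn (t%:C - l)} ->
  weyl mu beta xi (om, 1) eta l (weylfun mu beta xi om eta l).
Proof.
move=> c0 good; have [mom _] := omL.
have mcut := cmeasurable_cutres l c.
have cutL : wL2 mu (wminus xi) (fun t => om t * cutres l c t).
  apply: (@wL2_mul _ _ (wminus xi) _ (c^-1 ^+ 2)) => // [|t|t].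
  - exact: measurable_wminus.
  - exact: wminus_ge0.
  rewrite mulrC ler_wpM2r ?wminus_ge0//; apply: lerXn2r; rewrite ?nnegrE ?cn_ge0//.
    by rewrite invr_ge0 ltW.
  exact: cn_cutres_le.
(* By [cutres_kap] the squared multiplier is at most (K wminus)^2, and wplus wminus = 1 leaves K^2
   wminus. *)
have kapL : wL2 mu (wplus xi) (fun t => om t * ((kap xi t)%:C * cutres l c t)).
  have [K K0 hK] := cutres_kap xi l c0.
  apply: (@wL2_mul _ _ (wminus xi) _ (K ^+ 2)) => // [||t|t].
  - exact: measurable_wplus.
  - by apply: cmeasurableM => //; apply: cmeasurable_real; exact: measurable_kap.
  - exact: wplus_ge0.
  have h : (`|kap xi t| * cn (cutres l c t)) ^+ 2 <= (K * wminus xi t) ^+ 2.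
    apply: lerXn2r (hK t); rewrite ?nnegrE.
      by apply: mulr_ge0 (normr_ge0 _) (cn_ge0 _).
    by rewrite mulr_ge0 ?wminus_ge0.
  rewrite cnM cn_real; apply: le_trans (ler_wpM2l (wplus_ge0 xi t) h) _.
  rewrite exprMn mulrCA /wminus /wplus expr2 mulVKf ?gt_eqF// ?ltr_wpDr ?absval_ge0//.
have m1 : measurable_fun [set: R] (fun=> 1 : R) by exact: measurable_cst.
have mwp := @measurable_wplus R xi; have mwm := @measurable_wminus R xi.
have value f : cmeasurable f ->
    {ae mu, forall t, f t = om t * ((kap xi t)%:C * cutres l c t)} ->
    cintegral mu (fun t => conjc (om t) * f t) = weylM mu xi om l.
  move=> mf fE; apply: ae_cintegral.
  - by apply: cmeasurableM => //; exact: cmeasurableJ.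
  - apply: cmeasurableM; last exact: cmeasurable_resolvent.
    apply: cmeasurable_real; apply: measurable_funM; last exact: measurable_kap.
    by apply: measurable_funX; exact: measurable_cn.
  apply: filterS2 fE (cutres_good c0 good) => t -> [<- _].
  by rewrite rmorphM /= -mulJc; ring.
have small p q h e : p.2 = q.2 -> q.1 = (fun t => p.1 t * (h t)%:C) ->
    forall k, \int[mu]_t (k t * cn (p.1 t - p.1 t * (h t)%:C) ^+ 2) < e ->
    beta * cn (p - q).2 ^+ 2 + \int[mu]_t (k t * cn ((p - q).1 t) ^+ 2) < e.
  move=> pq2 pq1 k; rewrite -[(p - q).2]/(p.2 - q.2) pq2 subrr cn0 expr0n mulr0 add0r.
  by rewrite -[(p - q).1]/(fun t => p.1 t - q.1 t) pq1.
rewrite /weyl /weylfun; case E : xi => [x|].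
  (* Written this way, and not as om kap / (t - l), because [rIadd] requires om = F + (x - l) G as
     an identity of functions; the multiplier form holds only almost everywhere. *)
  pose F t : C := om t - (x%:C - l) * (om t * cutres l c t).
  have mF : cmeasurable F.
    apply: cmeasurableD => //; apply: cmeasurableN; apply: cmeasurableM; first exact: cmeasurable_cst.
    exact: cmeasurableM.
  have FE : {ae mu, forall t, F t = om t * ((kap xi t)%:C * cutres l c t)}.
    apply: filterS (cutres_good c0 good) => t [_ t1].
    rewrite /F E /kap rmorphB; apply/esym/eqP; rewrite eq_sym subr_eq; apply/eqP.
    rewrite [RHS](_ : _ = om t * ((t%:C - l) * cutres l c t)); last by ring.
    by rewrite t1 mulr1.
  have FL : wL2 mu (wplus xi) F.
    by apply: wL2_ae kapL => //; apply: filterS FE => t ->.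
  exists (F, 1); last first.
    by rewrite pairing_om mulr1 value// E.
  exists (fun t => om t * cutres l c t, 0); last first.
    congr pair; last by rewrite /= scaler0 addr0.
    by apply/funext => t; rewrite /F; apply/esym; exact: subrK.
  split; [by rewrite -E; apply/(HplusP mu beta)|by rewrite -E; apply/(HminusP mu beta)|].
  move=> e e0; have [h [h1 h2 [h3 h4] h5 h6]] := truncation FL cutL e0.
  set F' := fun t => F t * _ in h1 h3 h5; set G' := fun t => _ * (h t)%:C in h2 h4 h6.
  rewrite -E; exists ((F', 1), (G', 0)); split.
  - apply: (@Arel_intro _ _ _ (G', 0) ((F', 1) + x%:C *: (G', 0) : V)) => //.
      by apply: wL2D => //; exact: wL2Z.
    apply: filterS (cutres_good c0 good) => t [_ t1] /=.
    rewrite -[LHS]/(F' t + x%:C * G' t) /F' /G' /F.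
    rewrite [RHS](_ : _ = ((t%:C - l) * cutres l c t * om t - (x%:C - l) * (om t * cutres l c t)) * (h t)%:C + x%:C * (om t * cutres l c t * (h t)%:C)); last by ring.
    by rewrite t1 mul1r.
  - exact/(HplusP mu beta xi (F', 1)).
  - exact/(HminusP mu beta xi (G', 0)).
  - rewrite nrm2_plus; first by apply: (small (F, 1) (F', 1)) h5.
    by apply/(HplusP mu beta xi ((F, 1) - (F', 1))); apply: wL2B FL h3 => //; exact: wplus_ge0.
  by rewrite nrm2_minus; apply: (small (_, 0) (_, 0)) h6.
(* As above, the image must equal om + l f exactly, so it is not written as t f. *)
pose G t : C := om t + l * (om t * cutres l c t).
have kap1 t : om t * ((kap xi t)%:C * cutres l c t) = om t * cutres l c t.
  by rewrite E /kap mul1r.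
have FL : wL2 mu (wplus xi) (fun t => om t * cutres l c t).
  by move: kapL; rewrite (_ : (fun t => _) = (fun t => om t * cutres l c t))//; exact/funext.
have GL : wL2 mu (wminus xi) G.
  by apply: wL2D => //; [exact: wminus_ge0|exact: wL2Z].
exists (fun t => om t * cutres l c t, 0); last first.
  rewrite pairing_om mulr0 add0r value ?E//; first exact: cmeasurableM.
  by apply: aeW => t; rewrite -{1}E kap1.
split; [by rewrite -E; apply/(HplusP mu beta)| |].
  by rewrite -E; apply/(HminusP mu beta).
move=> e e0; have [h [h1 h2 [h3 h4] h5 h6]] := truncation FL GL e0.
set F' := fun t => _ * cutres l c t * (h t)%:C in h1 h3 h5; set G' := fun t => _ * _ in h2 h4 h6.
rewrite -E; exists ((F', 0), (G', 1)); split.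
- apply: (@Arel_intro _ _ _ (F', 0) (G', 1)) => //.
  apply: filterS (cutres_good c0 good) => t [_ t1]; rewrite /= /F' /G' /G.
  rewrite [RHS](_ : _ = (om t * ((t%:C - l) * cutres l c t) + l * (om t * cutres l c t)) * (h t)%:C); last by ring.
  by rewrite t1 mulr1.
- exact/(HplusP mu beta xi (F', 0)).
- exact/(HminusP mu beta xi (G', 1)).
- rewrite nrm2_plus; first by apply: (small (_, 0) (F', 0)) h5.
  by apply/(HplusP mu beta xi ((_, 0) - (F', 0))); apply: wL2B FL h3 => //; exact: wplus_ge0.
rewrite nrm2_minus; apply: (small (G, _) (G', 1)) h6 => //.
by rewrite -[LHS]/(1 + l * 0) mulr0 addr0.
Qed.

Lemma weylfun_realized eta (F : C -> C) : admissible mu beta ->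
  (forall z, Im z != 0 -> F z = weylfun mu beta xi om eta z) ->
  realized F (triplet mu beta xi (om, 1) eta).
Proof.
move=> adm FE l /= hl.
have [c c0 good] : exists2 c : R, 0 < c & {ae mu, forall t : R, c <= cn (t%:C - l)}.
  have [l0|l0] := eqVneq (Im l) 0; last first.
    by have [c0 good] := good_nonreal mu l0; exists `|Im l|.
  have lE : l = (Re l)%:C by apply: complex_ext.
  have [|c c0 good] := resolvent_real_good beta0 (x0 := Re l) adm; first by rewrite -lE.
  by exists c => //; rewrite lE.
exists (weylfun mu beta xi om eta l); first exact: weyl_exists c0 good.
split => [l0|]; first exact: FE.
apply: (@cvgC_near_eq R (within nonreal (nbhs l)) _ (weylfun mu beta xi om eta)); last first.
  exact: weylfun_continuous c0 good.
apply: (@filterS _ (within nonreal (nbhs l)) _ nonreal) => [z z0|]; first by rewrite /mkset FE.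
exact: withinT.
Qed.

End WeylExistence.

(** * Weyl functions as Cauchy transforms *)

Section WeylCauchy.
Context {R : realType} (mu : {measure set R -> \bar R}) (beta : R).
Local Notation C := (R[i]^o).
Variables (xi : option R) (om : R -> C) (g : R -> R).
Hypotheses (omL : wL2 mu (wminus xi) om) (kg : kdensity mu g)
  (omg : {ae mu, forall t, kap xi t ^+ 2 * cn (om t) ^+ 2 = g t}).

Lemma cintegrable_weyl z : Im z != 0 ->
  cintegrable mu (fun t => (cn (om t) ^+ 2 * kap xi t)%:C * (t%:C - z)^-1 : C).
Proof.
move=> z0; have [c0 _] := good_nonreal mu z0.
have [K _ hK] := cintegrable_cutres omL z c0.
have m1 : cmeasurable (fun=> 1 : C) by exact: cmeasurable_cst.
have le1 (t : R) : cn (1 : C) <= 1 by rewrite cn1.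
have [i1 _] := hK _ _ m1 le1; move: i1.
rewrite (_ : (fun t => _) = (fun t => (cn (om t) ^+ 2 * kap xi t)%:C * (t%:C - z)^-1))//.
apply/funext => t; rewrite mulr1 /cutres indicE mem_set ?mul1r//.
exact: Im_le_cn_sub.
Qed.

(** Since (z - x) (t - x) / (t - z) = (t - x)^2 (1 / (t - z) - 1 / (t - x)), the Weyl integrand and
    that of the Cauchy transform of [g] differ by a function of t alone, whose integral is part of
    [d]. *)
Lemma weyl_cauchy : exists d : R, forall eta z, Im z != 0 ->
  weylfun mu beta xi om eta z =
  (eta + d)%:C + (if xi is Some _ then beta else 0)%:C * z + kint mu g z.
Proof.
pose fac z : C := if xi is Some x then z - x%:C else 1.
pose dif t : R := g t * (t * rho t - if xi is Some x then (t - x)^-1 else 0).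
have [mg _] := kg.
have mdif : measurable_fun setT dif.
  apply: measurable_funM => //; apply: measurable_funB.
    by apply: measurable_funM => //; exact: measurable_rho.
  case: xi => [x|]; last exact: measurable_cst.
  by apply: measurable_inv; apply: measurable_funB => //; exact: measurable_cst.
have split z : Im z != 0 -> {ae mu, forall t,
    fac z * ((cn (om t) ^+ 2 * kap xi t)%:C * (t%:C - z)^-1) = (g t)%:C * kernel t z + (dif t)%:C}.
  move=> z0; apply: filterS omg => t; rewrite /fac /dif /kernel /kap => <-.
  have tz := nonreal_sub t z0; move: (rho t) (cn (om t) ^+ 2) => p q.
  case: (xi) => [x|]; last by rewrite subr0 !rmorphM/=; ring.
  have [->|tx] := eqVneq t x.
    by rewrite subrr mulr0 mul0r expr0n !mul0r mulr0 add0r.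
  have tx0 : t - x != 0 by rewrite subr_eq0.
  have txC : t%:C - x%:C != 0 :> R[i] by rewrite -rmorphB fmorph_eq0.
  rewrite [X in _ = _ + X%:C](_ : _ = (t - x) ^+ 2 * q * (t * p) - q * (t - x)); last by field.
  by rewrite !(rmorphM, rmorphB, rmorphXn)/=; field.
(* Integrable as the difference of two integrable functions at the single point z = i. *)
have idif : cintegrable mu (fun t => (dif t)%:C : C).
  have i0 : Im (0 +i* 1 : R[i]) != 0 by rewrite oner_eq0.
  have j1 := cintegrableZ (fac (0 +i* 1)) (cintegrable_weyl i0).
  have j2 := cintegrableZ (-1) (cintegrable_kint i0 kg).
  have [_ j3] := cintegrableD j1 j2.
  split; first exact: cmeasurable_real.
  apply: ae_rintegrable j3; first by apply: measurable_cn; exact: cmeasurable_real.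
  by apply: filterS (split _ i0) => t ->; rewrite mulN1r addrAC subrr add0r.
exists ((if xi is Some x then - (beta * x) else 0) + \int[mu]_t dif t) => eta z z0.
have -> : weylfun mu beta xi om eta z = eta%:C + (if xi is Some x then (z - x%:C) * beta%:C else 0) +
    fac z * weylM mu xi om z.
  rewrite /weylfun /fac; case: (xi) => [x|]; last by rewrite addr0 mul1r.
  by rewrite mulrDr addrA.
have -> : fac z * weylM mu xi om z = kint mu g z + (\int[mu]_t dif t)%:C.
  rewrite -cintegralZ; last exact: cintegrable_weyl.
  have -> : (\int[mu]_t dif t)%:C = cintegral mu (fun t => (dif t)%:C : C).
    by apply: complex_ext => //=; rewrite Rintegral_cst// mul0r.
  rewrite -cintegralD//; last exact: cintegrable_kint.
  apply: ae_cintegral; last exact: split.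
    by have [] := cintegrableZ (fac z) (cintegrable_weyl z0).
  by have [] := cintegrableD (cintegrable_kint z0 kg) idif.
rewrite !rmorphD/=; case: (xi) => [x|]; last by rewrite rmorph0; ring.
by rewrite rmorphN rmorphM/=; ring.
Qed.

End WeylCauchy.

Lemma ae_notin {R : realType} (mu : {measure set R -> \bar R}) (s : seq R) :
  (forall x, x \in s -> mu [set x] = 0%E) -> {ae mu, forall t, t \notin s}.
Proof.
elim: s => [_|x s IH sx]; first exact: aeW.
have hx : {ae mu, forall t, t != x}.
  apply: (@negligibleS _ _ _ _ [set x]).
    by move=> t /= /negP; rewrite negbK => /eqP.
  by apply/negligibleP; [exact: measurable_set1|apply: sx; rewrite mem_head].
have hs : {ae mu, forall t, t \notin s} by apply: IH => y ys; apply: sx; rewrite inE ys orbT.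
by apply: filterS2 hx hs => t tx ts; rewrite inE negb_or tx.
Qed.

(** * The transformed model *)

Section SigmaE.
Context {R : realType} (n : nat) (a b : n.+1.-tuple (option R)).
Variable sigma : {measure set R -> \bar R}.
Local Notation C := (R[i]^o).
Local Notation A := (finpts a).
Local Notation B := (finpts b).
Local Notation out := (\1_(~` [set` A]) : R -> R).

Lemma measurable_out : measurable (~` [set` A] : set R).
Proof. by apply: measurableC; exact: measurable_finpts. Qed.

Lemma measurable_out_fun (f : R -> R) : measurable_fun setT f ->
  measurable_fun setT (fun t => out t * f t).
Proof. by apply: measurable_funM; apply: measurable_indic; exact: measurable_out. Qed.

(** sigma is the sum of its restrictions to [E] and to the complement, on which the cut integrand
    agrees almost everywhere with [f] and with 0. *)
Lemma ge0_integral_mrestr (E : set R) (mE : measurable E) (f : R -> R) :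
  measurable_fun setT f -> (forall t, 0 <= f t) ->
  (\int[mrestr sigma mE]_t (f t)%:E = \int[sigma]_t (\1_E t * f t)%:E)%E.
Proof.
move=> mf f0; have mE' := measurableC mE.
have mEf : measurable_fun setT (fun t => (\1_E t * f t)%:E).
  by apply/measurable_EFinP; apply: measurable_funM => //; exact: measurable_indic.
have Ef0 t : 0 <= \1_E t * f t by rewrite mulr_ge0// indicE.
rewrite [RHS](@eq_measure_integral _ _ _ _ (measure_add (mrestr sigma mE) (mrestr sigma mE'))); last first.
  move=> X mX _; apply/esym; rewrite -[LHS]/(measure_add (mrestr sigma mE) (mrestr sigma mE') X).
  rewrite measure_addE /mrestr /= -[in RHS](setIT X) -(setUv E) setIUr measureU//.
  - exact: measurableI.
  - exact: measurableI.
  by rewrite setIACA setICr setI0.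
rewrite ge0_integral_measure_add//; last by move=> t _; rewrite lee_fin.
rewrite [X in _ = (_ + X)%E](_ : _ = 0%E) ?adde0.
  apply: ae_eq_integral => //; first exact/measurable_EFinP.
  exists (~` E); split => //; first by rewrite -[LHS]/(sigma (~` E `&` E)) setICl measure0.
  move=> t /= ht Et; apply: ht => _; rewrite indicE mem_set// mul1r//.
rewrite (_ : 0%E = \int[mrestr sigma mE']_t (cst 0%E) t)%E; last by rewrite integral0.
apply: ae_eq_integral => //.
exists E; split => //; first by rewrite -[LHS]/(sigma (E `&` ~` E)) setICr measure0.
move=> t /= ht; apply: contrapT => Et; apply: ht => _; rewrite indicE memNset// mul0r//.
Qed.

Lemma ge0_integral_sigma_e (f : R -> R) : measurable_fun setT f -> (forall t, 0 <= f t) ->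
  (\int[sigma_e a b sigma]_t (f t)%:E =
   \int[sigma]_t (out t * f t)%:E + (\sum_(x <- B) f x)%:E)%E.
Proof.
move=> mf f0; have mfE : measurable_fun setT (EFin \o f) by exact/measurable_EFinP.
rewrite ge0_integral_measure_add//; last by move=> t _; rewrite lee_fin.
congr (_ + _)%E; first exact: ge0_integral_mrestr.
rewrite ge0_integral_measure_sum//; last by move=> t _; rewrite lee_fin.
rewrite (big_nth 0) big_mkord -sumEFin; apply: eq_bigr => k _.
by rewrite integral_dirac// diracT mul1e.
Qed.

Lemma rintegrable_sigma_e (f : R -> R) : measurable_fun setT f ->
  rintegrable (sigma_e a b sigma) f <-> rintegrable sigma (fun t => out t * f t).
Proof.
move=> mf; have key : (\int[sigma_e a b sigma]_t `|(EFin \o f) t| < +oo <->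
    \int[sigma]_t `|(EFin \o (fun t => out t * f t)%R) t| < +oo)%E.
  have -> : (fun t => `|(EFin \o f) t|)%E = (fun t => (`|f t|)%:E) by apply/funext => t.
  have -> : (fun t => `|(EFin \o (fun t => out t * f t)%R) t|)%E = (fun t => (out t * `|f t|)%:E).
    by apply/funext => t; rewrite /= normrM [`|out t|]ger0_norm// indicE.
  rewrite ge0_integral_sigma_e//; last exact: measurableT_comp.
  by split => [|h]; [apply: le_lt_trans; rewrite leeDl// lee_fin; apply: sumr_ge0|rewrite lte_add_pinfty// ltry].
split=> /integrableP[_ h]; apply/integrableP; split; try by apply/key.
  by apply/measurable_EFinP; exact: measurable_out_fun.
exact/measurable_EFinP.
Qed.

(** The sum formula for measures is available for nonnegative integrands; a signed f is written as
    (f + |f|) - |f|. *)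
Lemma Rintegral_sigma_e (f : R -> R) : measurable_fun setT f ->
  rintegrable (sigma_e a b sigma) f ->
  \int[sigma_e a b sigma]_t f t = \int[sigma]_t (out t * f t) + \sum_(x <- B) f x.
Proof.
have pos (h : R -> R) : measurable_fun setT h -> (forall t, 0 <= h t) ->
    rintegrable (sigma_e a b sigma) h ->
    \int[sigma_e a b sigma]_t h t = \int[sigma]_t (out t * h t) + \sum_(x <- B) h x.
  move=> mh h0 ih; rewrite /Rintegral ge0_integral_sigma_e// fineD//.
  exact: (integrable_fin_num measurableT ((rintegrable_sigma_e mh).1 ih)).
move=> mf jf; have jn := rintegrable_norm jf; have js := rintegrableD jf jn.
have mn : measurable_fun setT (fun t => `|f t|) by exact: measurableT_comp.
have ms : measurable_fun setT (fun t => f t + `|f t|) by exact: measurable_funD.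
have e1 := pos _ mn (fun t => normr_ge0 _) jn.
have s0 t : 0 <= f t + `|f t| by have := ler_norm (- f t); rewrite normrN; lra.
have e2 := pos _ ms s0 js.
have e3 := RintegralD measurableT jf jn.
have o1 := (rintegrable_sigma_e mf).1 jf; have o2 := (rintegrable_sigma_e mn).1 jn.
have e4 := RintegralD measurableT o1 o2.
have e5 : \int[sigma]_t (out t * (f t + `|f t|)) = \int[sigma]_t (out t * f t + out t * `|f t|).
  by apply: eq_Rintegral => t _; rewrite mulrDr.
by move: e2; rewrite e3 e1 big_split/= e5 e4; lra.
Qed.

Lemma cintegral_sigma_e (f : R -> C) : cintegrable (sigma_e a b sigma) f ->
  cintegral (sigma_e a b sigma) f =
  cintegral sigma (fun t => (out t)%:C * f t : C) + \sum_(x <- B) f x.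
Proof.
move=> jf; have [[m1 m2] _] := jf; apply: complex_ext.
  rewrite cReD /= (Rintegral_sigma_e m1 (cintegrable_Re jf)); congr (_ + _).
    by apply: eq_Rintegral => t _; rewrite cReM /= mul0r subr0.
  by elim: (B) => [|x s IH]; rewrite ?big_nil// !big_cons cReD IH.
rewrite cImD /= (Rintegral_sigma_e m2 (cintegrable_Im jf)); congr (_ + _).
  by apply: eq_Rintegral => t _; rewrite cImM /= mul0r addr0.
by elim: (B) => [|x s IH]; rewrite ?big_nil// !big_cons cImD IH.
Qed.

End SigmaE.

(** * Reality of the rational factor and its behaviour at infinity *)

Section RationalFactor.
Context {R : realType}.
Local Notation C := (R[i]^o).
Local Notation toC := (map_poly (real_complex R)).

Lemma poly_eq0_nonreal (p : {poly R[i]}) : (forall z, Im z != 0 -> p.[z] = 0) -> p = 0.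
Proof.
move=> p0; apply: contrapT => /eqP pn.
pose rs := [seq (0 +i* k.+1%:R : R[i]) | k <- iota 0 (size p)].
have := max_poly_roots (rs := rs) pn; rewrite size_map size_iota ltnn => h; suff : false by []; apply: h.
  by apply/allP => _ /mapP[k _ ->]; rewrite /root p0//= pnatr_eq0.
rewrite map_inj_uniq ?iota_uniq// => i j [/eqP].
by rewrite eqr_nat => /eqP[].
Qed.

(** At a nonreal zero the quotient Im Q / Im w, a sum of nonnegative terms, vanishes, so be = 0 and
    mu = 0: Q is a constant equal to 0. This rules out nonreal poles of r. *)
Lemma nonreal_root_null (mu : {measure set R -> \bar R}) (al be : R) (w : C) :
  rintegrable mu rho -> 0 <= be -> Im w != 0 -> cauchyQ mu al be w = 0 ->
  forall z, Im z != 0 -> cauchyQ mu al be z = 0.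
Proof.
move=> irho be0 w0 Qw; have := Im_cauchyQ al be irho w0; rewrite Qw /= => /esym/eqP.
have iw := integrable_inv_cn irho w0.
rewrite mulf_eq0 (negbTE w0) orbF => /eqP h.
have i0 : 0 <= \int[mu]_t (cn (t%:C - w) ^+ 2)^-1.
  by apply: Rintegral_ge0 => t _; rewrite invr_ge0 sqr_ge0.
have b0 : be = 0 by lra.
have {}i0 : \int[mu]_t (cn (t%:C - w) ^+ 2)^-1 = 0 by lra.
have null : {ae mu, forall t : R, False}.
  have : {ae mu, forall t, (cn (t%:C - w) ^+ 2)^-1 = 0}.
    apply: ae_eq0_small; first exact: measurable_inv_cn.
      by move=> t; rewrite invr_ge0 sqr_ge0.
    move=> e e0; exists (fun t => (cn (t%:C - w) ^+ 2)^-1); split => //; first exact: aeW.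
    by rewrite i0 ltW.
  apply: filterS => t /eqP; rewrite invr_eq0 expf_eq0 /= gt_eqF//.
  by rewrite cn_gt0 nonreal_sub.
have k0 z : kint mu (fun=> 1) z = 0.
  rewrite -(cintegral0 mu); apply: ae_cintegral.
  - by apply: cmeasurable_kint; exact: measurable_cst.
  - exact: cmeasurable_cst.
  by apply: filterS null.
move=> z z0; move: Qw; rewrite /cauchyQ !k0 b0 !mul0r => ->.
by [].
Qed.

Lemma cvgC_horner (p : {poly R[i]}) (F : set_system C) (FF : Filter F) (f : C -> C) (l : C) :
  f @ F --> l -> (p.[f z] : C) @[z --> F] --> (p.[l] : C).
Proof.
move=> fl; elim/poly_ind: p => [|p c IH].
  by under eq_fun do rewrite horner0; rewrite horner0; exact: cvgC_cst.
under eq_fun do rewrite hornerMXaddC; rewrite hornerMXaddC.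
by apply: cvgCD; [exact: cvgCM|exact: cvgC_cst].
Qed.

Lemma derivable_continuousC (f : C -> C) (w : C) : derivable f w 1 -> f z @[z --> nbhs w] --> f w.
Proof. by move=> /derivable1_diffP/differentiable_continuous. Qed.

Lemma cvgC_lim (F : set_system C) {FF : ProperFilter F} (f : C -> C) (l : C) :
  f z @[z --> F] --> l -> lim (f z @[z --> F]) = l.
Proof. exact: (cvg_lim (@norm_hausdorff _ C)). Qed.

(* With the convention x / 0 = 0 the quotient vanishes at w, so continuity forces p w * Q w = 0. *)
Lemma denominator_root (p q : {poly R[i]}) (Q : C -> C) (w : C) : q != 0 ->
  derivable Q w 1 -> derivable (fun z : C => p.[z] / q.[z] * Q z : C) w 1 ->
  q.[w] = 0 -> p.[w] * Q w = 0.
Proof.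
move=> q0 /derivable_continuousC cQ /derivable_continuousC cP qw.
rewrite qw invr0 mulr0 mul0r in cP.
pose u (k : nat) : C := w + (k.+1%:R^-1 : R)%:C.
pose F : set_system C := u @ \oo.
have FF : ProperFilter F by exact: fmap_proper_filter.
have uw : F --> (w : C).
  have : z @[z --> F] --> (w : C).
    apply/cvgC_P => e e0; rewrite /F /fmap /mkset /=; near=> k.
    suff : cn (u k - w) < e by [].
    rewrite /u addrC addKr cn_real gtr0_norm ?invr_gt0//.
    by near: k; exact: (near_infty_natSinv_lt (PosNum e0)).
  by [].
have h1 : p.[z] * Q z @[z --> F] --> (p.[w] * Q w : C).
  apply: (@cvgCM _ F _ (fun z => p.[z]) Q).
    by apply: (@cvgC_horner p F _ id); exact: uw.
  exact: (cvg_trans (cvg_app Q uw) cQ).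
have h2 : q.[z] * (p.[z] / q.[z] * Q z) @[z --> F] --> (q.[w] * 0 : C).
  apply: (@cvgCM _ F _ (fun z => q.[z]) (fun z => p.[z] / q.[z] * Q z)).
    by apply: (@cvgC_horner q F _ id); exact: uw.
  exact: (cvg_trans (cvg_app (fun z : C => p.[z] / q.[z] * Q z : C) uw) cP).
(* Isolating the root w with its multiplicity shows that q does not vanish at the approximating
   points from some index on. *)
have [m [q1 q1w qE]] := multiplicity_XsubC q w; rewrite q0 /= in q1w.
have h3 : p.[z] * Q z @[z --> F] --> (q.[w] * 0 : C).
  apply: cvgC_near_eq h2.
  have hq1 : q1.[z] @[z --> F] --> (q1.[w] : C).
    by apply: (@cvgC_horner q1 F _ id); exact: uw.
  have e0 : 0 < cn q1.[w] by rewrite cn_gt0.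
  move: hq1 => /cvgC_P/(_ _ e0); rewrite /F /fmap /mkset /=; apply: filterS => k /= hk.
  have q1k : q1.[u k] != 0.
    by apply: contraTneq hk => ->; rewrite sub0r cnN ltxx.
  have qk : q.[u k] != 0.
    rewrite qE hornerM horner_exp hornerXsubC mulf_neq0// expf_neq0// /u addrC addKr.
    by rewrite fmorph_eq0 invr_eq0 pnatr_eq0.
  by field.
rewrite mulr0 in h3.
by rewrite -[LHS](cvgC_lim h1) (cvgC_lim h3).
Unshelve. all: by end_near. Qed.

(** All roots of q are real and listed in [s] with multiplicity, so q is a constant times a real
    product; dividing p by that constant, the symmetry makes its coefficients real. *)
Lemma ratfun_factor (p q : {poly R[i]}) (s : seq R) : q != 0 ->
  (forall x, count_mem x s = mup x%:C q) ->
  (forall w, Im w != 0 -> q.[w] != 0) ->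
  (forall z, Im z != 0 -> p.[conjc z] / q.[conjc z] = conjc (p.[z] / q.[z])) ->
  exists (N : {poly R}) (k : R[i]), [/\ k != 0, p = k *: toC N &
    q = k *: toC (\prod_(x <- s) ('X - x%:P))].
Proof.
move=> q0 sq qn sym; have [rs qE] := closed_field_poly_normal q.
pose k := lead_coef q; have k0 : k != 0 by rewrite lead_coef_eq0.
have rsE : perm_eq rs [seq x%:C | x <- s].
  apply/allP => z _ /=; apply/eqP.
  have mz : mup z q = count_mem z rs.
    rewrite qE -mul_polyC mupMr ?mu_prod_XsubC//.
    by rewrite /root hornerC.
  rewrite -mz; have [z0|z0] := eqVneq (Im z) 0; last first.
    rewrite mupNroot; last exact: qn.
    apply/esym/count_memPn; apply/negP => /mapP[x _ zx].
    by rewrite zx eqxx in z0.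
  have -> : z = (Re z)%:C by apply: complex_ext.
  rewrite -sq count_map; apply: eq_count => x /=.
  by rewrite (inj_eq (@complexI R)).
have {}qE : q = k *: toC (\prod_(x <- s) ('X - x%:P)).
  rewrite {1}qE -/k; congr (_ *: _); rewrite rmorph_prod (perm_big _ rsE) big_map.
  by apply: eq_bigr => x _; rewrite /= rmorphB /= map_polyX map_polyC.
have qp z : q.[z] = k * peval (\prod_(x <- s) ('X - x%:P)) z by rewrite qE hornerZ.
have [N NE] : exists N : {poly R}, forall z, Im z != 0 -> (k^-1 *: p).[z] = peval N z.
  apply: (@real_poly_of_symmetric _ (fun z => (k^-1 *: p).[z]) (k^-1 *: p)) => // z z0.
  have zJ : Im (conjc z) != 0 by rewrite cImJ oppr_eq0.
  have Dz := peval_prod_nonreal s z0; have DJ := peval_prod_nonreal s zJ.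
  have := sym z z0; rewrite !qp !hornerZ.
  have -> v D : v / (k * D) = k^-1 * v / D by rewrite invfM; ring.
  have -> v D : v / (k * D) = k^-1 * v / D by rewrite invfM; ring.
  rewrite [in RHS]conjcM conjcV peval_conj => h.
  have DJ' : conjc (peval (\prod_(x <- s) ('X - x%:P)) z) != 0 by rewrite -peval_conj.
  by apply: (mulIf (invr_neq0 DJ')); rewrite h.
exists N, k; split => //.
apply/eqP; rewrite -subr_eq0; apply/eqP; apply: poly_eq0_nonreal => z z0.
by rewrite hornerD hornerN hornerZ -[(toC N).[z]]/(peval N z) -NE// hornerZ mulVKf// subrr.
Qed.

Lemma peval_growth (N : {poly R}) m : (size N <= m)%N -> exists2 c : R, 0 <= c &
  forall z, 1 <= cn z -> cn (peval N z) * cn z <= c * cn z ^+ m.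
Proof.
move=> Nm; exists (\sum_(i < size N) `|N`_i|); first by apply: sumr_ge0.
move=> z z1; have z0 : 0 <= cn z by exact: cn_ge0.
rewrite /peval horner_coef size_map_poly.
apply: le_trans (_ : (\sum_(i < size N) `|N`_i| * cn z ^+ i) * cn z <= _).
  apply: ler_wpM2r => //.
  apply: (big_ind2 (fun (u : R[i]) v => cn u <= v)) => [|u v u' v' h1 h2|i _]; first by rewrite cn0.
    by apply: le_trans (cnD _ _) _; exact: lerD.
  by rewrite cnM cnX coef_map cn_real.
rewrite !mulr_suml; apply: ler_sum => i _; rewrite -mulrA -exprSr ler_wpM2l//.
by apply: ler_weXn2l => //; exact: leq_trans (ltn_ord i) Nm.
Qed.

(** Once |z| >= 2 |x| one has |z| <= 2 |z - x|: one factor 2 per root. *)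
Lemma prod_growth (s : seq R) : exists2 T : R, 1 <= T & forall z, T <= cn z ->
  cn z ^+ size s <= 2 ^+ size s * cn (peval (\prod_(x <- s) ('X - x%:P)) z).
Proof.
elim: s => [|x s [T T1 IH]].
  by exists 1 => // z _; rewrite big_nil peval1 cn1 mulr1.
exists (Num.max T (2 * `|x|)) => [|z]; first by rewrite le_max T1.
rewrite ge_max => /andP[zT zx]; rewrite big_cons pevalM pevalXsubC cnM /= !exprS.
rewrite [leRHS](_ : _ = (2 * cn (z - x%:C)) *
  (2 ^+ size s * cn (peval (\prod_(j <- s) ('X - j%:P)) z))); last by ring.
apply: ler_pM; rewrite ?cn_ge0 ?exprn_ge0 ?cn_ge0//; last exact: IH.
have := cnD (z - x%:C) x%:C; rewrite subrK cn_real; lra.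
Qed.

Lemma proper_bound (N : {poly R}) (s : seq R) : (size N <= size s)%N ->
  exists c T : R, [/\ 0 <= c, 1 <= T & forall z, T <= cn z ->
    peval (\prod_(x <- s) ('X - x%:P)) z != 0 /\
    cn (peval N z / peval (\prod_(x <- s) ('X - x%:P)) z) <= c / cn z].
Proof.
move=> Ns; have [c c0 hc] := peval_growth Ns; have [T T1 hT] := prod_growth s.
exists (c * 2 ^+ size s), T; split => // [|z zT]; first by rewrite mulr_ge0 ?exprn_ge0.
have z0 : 0 < cn z by apply: lt_le_trans zT; exact: lt_le_trans T1.
have := hT z zT; set D := peval _ z => hD.
have D0 : 0 < cn D.
  rewrite lt_neqAle cn_ge0 andbT eq_sym; apply: contraTneq hD => ->.
  by rewrite mulr0 -ltNge exprn_gt0.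
split; first by rewrite -cn_gt0.
rewrite cnM cnV ler_pdivlMr// mulrAC ler_pdivrMr//.
apply: le_trans (hc z (le_trans T1 zT)) _; rewrite -mulrA; exact: ler_wpM2l.
Qed.

(** Subtracting the coefficient times the monic denominator leaves a proper fraction, which is O(1 /
    |z|). *)
Lemma ratio_cinfty (N : {poly R}) (s : seq R) : (size N <= (size s).+1)%N ->
  peval N z / peval (\prod_(x <- s) ('X - x%:P)) z @[z --> cinfty] --> ((N`_(size s))%:C : C).
Proof.
move=> Ns; set D := \prod_(x <- s) ('X - x%:P); set g := N`_(size s).
have Dm : D \is monic by exact: monic_prod_XsubC.
have sD : size D = (size s).+1 by rewrite size_prod_XsubC.
have sN : (size (N - g *: D)%R <= size s)%N.
  apply/leq_sizeP => j; rewrite leq_eqVlt coefB coefZ => /orP[/eqP <-|sj].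
    have -> : D`_(size s) = 1 by move/monicP : Dm; rewrite /lead_coef sD.
    by rewrite mulr1 subrr.
  rewrite !nth_default ?mulr0 ?subr0//; first by rewrite sD.
  exact: leq_trans sj.
have [c [T [c0 T1 hc]]] := proper_bound sN.
move=> U /nbhsC_P[e e0 eU]; exists (T + c / e) => z; rewrite normc_cn ltcR => zT.
have ce : 0 <= c / e by rewrite divr_ge0// ltW.
have Tz : T <= cn z by lra.
have z0 : 0 < cn z by apply: lt_le_trans Tz; exact: lt_le_trans T1.
have [Dz] := hc z Tz; rewrite -/D in Dz *.
rewrite pevalB pevalZ mulrBl mulfK// => h; apply: eU.
apply: le_lt_trans h _; rewrite ltr_pdivrMr// mulrC -ltr_pdivrMr//; lra.
Qed.

End RationalFactor.

Section Patch.
Context {R : realType} (s : seq R).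

Definition patch_on (h v : R -> R) (t : R) : R :=
  \1_(~` [set` s]) t * h t + \sum_(x <- s) \1_[set x] t * v x.

Lemma patch_out h v t : t \notin s -> patch_on h v t = h t.
Proof.
move=> ts; rewrite /patch_on indicE mem_set ?mul1r; last by move=> /=; apply/negP.
rewrite big_seq big1 ?addr0// => x xs; rewrite indicE memNset ?mul0r//= => tx.
by rewrite tx xs in ts.
Qed.

Lemma patch_in h v t : uniq s -> t \in s -> patch_on h v t = v t.
Proof.
move=> us ts; rewrite /patch_on indicE memNset; last by move=> /=; apply.
rewrite mul0r add0r (bigD1_seq t)//= indicE mem_set// mul1r big1 ?addr0// => x xt.
by rewrite indicE memNset ?mul0r//= => tx; rewrite tx eqxx in xt.
Qed.

Lemma measurable_patch h v : measurable_fun setT h -> measurable_fun setT (patch_on h v).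
Proof.
move=> mh; apply: measurable_funD.
  apply: measurable_funM => //; apply: measurable_indic; apply: measurableC.
  by apply: countable_measurable => [x|]; [exact: measurable_set1|exact/finite_set_countable/finite_seq].
elim: (s) => [|x s' IH].
  by under eq_fun do rewrite big_nil; exact: measurable_cst.
under eq_fun do rewrite big_cons; apply: measurable_funD => //.
by apply: measurable_funM; [exact: measurable_indic|exact: measurable_cst].
Qed.

End Patch.

(** * Decay of the density at the distinguished zero *)

Section RatioDecay.
Context {R : realType} (mu : {measure set R -> \bar R}) (s : seq R) (N : {poly R}).
Local Notation D := (\prod_(x <- s) ('X - x%:P)).
Local Notation r t := (N.[t] / D.[t]).
Hypotheses (irho : rintegrable mu rho) (kr : kdensity mu (fun t => r t)).

Lemma ratio_near_zero (x : R) : N.[x] = 0 -> D.[x] != 0 -> exists c d : R,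
  [/\ 0 <= c, 0 < d & forall t, `|t - x| < d -> `|r t| / `|t - x| <= c].
Proof.
move=> /eqP/factor_theorem[N1 NE] Dx; pose B : R := `|x| + 1.
have [L L0 hL] := peval_lipschitz N1 B; have [M M0 hM] := peval_lipschitz D B.
have Dx0 : 0 < `|D.[x]| by rewrite normr_gt0.
exists (L * (2 / `|D.[x]|)), (Num.min 1 (`|D.[x]| / (2 * M))); split.
- by rewrite mulr_ge0 ?divr_ge0// ltW.
- by rewrite lt_min ltr01 divr_gt0// mulr_gt0.
move=> t; rewrite lt_min => /andP[t1 tD].
have [->|tx] := eqVneq (t - x) 0.
  by rewrite normr0 invr0 mulr0 mulr_ge0 ?divr_ge0// ltW.
have tx0 : 0 < `|t - x| by rewrite normr_gt0.
have tB : cn (t%:C : R[i]) <= B.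
  by rewrite cn_real /B; have := ler_normD (t - x) x; rewrite subrK; lra.
have xB : cn (x%:C : R[i]) <= B by rewrite cn_real /B; lra.
have [N1t _] := hL _ _ tB tB; have [_ DD] := hM _ _ tB xB.
rewrite !peval_real -!rmorphB !cn_real in N1t DD.
have Dt : `|D.[x]| / 2 <= `|D.[t]|.
  have MD : M * `|t - x| <= `|D.[x]| / 2.
    rewrite mulrC -ler_pdivlMr// -mulrA -invfM; exact: ltW.
  have := ler_distD 0 D.[x] D.[t]; have := ler_normB D.[x] D.[t].
  have : `|D.[x]| <= `|D.[t] - D.[x]| + `|D.[t]|.
    by rewrite distrC -{1}(subrK D.[t] D.[x]); exact: ler_normD.
  lra.
rewrite NE hornerM hornerXsubC normrM normrV ?unitfE; last by rewrite -normr_gt0; lra.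
rewrite normrM mulrAC mulfK ?gt_eqF//; apply: ler_pM => //; rewrite ?invr_ge0//.
rewrite -[leRHS]invf_div lef_pV2 ?posrE ?divr_gt0//; lra.
Qed.

(** Serves the membership of [omega_e] in the negative space. Near a finite zero the factor t - x of
    N cancels |kap|, and away from it |kap| is bounded below; a zero at infinity gives |r| = O(1 /
    |t|). *)
Lemma ratio_decay (xi : option R) :
  (if xi is Some x then N.[x] = 0 /\ D.[x] != 0 else (size N <= size s)%N) ->
  rintegrable mu (fun t => `|r t| / `|kap xi t| * ((1 + `|t|) * rho t)).
Proof.
move=> hxi; have [mr ir] := kr.
have mf : measurable_fun setT (fun t => `|r t| / `|kap xi t| * ((1 + `|t|) * rho t)).
  apply: measurable_funM.
    apply: measurable_funM; first exact: measurableT_comp.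
    by apply: measurable_inv; apply: measurableT_comp => //; exact: measurable_kap.
  apply: measurable_funM; last exact: measurable_rho.
  by apply: measurable_funD; [exact: measurable_cst|exact: (@measurable_absval R None)].
suff [c [d [c0 d0 h]]] : exists c d : R, [/\ 0 <= c, 0 <= d & forall t,
    `|r t| / `|kap xi t| * (1 + `|t|) <= c * `|r t| + d].
  apply: rintegrable_le (rintegrableD (rintegrableZ c ir) (rintegrableZ d irho)) _ => // t.
  have r0 := rho_gt0 t.
  rewrite ger0_norm; last first.
    apply: mulr_ge0; first by apply: mulr_ge0 => //; rewrite invr_ge0.
    by apply: mulr_ge0; [exact: addr_ge0|exact: ltW].
  by rewrite [leRHS](_ : _ = (c * `|r t| + d) * rho t); [rewrite mulrA ler_pM2r|ring].
case: xi hxi {mf} => [x [Nx Dx]|Ns].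
  have [c [d [c0 d0 h]]] := ratio_near_zero Nx Dx.
  exists ((1 + `|x|) / d + 1), (c * (1 + `|x| + d)); split.
  - by rewrite addr_ge0// divr_ge0 ?addr_ge0// ltW.
  - by rewrite mulr_ge0 ?addr_ge0// ltW.
  move=> t; rewrite /kap; have r0 := normr_ge0 (r t).
  have tx : `|t| <= `|t - x| + `|x| by have := ler_normD (t - x) x; rewrite subrK.
  have [td|td] := ltP `|t - x| d.
    apply: le_trans (_ : c * (1 + `|x| + d) <= _).
      by apply: ler_pM; rewrite ?addr_ge0 ?divr_ge0//; [exact: h|lra].
    by rewrite lerDr mulr_ge0// addr_ge0// divr_ge0 ?addr_ge0// ltW.
  have tx0 : 0 < `|t - x| by exact: lt_le_trans td.
  apply: le_trans (_ : ((1 + `|x|) / d + 1) * `|r t| <= _); last first.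
    by rewrite lerDl mulr_ge0 ?addr_ge0// ltW.
  rewrite -mulrA mulrC ler_wpM2r// mulrC ler_pdivrMr//.
  have : (1 + `|x|) <= (1 + `|x|) / d * `|t - x|.
    by rewrite -mulrA ler_peMr ?addr_ge0// mulrC ler_pdivlMr// mul1r.
  by rewrite mulrDl mul1r; lra.
have [c [T [c0 T1 hT]]] := proper_bound Ns.
exists (1 + T), (2 * c); split; [lra|by rewrite mulr_ge0|] => t.
rewrite /kap normr1 divr1; have r0 := normr_ge0 (r t).
have [tT|tT] := leP T `|t|.
  have t0 : 0 < `|t| by lra.
  have := hT t%:C; rewrite cn_real => /(_ tT) [_].
  rewrite !peval_real -fmorphV -rmorphM cn_real /= ler_pdivlMr// => h.
  have : `|r t| * 1 <= `|r t| * `|t| by rewrite ler_wpM2l//; lra.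
  have : 0 <= (1 + T) * `|r t| by rewrite mulr_ge0//; lra.
  by rewrite mulrDr; lra.
have : `|r t| * (1 + `|t|) <= `|r t| * (1 + T) by rewrite ler_wpM2l//; lra.
by have : 0 <= 2 * c; [rewrite mulr_ge0|lra].
Qed.

End RatioDecay.

(** * The product as a Weyl function for the new measure *)

Section TransformedModel.
Context {R : realType} (n : nat) (a b : n.+1.-tuple (option R)).
Variables (sigma : {measure set R -> \bar R}) (al be : R) (N : {poly R}) (xi : option R).
Local Notation C := (R[i]^o).
Local Notation s := (pmap id b).
Local Notation D := (\prod_(x <- s) ('X - x%:P)).
Local Notation r t := (N.[t] / D.[t]).
Local Notation rQ z := (peval N z / peval D z * cauchyQ sigma al be z).
Hypotheses (irho : rintegrable sigma rho) (be0 : 0 <= be).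
Hypothesis P_Im : forall z, 0 < Im z -> 0 <= Im (rQ z).
Hypothesis Ns : forall x, x \in s -> N.[x] != 0.
Hypothesis Na : forall x, x \in finpts a -> N.[x] = 0.
Hypothesis hxi : if xi is Some x then x \in finpts a else (size N <= size s)%N.
Variables (A B : R) (c : R -> R).
Hypothesis c0 : forall x, x \in s -> 0 <= c x.
Hypothesis B0 : xi = None -> B = 0.
Hypothesis rQE : forall z, Im z != 0 ->
  rQ z = A%:C + B%:C * z + \sum_(x <- undup s) (c x)%:C / (x%:C - z) +
    kint sigma (fun t => r t) z.

Local Notation sigmae := (sigma_e a b sigma).
Local Notation out := (\1_(~` [set` finpts a]) : R -> R).

Definition omega_p t : R := patch_on (finpts b)
  (fun t => Num.sqrt `|r t| / kap xi t) (fun x => Num.sqrt (c x) / kap xi x) t.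

Definition density_p t : R := patch_on (finpts b) (fun t => `|r t|) c t.

Lemma Na_notin x : x \in finpts a -> x \notin finpts b.
Proof. by move=> xa; apply/negP; rewrite mem_undup => /Ns; rewrite Na ?eqxx. Qed.

Lemma ratio_out t : out t * r t = r t.
Proof.
rewrite indicE; have [ta|ta] := boolP (t \in finpts a).
  by rewrite Na// mul0r mulr0.
by rewrite mem_set ?mul1r//=; apply/negP.
Qed.

Lemma measurable_sqrtratio : measurable_fun setT (fun t => Num.sqrt `|r t|).
Proof.
apply: (measurableT_comp (continuous_measurable_fun (@sqrt_continuous R))).
by apply: measurableT_comp => //; exact: measurable_ratio.
Qed.

Lemma measurable_omega_p : measurable_fun setT omega_p.
Proof.
apply: measurable_patch; apply: measurable_funM; first exact: measurable_sqrtratio.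
by apply: measurable_inv; exact: measurable_kap.
Qed.

Lemma measurable_density_p : measurable_fun setT density_p.
Proof.
by apply: measurable_patch; apply: measurableT_comp => //; exact: measurable_ratio.
Qed.

Lemma kap_eq0 t : kap xi t = 0 -> t \in finpts a.
Proof.
rewrite /kap; case: (xi) hxi => [x xa|_]; last by move/eqP; rewrite oner_eq0.
by move/eqP; rewrite subr_eq0 => /eqP ->.
Qed.

(** Where [kap] vanishes, t is a zero of r and therefore not a pole, so the density |r| vanishes
    there as well. *)
Lemma omega_density t : kap xi t ^+ 2 * cn ((omega_p t)%:C : C) ^+ 2 = density_p t.
Proof.
rewrite cn_real real_normK ?num_real//.
have [k0|k0] := eqVneq (kap xi t) 0.
  have ta := kap_eq0 k0; rewrite k0 expr0n mul0r /density_p patch_out ?Na_notin//.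
  by rewrite Na// mul0r normr0.
have [tb|tb] := boolP (t \in finpts b); last first.
  rewrite /omega_p /density_p !patch_out// exprMn sqr_sqrtr// exprVn mulrCA mulfV ?mulr1//.
  by rewrite expf_neq0.
rewrite /omega_p /density_p !patch_in ?undup_uniq// exprMn sqr_sqrtr; last first.
  by apply: c0; rewrite -mem_undup.
by rewrite exprVn mulrCA mulfV ?mulr1// expf_neq0.
Qed.

(** Removing the zeros changes nothing since r vanishes there, the poles are sigma-null, and r >= 0
    almost everywhere removes the absolute value. *)
Lemma density_ae : {ae sigma, forall t, out t * density_p t = r t}.
Proof.
have s0 x : x \in s -> sigma [set x] = 0%E.
  by move=> xs; apply: pole_atom0 xs (Ns xs) => //; exact: P_Im.
apply: filterS2 (ae_notin s0) (ratio_ge0 irho be0 P_Im) => t ts rt.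
by rewrite /density_p patch_out ?mem_undup// ger0_norm// ratio_out.
Qed.

Lemma kdensity_p : kdensity sigmae density_p.
Proof.
have [_ kr] := density_integrable irho be0 P_Im.
have md := measurable_density_p; have mr := @measurable_rho R.
have ma : measurable_fun setT (fun t => `|density_p t|) by exact: measurableT_comp.
split=> //; apply/rintegrable_sigma_e.
  exact: measurable_funM.
apply: ae_rintegrable kr.
  by apply: measurable_out_fun; exact: measurable_funM.
apply: filterS density_ae => t <-.
by rewrite normrM mulrA [`|out t|]ger0_norm// indicE.
Qed.

Lemma omega_p_mem : wL2 sigmae (wminus xi) (fun t => (omega_p t)%:C : C).
Proof.
have mw := cmeasurable_real measurable_omega_p; split => //.
have mf := wL2_measurable (@measurable_wminus R xi) mw.
apply/rintegrable_sigma_e => //.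
have kr := density_integrable irho be0 P_Im.
have i0 : rintegrable sigma (fun t => `|r t| / `|kap xi t| * ((1 + `|t|) * rho t)).
  apply: ratio_decay => //; move: hxi; case: (xi) => // x xa; split; first exact: Na.
  by rewrite prod_XsubC_eq0 -mem_undup; exact: Na_notin.
(* For a finite [xi] this gives 1 + |t| <= K (1 + |t - x|). *)
pose K : R := 1 + (if xi is Some x then `|x| else 0).
have K1 : 1 <= K by rewrite /K; case: (xi) => [x|]; rewrite lerDl.
have i1 := rintegrableZ K i0.
have s0 x : x \in s -> sigma [set x] = 0%E.
  by move=> xs; apply: pole_atom0 xs (Ns xs) => //; exact: P_Im.
have mo : cmeasurable (fun t => (Num.sqrt `|r t| / kap xi t)%:C : C).
  apply: cmeasurable_real; apply: measurable_funM; first exact: measurable_sqrtratio.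
  by apply: measurable_inv; exact: measurable_kap.
have i2 : rintegrable sigma (fun t => out t * (wminus xi t * cn ((Num.sqrt `|r t| / kap xi t)%:C : C) ^+ 2)).
  apply: rintegrable_le i1 _.
    apply: measurable_out_fun; apply: wL2_measurable mo; exact: measurable_wminus.
  move=> t; have w0 := wminus_ge0 xi t; have r0 := rho_gt0 t.
  have p0 : 0 <= wminus xi t * cn ((Num.sqrt `|r t| / kap xi t)%:C : C) ^+ 2.
    by rewrite mulr_ge0 ?sqr_ge0.
  rewrite ger0_norm; last by rewrite mulr_ge0// indicE.
  apply: le_trans (_ : wminus xi t * cn ((Num.sqrt `|r t| / kap xi t)%:C : C) ^+ 2 <= _).
    by rewrite ler_piMl// indicE; case: (_ \in _).
  rewrite cn_real real_normK ?num_real// exprMn sqr_sqrtr//.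
  have [k0|k0] := eqVneq (kap xi t) 0.
    rewrite k0 invr0 expr0n !mulr0 mulr_ge0//; first lra.
    apply: mulr_ge0; first by apply: mulr_ge0 => //; rewrite invr_ge0.
    by apply: mulr_ge0; [exact: addr_ge0|exact: ltW].
  have kk : 0 < `|kap xi t| by rewrite normr_gt0.
  have e1 : (kap xi t)^-1 ^+ 2 = `|kap xi t|^-1 ^+ 2 by rewrite -normfV real_normK ?num_real.
  rewrite e1; suff h : wminus xi t / `|kap xi t| <= K * ((1 + `|t|) * rho t).
    rewrite [leLHS](_ : _ = `|r t| / `|kap xi t| * (wminus xi t / `|kap xi t|)); last by ring.
    rewrite [leRHS](_ : _ = `|r t| / `|kap xi t| * (K * ((1 + `|t|) * rho t))); last by ring.
    by rewrite ler_wpM2l// divr_ge0.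
  have t1 : 0 < 1 + `|t| by rewrite ltr_wpDr.
  have t2 : 1 + t ^+ 2 <= (1 + `|t|) ^+ 2.
    by have := normr_ge0 t; rewrite -(real_normK (num_real t)); nra.
  have key q : 0 < q -> (1 + `|t|) <= K * q -> q^-1 <= K * ((1 + `|t|) * rho t).
    move=> q0 hq; rewrite /rho -[X in K * (_ * X)]/((1 + t ^+ 2)^-1) mulrA.
    rewrite ler_pdivlMr; last by rewrite ltr_wpDr// sqr_ge0.
    rewrite mulrC ler_pdivrMr//; apply: le_trans t2 _; rewrite expr2 mulrAC ler_wpM2r// ltW//.
  rewrite /wminus /absval /kap in kk *; move: kk key; rewrite /K; case: (xi) => [x|] kk key.
    have -> : (1 + `|t - x|^-1)^-1 / `|t - x| = (1 + `|t - x|)^-1.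
      by field; rewrite !gt_eqF// ltr_wpDr.
    apply: key; first by rewrite ltr_wpDr.
    by have := ler_normD (t - x) x; rewrite subrK; have := normr_ge0 x; have := normr_ge0 (t - x); nra.
  by rewrite normr1 divr1; apply: key => //; rewrite addr0 mul1r.
apply: ae_rintegrable i2; first exact: measurable_out_fun.
by apply: filterS (ae_notin s0) => t ts; rewrite /omega_p patch_out// mem_undup.
Qed.

Lemma irho_sigma_e : rintegrable sigmae rho.
Proof.
have mr := @measurable_rho R; apply/rintegrable_sigma_e => //.
apply: rintegrable_le irho _ => [|t]; first exact: measurable_out_fun.
have r0 := rho_gt0 t; rewrite ger0_norm; last by rewrite mulr_ge0 ?(ltW r0)// indicE.
by rewrite ler_piMl ?(ltW r0)// indicE; case: (_ \in _).
Qed.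

Lemma admissible_sigma_e be' : 0 <= be' -> admissible sigmae be'.
Proof.
move=> be'0; split => //; have /integrableP[_] := irho_sigma_e.
rewrite (_ : (fun t => _) = (fun t : R => ((1 + t ^+ 2)^-1)%:E))//.
by apply/funext => t; rewrite abse_EFin ger0_norm// ltW// rho_gt0.
Qed.

Lemma kint_sigma_e z : Im z != 0 -> kint sigmae density_p z =
  kint sigma (fun t => r t) z + \sum_(x <- undup s) (c x)%:C * kernel x z.
Proof.
move=> z0; rewrite /kint cintegral_sigma_e; last exact: cintegrable_kint z0 kdensity_p.
congr (_ + _).
  have [mr _] := density_integrable irho be0 P_Im.
  apply: ae_cintegral.
  - apply: cmeasurableM; first by apply: cmeasurable_real; apply: measurable_indic; exact: measurable_out.
    exact: cmeasurable_kint measurable_density_p.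
  - exact: cmeasurable_kint.
  by apply: filterS density_ae => t <-; rewrite rmorphM/= mulrA.
by apply: eq_big_seq => x xs; rewrite /density_p patch_in ?undup_uniq.
Qed.

Lemma transformed_weyl : exists eta : R, forall z, Im z != 0 ->
  rQ z = weylfun sigmae (if xi is Some _ then B else 0) xi (fun t => (omega_p t)%:C) eta z.
Proof.
have [d hd] := weyl_cauchy (if xi is Some _ then B else 0) omega_p_mem kdensity_p
  (aeW sigmae omega_density).
(* Each point mass contributes the regularized kernel; the sum restores its subtracted constants,
   and [eta] absorbs every additive constant. *)
pose e : R := A + \sum_(x <- undup s) c x * (x * rho x).
exists (e - d) => z z0; rewrite hd// subrK kint_sigma_e// rQE//.
have -> : (if xi is Some _ then if xi is Some _ then B else 0 else 0) = B.
  by case E : (xi) => [x|] //; rewrite B0.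
have -> : \sum_(x <- undup s) (c x)%:C * kernel x z =
    \sum_(x <- undup s) (c x)%:C / (x%:C - z) - (\sum_(x <- undup s) c x * (x * rho x))%:C.
  rewrite rmorph_sum -sumrB; apply: eq_bigr => x _.
  by rewrite /kernel mulrBr -rmorphM.
by rewrite rmorphD/=; ring.
Qed.

End TransformedModel.

Section ProductFacts.
Context {R : realType}.
Local Notation C := (R[i]^o).

Global Instance cinfty_filter : ProperFilter (@cinfty R).
Proof.
split.
  move=> [M hM]; apply: (hM (`|M| + 1)%:C).
  by rewrite normc_cn ltcR cn_real ger0_norm ?addr_ge0//; have := ler_norm M; lra.
split; first by exists 0.
  move=> U V [M hM] [L hL]; exists (Num.max M L) => z; rewrite normc_cn ltcR gt_max => /andP[h1 h2].
  by split; [apply: hM|apply: hL]; rewrite normc_cn ltcR.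
by move=> U V UV [M hM]; exists M => z /hM/UV.
Qed.

Lemma count_pmap_id (x : R) (l : seq (option R)) : count_mem x (pmap id l) = count_mem (Some x) l.
Proof. by elim: l => [|[y|] l IH] //=; rewrite IH. Qed.

Lemma cauchyQ_infty (mu : {measure set R -> \bar R}) al be : rintegrable mu rho ->
  cauchyQ mu al be z / z @[z --> nontangential None] --> (be%:C : C).
Proof.
move=> irho.
have h : al%:C * z^-1 + be%:C + z^-1 * kint mu (fun=> 1) z @[z --> nontangential None] -->
    (al%:C * 0 + be%:C + 0 : C).
  apply: cvgCD; last by apply: kint_infty; exact: kdensity1.
  apply: cvgCD; last exact: cvgC_cst.
  by apply: cvgCM; [exact: cvgC_cst|exact: nontangential_inv].
rewrite mulr0 add0r addr0 in h; apply: cvgC_nonreal_eq h => z z0.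
by rewrite /cauchyQ; have zn0 := nonreal_neq0 z0; field.
Qed.

Lemma rlimE (xi : option R) (f : C -> C) (l : R) :
  f z @[z --> nontangential xi] --> (l%:C : C) -> rlim (nontangential xi) f = l.
Proof. by move=> h; rewrite /rlim (cvgC_lim h). Qed.

(** For this [omega] the product kap omega is 1 off b_1, a null point, so the density is 1. Every
    nonreal point is in the resolvent set, where [weyl_value] pins down Q. *)
Lemma realized_cauchy (n : nat) (b : n.+1.-tuple (option R)) (sigma : {measure set R -> \bar R})
    (beta eta : R) (Q : C -> C) : admissible sigma beta ->
  (forall b1, tnth b ord0 = Some b1 -> sigma [set b1] = 0%E) ->
  Hminus sigma beta (tnth b ord0) (omega b, 1) ->
  realized Q (triplet sigma beta (tnth b ord0) (omega b, 1) eta) ->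
  exists al, forall z, Im z != 0 ->
    Q z = cauchyQ sigma al (if tnth b ord0 is Some _ then beta else 0) z.
Proof.
move=> adm null /(HminusP sigma beta (tnth b ord0) (omega b, 1)) omL real.
have [beta0 _] := adm; have irho := admissible_irho adm.
have omg : {ae sigma, forall t, kap (tnth b ord0) t ^+ 2 * cn (omega b t) ^+ 2 = (fun=> 1) t}.
  move: null; rewrite /kap /omega; case: (tnth b ord0) => [b1|] null; last first.
    by apply: aeW => t; rewrite cn1 !expr1n mulr1.
  have : {ae sigma, forall t, t \notin [:: b1]}.
    by apply: ae_notin => x; rewrite inE => /eqP ->; exact: null.
  apply: filterS => t; rewrite inE => tb.
  rewrite cn_real real_normK ?num_real// exprVn mulfV// expf_neq0//.
  by rewrite subr_eq0.
have [d hd] := weyl_cauchy beta omL (kdensity1 irho) omg.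
exists (eta + d) => z z0; rewrite /cauchyQ -hd//.
have [m hm [/(_ z0) -> _]] := real z (resolvent_nonreal sigma beta0 z0).
exact: (weyl_value beta0 omL z0 hm).
Qed.

End ProductFacts.

Theorem theorem6p7 (R : realType) (r : @ratfun R) (Q : R[i]^o -> R[i]^o)
  (n : nat) (a b : n.+1.-tuple (option R))
  (sigma : {measure set R -> \bar R}) (beta : R)
  (r_sym : rsymmetric r) (r_nonconst : rnonconstant r)
  (QN : N00 r Q) (Q_neq0 : exists2 z, nonreal z & Q z != 0)
  (a_zeros : forall xi, count_mem xi a = zero_order r xi)
  (b_poles : forall xi, count_mem xi b = pole_order r xi)
  (a_last : None \in a -> tnth a ord_max = None)
  (b_last : None \in b -> tnth b ord_max = None)
  (Hsigma : admissible sigma beta)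
  (omega_defined : forall b1, tnth b ord0 = Some b1 -> sigma [set b1] = 0%E)
  (omega_mem : Hminus sigma beta (tnth b ord0) (omega b, 1))
  (Q_realized : realized Q
     (triplet sigma beta (tnth b ord0) (omega b, 1)
        (rlim (nontangential (tnth b ord0)) Q))) :
  let sigmae := sigma_e a b sigma in
  let betae := beta_e r Q a b beta in
  let omegae := omega_e r Q a b in
  let rQ := fun z => reval r z * Q z in
  let etaa := rlim (nontangential (tnth a ord_max)) rQ in
  [/\ admissible sigmae betae,
      Hminus sigmae betae (tnth a ord_max) (omegae, 1),
      rQ z @[z --> nontangential (tnth a ord_max)] --> (etaa%:C : R[i]^o)
    & realized rQ (triplet sigmae betae (tnth a ord_max) (omegae, 1) etaa)].
Proof.
move=> sigmae betae omegae rQ etaa.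
have [al QE] := realized_cauchy Hsigma omega_defined omega_mem Q_realized.
have irho := admissible_irho Hsigma; have [beta0 _] := Hsigma.
set be := (if tnth b ord0 is Some _ then beta else 0) in QE.
have be0 : 0 <= be by rewrite /be; case: (tnth b ord0).
have [[Qh _ _] [Ph _ PIm]] := QN.
have q0 : rden r != 0 by case: (r).
have qp : coprimep (rden r) (rnum r) by rewrite coprimep_sym; case: (r).
(* A nonreal pole w of r would force Q w = 0 by holomorphy of r Q and coprimality, hence Q = 0 off
   the real line. *)
have den w : Im w != 0 -> (rden r).[w] != 0.
  move=> w0; apply/eqP => dw.
  have := denominator_root q0 (Qh w w0) (Ph w w0) dw.
  have nw : (rnum r).[w] != 0 by apply: (coprimep_root qp); apply/eqP.
  move/eqP; rewrite mulf_eq0 (negbTE nw) /= QE// => /eqP Qw.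
  have [z z0] := Q_neq0; rewrite QE//.
  by rewrite (nonreal_root_null irho be0 w0 Qw z0) eqxx.
pose s := pmap id b.
have [N [k [k0 numE denE]]] : exists (N : {poly R}) (k : R[i]), [/\ k != 0,
    rnum r = k *: map_poly (real_complex R) N &
    rden r = k *: map_poly (real_complex R) (\prod_(x <- s) ('X - x%:P))].
  apply: ratfun_factor => // [x|z z0].
    by rewrite count_pmap_id b_poles.
  by apply: r_sym; apply: den; rewrite ?cImJ ?oppr_eq0.
pose D := \prod_(x <- s) ('X - x%:P).
have rE z : reval r z = peval N z / peval D z.
  by rewrite /reval numE denE !hornerZ -mulf_div mulfV// mul1r.
have rootN x : ((rnum r).[x%:C] == 0) = (N.[x] == 0).
  by rewrite numE hornerZ mulf_eq0 (negbTE k0) -/(peval N x%:C) peval_real fmorph_eq0.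
have rootD x : ((rden r).[x%:C] == 0) = (x \in s).
  by rewrite denE hornerZ mulf_eq0 (negbTE k0) -/(peval D x%:C) peval_real fmorph_eq0 prod_XsubC_eq0.
have Ns x : x \in s -> N.[x] != 0.
  by rewrite -rootD => dx; rewrite -rootN; exact: (coprimep_root qp).
have Na x : x \in finpts a -> N.[x] = 0.
  rewrite mem_undup -has_pred1 has_count count_pmap_id a_zeros /= => h.
  by apply/eqP; rewrite -rootN; apply: contraTT h => /mupNroot ->.
have sN : size (rnum r) = size N by rewrite numE size_scale// size_map_poly.
have sD : size (rden r) = (size s).+1 by rewrite denE size_scale// size_map_poly size_prod_XsubC.
(* A zero at infinity means deg N < deg D, that is [size N <= size s]. *)
have hxi : if tnth a ord_max is Some x then x \in finpts a else (size N <= size s)%N.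
  have := mem_tnth ord_max a; case: (tnth a ord_max) => [x|] xa.
    by rewrite mem_undup -has_pred1 has_count count_pmap_id -has_count has_pred1.
  by move: xa; rewrite -has_pred1 has_count a_zeros /= sN sD subn_gt0.
have P_Im z : 0 < Im z -> 0 <= Im (peval N z / peval D z * cauchyQ sigma al be z).
  move=> z0; have zn : Im z != 0 by rewrite gt_eqF.
  by have := PIm z zn; rewrite rE QE// pmulr_lge0// invr_gt0.
have [A [B [c rQE]]] := product_representation irho be0 P_Im Ns.
have B0 := product_infty_ge0 irho be0 P_Im rQE.
have cE x : x \in s -> zeta r Q x = c x.
  move=> xs; apply: rlimE; apply: cvgC_nonreal_eq (product_pole irho be0 P_Im rQE xs) => z z0.
  by rewrite rE QE// mulrA.
have zetaE : zeta_inf r Q = B.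
  apply: rlimE; apply: cvgC_nonreal_eq (product_infty irho be0 P_Im rQE) => z z0.
  by rewrite rE QE.
(* Both sides are the nontangential limit at infinity of r Q / z, the right one computed as r times
   Q / z. *)
have leadE : (size N <= (size s).+1)%N -> B = N`_(size s) * be.
  move=> sNs; have h0 := product_infty irho be0 P_Im rQE.
  have h1 : peval N z / peval D z @[z --> nontangential None] --> ((N`_(size s))%:C : R[i]^o).
    by apply: cvg_trans (ratio_cinfty sNs); apply: cvg_app => U hU K; exact: filterS hU.
  have h2 : peval N z / peval D z * (cauchyQ sigma al be z / z) @[z --> nontangential None] -->
      ((N`_(size s) * be)%:C : R[i]^o).
    rewrite rmorphM; exact: cvgCM h1 (@cauchyQ_infty _ sigma al be irho).
  have E : (fun z : R[i]^o => peval N z / peval D z * (cauchyQ sigma al be z / z) : R[i]^o) =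
      (fun z : R[i]^o => peval N z / peval D z * cauchyQ sigma al be z / z : R[i]^o).
    by apply/funext => z; rewrite mulrA.
  rewrite E in h2.
  by apply: complexI; rewrite -[LHS](cvgC_lim h0) -[RHS](cvgC_lim h2).
(* If infinity is a pole, B is [zeta_inf]. If it is neither zero nor pole, r tends to [gamma_inf]
   and b_1 is finite, so B = gamma beta. *)
have betaeE : betae = if tnth a ord_max is Some _ then B else 0.
  rewrite /betae /beta_e; move: a_last hxi; case: (tnth a ord_max) => [x|]// a_last' _.
  move: b_last; case Eb : (tnth b ord_max) => [y|] bl; last exact: zetaE.
  have Nb : None \notin b by apply/negP => /bl.
  have sNs : (size N <= (size s).+1)%N.
    by rewrite -sN -sD -subn_eq0 -[X in X == _](b_poles None) -leqn0 leqNgt -has_count has_pred1.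
  rewrite leadE// /be; have := mem_tnth ord0 b; case: (tnth b ord0) => [b1|] h; last by rewrite h in Nb.
  congr (_ * _); rewrite /gamma_inf /rlim; under eq_fun do rewrite rE.
  by rewrite (cvgC_lim (ratio_cinfty sNs)).
have B00 : tnth a ord_max = None -> B = 0.
  move=> E; move: hxi; rewrite E => sNs.
  by rewrite leadE ?(leqW sNs)// nth_default// mul0r.
have sqrtrE t : sqrtr r t = Num.sqrt `|N.[t] / D.[t]|.
  by rewrite /sqrtr rE !peval_real -fmorphV -rmorphM normc_cn -[Re _]/(cn (N.[t] / D.[t])%:C) cn_real.
(* The residue enters through zeta = c; in the case a_n = infinity the indicator, which is 0 or 1,
   moves out of the square root. *)
have omE : omegae = fun t => (omega_p b N (tnth a ord_max) c t)%:C.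
  apply/funext => t; rewrite /omegae /omega_e /omega_p /patch_on /kap; congr (_%:C).
  have zE x : x \in finpts b -> zeta r Q x = c x by rewrite mem_undup; exact: cE.
  case: (tnth a ord_max) => [x|].
    rewrite sqrtrE; congr (_ + _); first by rewrite mulrAC mulrA.
    by apply: eq_big_seq => y yb; rewrite zE// mulrA.
  rewrite sqrtrE; congr (_ + _); first by rewrite divr1.
  apply: eq_big_seq => y yb; rewrite zE// divr1 indicE.
  by case: (_ \in _); rewrite ?mul1r// !mul0r sqrtr0.
have c0 x : x \in s -> 0 <= c x by exact: (product_pole_ge0 irho be0 P_Im rQE).
have [|eta etaE] := transformed_weyl irho be0 P_Im Ns Na _ c0 B00 rQE.
  by move: hxi; case: (tnth a ord_max).
have omL : wL2 sigmae (wminus (tnth a ord_max)) (fun t => (omega_p b N (tnth a ord_max) c t)%:C).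
  apply: (omega_p_mem irho be0 P_Im Ns Na).
  by move: hxi; case: (tnth a ord_max).
have rQW z : Im z != 0 -> rQ z = weylfun sigmae betae (tnth a ord_max) omegae eta z.
  by move=> z0; rewrite /rQ rE QE// etaE// omE betaeE.
rewrite -omE in omL.
(* The Weyl function tends to its own parameter at a_n, which identifies [eta] with the prescribed
   limit [etaa]. *)
have lim : rQ z @[z --> nontangential (tnth a ord_max)] --> (eta%:C : R[i]^o).
  apply: (@cvgC_nonreal_eq R _ (weylfun sigmae betae (tnth a ord_max) omegae eta) rQ).
    by move=> z z0; rewrite rQW.
  exact: weylfun_nontangential.
have etaaE : etaa = eta by exact: rlimE.
have betae0 : 0 <= betae by rewrite betaeE; case: (tnth a ord_max).
have adm : admissible sigmae betae by exact: admissible_sigma_e.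
rewrite etaaE; split => //.
  exact/(HminusP sigmae betae (tnth a ord_max) (omegae, 1)).
exact: weylfun_realized.
Qed.
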